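(* Let $M$ be a closed Kähler manifold with first Chern class $c_1(M)>0$, and let $g(t)$, $t\in[0,+\infty)$, be a solution to the Kähler Ricci flow $\frac{\partial g_{i\bar j}}{\partial t}=g_{i\bar j}-R_{i\bar j}$ on $M$. Let $Rm$ and $W$ denote the Riemannian curvature tensor and the Weyl tensor of $g(t)$. Then $\sup_{M\times[0,+\infty)}|Rm|<\infty$ if and only if $\sup_{M\times[0,+\infty)}|W|<\infty$.
   Context: $R_{i\bar j}$ are the components of the Ricci tensor of $g(t)$ in local holomorphic coordinates. $Rm$ and $W$ are those of the underlying Riemannian metric of $g(t)$: in real dimension $m\ge 3$ the Weyl tensor is defined by the orthogonal decomposition $Rm=-\frac{R}{2(m-1)(m-2)}\,g\odot g+\frac{1}{m-2}\,Rc\odot g+W$, where $R$ is the scalar curvature, $Rc$ the Ricci tensor and $\odot$ the Kulkarni–Nomizu product. At each time $t$ the norms $|Rm|$ and $|W|$ are the tensor norms taken with respect to $g(t)$. *)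

(* Defs.v *)
From mathcomp Require Export all_boot all_order all_algebra.
From mathcomp Require Export complex.
From mathcomp Require Export all_classical all_reals all_analysis.

Set Implicit Arguments.
Unset Strict Implicit.
Unset Printing Implicit Defensive.

Import Order.TTheory GRing.Theory Num.Theory.
Import numFieldNormedType.Exports.

Local Open Scope classical_set_scope.
Local Open Scope ring_scope.

Section Calculus.
Context {R : realType} {m : nat}.

Definition partial (a : 'I_m) (f : 'rV[R]_m -> R) (x : 'rV[R]_m) : R :=
  'D_(delta_mx 0 a) f x.

Definition partials (s : seq 'I_m) (f : 'rV[R]_m -> R) : 'rV[R]_m -> R :=
  foldr partial f s.

(* C^oo on an open set U. *)
Definition smooth_on (U : set 'rV[R]_m) (f : 'rV[R]_m -> R) : Prop :=
  forall (s : seq 'I_m) (x : 'rV[R]_m), U x ->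
    {for x, continuous (partials s f)} /\
    forall a : 'I_m, derivable (partials s f) x (delta_mx 0 a).

(* Derivatives in time are taken inside [0, +oo[, so they are the usual ones
   for t > 0 and right derivatives at t = 0. *)
Definition time_quotient (f : R -> R) (t h : R) : R :=
  h^-1 * (f (t + h) - f t).

Definition time_nbhs (t : R) : set_system R :=
  within [set h | 0 <= t + h] 0^'.

Definition time_derivable (f : R -> R) (t : R) : Prop :=
  cvg (time_quotient f t @ time_nbhs t).

Definition time_derive (f : R -> R) (t : R) : R :=
  lim (time_quotient f t @ time_nbhs t).

(* None stands for the time variable. *)
Definition spacetime_partial (o : option 'I_m) (f : R -> 'rV[R]_m -> R) :
    R -> 'rV[R]_m -> R :=
  fun t x => if o is Some a then partial a (f t) x else time_derive (f ^~ x) t.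

Definition spacetime_partials (s : seq (option 'I_m))
    (f : R -> 'rV[R]_m -> R) : R -> 'rV[R]_m -> R :=
  foldr spacetime_partial f s.

(* C^oo on [0, +oo[ x U, up to the boundary t = 0, for U open. *)
Definition spacetime_smooth_on (U : set 'rV[R]_m) (f : R -> 'rV[R]_m -> R) :
    Prop :=
  forall s : seq (option 'I_m),
    {within [set z : R * 'rV[R]_m | 0 <= z.1 /\ U z.2],
       continuous (fun z => spacetime_partials s f z.1 z.2)} /\
    forall (t : R) (x : 'rV[R]_m), 0 <= t -> U x ->
      time_derivable (spacetime_partials s f ^~ x) t /\
      forall a : 'I_m, derivable (spacetime_partials s f t) x (delta_mx 0 a).

End Calculus.

(* Riemannian geometry in one coordinate chart: g y is the Gram matrix
   (g_ab)(y) of the coordinate frame. *)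
Section LocalGeometry.
Context {R : realType} {m : nat}.
Implicit Types (g : 'rV[R]_m -> 'M[R]_m) (x : 'rV[R]_m) (a b c d : 'I_m).

(* Gamma_ab^c *)
Definition christoffel g x a b c : R :=
  2^-1 * \sum_d invmx (g x) c d *
    (partial a (fun y => g y b d) x + partial b (fun y => g y a d) x
     - partial d (fun y => g y a b) x).

(* R(e_a, e_b) e_c = \sum_d (curvature_op g x a b) c d e_d,
   where R(X, Y) = [nabla_X, nabla_Y] - nabla_[X, Y] *)
Definition curvature_op g x a b : 'M[R]_m :=
  \matrix_(c, d)
    (partial a (fun y => christoffel g y b c d) x
     - partial b (fun y => christoffel g y a c d) x
     + \sum_e (christoffel g x b c e * christoffel g x a e d
               - christoffel g x a c e * christoffel g x b e d)).

(* Covariant 4-tensors are given by their components. *)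
Definition tensor4 := 'I_m -> 'I_m -> 'I_m -> 'I_m -> R.

(* Rm(X, Y, Z, V) = g(R(X, Y) V, Z): Rm(X, Y, X, Y) is the sectional curvature
   of an orthonormal pair, so that Rm = 1/2 g (.) g on the unit sphere. *)
Definition Rm g x : tensor4 := fun a b c d =>
  \sum_e curvature_op g x a b d e * g x e c.

Definition Rc g x : 'M[R]_m :=
  \matrix_(b, d) \sum_a curvature_op g x a b d a.

Definition scalar_curvature g x : R :=
  \sum_a \sum_b invmx (g x) a b * Rc g x a b.

Definition kulkarni_nomizu (h k : 'M[R]_m) : tensor4 := fun a b c d =>
  h a c * k b d + h b d * k a c - h a d * k b c - h b c * k a d.

Definition weyl g x : tensor4 := fun a b c d =>
  Rm g x a b c d
  + scalar_curvature g x / (2 * (m%:R - 1) * (m%:R - 2))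
    * kulkarni_nomizu (g x) (g x) a b c d
  - (m%:R - 2)^-1 * kulkarni_nomizu (Rc g x) (g x) a b c d.

Definition tensor4_norm (h : 'M[R]_m) (T : tensor4) : R :=
  Num.sqrt (\sum_a \sum_b \sum_c \sum_d \sum_a' \sum_b' \sum_c' \sum_d'
    invmx h a a' * invmx h b b' * invmx h c c' * invmx h d d'
    * T a b c d * T a' b' c' d').

End LocalGeometry.

(* C^n is 'rV[R]_(n + n), with z^k = x^k + i x^(n+k). Vectors are rows, so
   multiplication by i is v |-> v *m Jmx. *)
Definition Jmx {R : realType} {n : nat} : 'M[R]_(n + n) :=
  block_mx 0 1%:M (- 1%:M) 0.

Definition holomorphic_at (R : realType) (n : nat)
    (f : 'rV[R]_(n + n) -> 'rV[R]_(n + n)) (x : 'rV[R]_(n + n)) : Prop :=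
  differentiable f x /\ forall v, 'd f x (v *m Jmx) = 'd f x v *m Jmx.

Record complex_manifold (R : realType) (n : nat) := ComplexManifold {
  carrier :> topologicalType;
  chart_index : Type;
  chart_dom : chart_index -> set carrier;
  chart : chart_index -> carrier -> 'rV[R]_(n + n);
  chart_inv : chart_index -> 'rV[R]_(n + n) -> carrier;
  manifold_hausdorff : hausdorff_space carrier;
  manifold_second_countable : @second_countable carrier;
  chart_cover : forall p, exists i, chart_dom i p;
  chart_dom_open : forall i, open (chart_dom i);
  chart_img_open : forall i, open (chart i @` chart_dom i);
  chartK : forall i p, chart_dom i p -> chart_inv i (chart i p) = p;
  chart_continuous : forall i, {within chart_dom i, continuous (chart i)};
  chart_inv_continuous : forall i,
    {within chart i @` chart_dom i, continuous (chart_inv i)};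
  transition_holomorphic : forall i j p, chart_dom i p -> chart_dom j p ->
    holomorphic_at (chart j \o chart_inv i) (chart i p)
}.

Section KahlerGeometry.
Context {R : realType} {n : nat} (M : complex_manifold R n).
Local Notation I := (chart_index M).
Local Notation V := ('rV[R]_(n + n)).

Definition chart_img (i : I) : set V := chart i @` chart_dom i.

(* Rows of the Jacobian are the images of the coordinate vectors of chart i. *)
Definition transition_jacobian (i j : I) (p : M) : 'M[R]_(n + n) :=
  jacobian (chart j \o chart_inv i) (chart i p).

(* Tensor fields are given by their components in each chart; only the values
   on chart_img i are meaningful. *)
Definition tensor1 := I -> V -> V.
Definition tensor2 := I -> V -> 'M[R]_(n + n).

Definition smooth_1form (eta : tensor1) : Prop :=
  (forall i a, smooth_on (chart_img i) (fun x => eta i x 0 a)) /\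
  (forall i j p, chart_dom i p -> chart_dom j p ->
     eta i (chart i p) = eta j (chart j p) *m (transition_jacobian i j p)^T).

Definition smooth_tensor2 (T : tensor2) : Prop :=
  (forall i a b, smooth_on (chart_img i) (fun x => T i x a b)) /\
  (forall i j p, chart_dom i p -> chart_dom j p ->
     T i (chart i p) = transition_jacobian i j p *m T j (chart j p)
                       *m (transition_jacobian i j p)^T).

(* omega(X, Y) = g(J X, Y) *)
Definition kahler_form (g : tensor2) : tensor2 := fun i x => Jmx *m g i x.

Definition closed_2form (w : tensor2) : Prop :=
  forall i x a b c, chart_img i x ->
    partial a (fun y => w i y b c) x + partial b (fun y => w i y c a) x
    + partial c (fun y => w i y a b) x = 0.

Definition kahler_metric (g : tensor2) : Prop :=
  [/\ smooth_tensor2 g,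
      (forall i x, chart_img i x -> (g i x)^T = g i x),
      (forall i x (v : V), chart_img i x -> v != 0 ->
         0 < (v *m g i x *m v^T) 0 0),
      (forall i x, chart_img i x -> Jmx *m g i x *m Jmx^T = g i x) &
      closed_2form (kahler_form g)].

Definition ext_deriv (eta : tensor1) : tensor2 := fun i x =>
  \matrix_(a, b) (partial a (fun y => eta i y 0 b) x
                  - partial b (fun y => eta i y 0 a) x).

(* The Levi-Civita connection of a Kahler metric g is a complex connection on
   (TM, J). With Omega its curvature, the Chern-Weil form i/(2 pi) tr_C Omega
   is tr_R (J Omega)/(4 pi), since tr_C A = (tr_R A - i tr_R (J A))/2 and
   tr_R Omega = 0. *)
Definition chern_form (g : tensor2) : tensor2 := fun i x =>
  \matrix_(a, b) ((4 * pi)^-1 * \tr (curvature_op (g i) x a b *m Jmx)).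

Definition represents_c1 (w : tensor2) : Prop :=
  exists (g : tensor2) (eta : tensor1),
    [/\ kahler_metric g, smooth_1form eta &
        forall i x, chart_img i x ->
          w i x = chern_form g i x + ext_deriv eta i x].

(* A closed positive (1,1)-form is the Kahler form of a Kahler metric. *)
Definition c1_positive : Prop :=
  exists h : tensor2, kahler_metric h /\ represents_c1 (kahler_form h).

(* T(d/dz^j, d/dzbar^k) for the complex bilinear extension of T. *)
Definition d_dz (j : 'I_n) : 'rV[R[i]]_(n + n) :=
  2^-1 *: (delta_mx 0 (lshift n j) - 'i%C *: delta_mx 0 (rshift n j)).
Definition d_dzbar (k : 'I_n) : 'rV[R[i]]_(n + n) :=
  2^-1 *: (delta_mx 0 (lshift n k) + 'i%C *: delta_mx 0 (rshift n k)).
Definition hermitian_comp (T : 'M[R]_(n + n)) (j k : 'I_n) : R[i] :=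
  (d_dz j *m map_mx (real_complex R) T *m (d_dzbar k)^T) 0 0.

Definition kahler_ricci_flow (g : R -> tensor2) : Prop :=
  [/\ (forall t, 0 <= t -> kahler_metric (g t)),
      (forall i a b,
         spacetime_smooth_on (chart_img i) (fun t x => g t i x a b)) &
      forall t i x j k, 0 <= t -> chart_img i x ->
        hermitian_comp (\matrix_(a, b) time_derive (fun s => g s i x a b) t) j k
        = hermitian_comp (g t i x) j k - hermitian_comp (Rc (g t i) x) j k].

(* The supremum over M x [0, +oo[ of the g(t)-norm of the 4-tensor
   T (g t), where T is a local expression such as Rm or weyl. *)
Definition sup_norm (T : (V -> 'M[R]_(n + n)) -> V -> tensor4)
    (g : R -> tensor2) : \bar R :=
  ereal_sup [set y | exists t i x, [/\ 0 <= t, chart_img i x &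
    y = (tensor4_norm (g t i x) (T (g t i) x))%:E]].

End KahlerGeometry.

(* Main.v *)
From HB Require Import structures.
From mathcomp Require Import ring lra zify.
Require Import Defs.

Set Implicit Arguments.
Unset Strict Implicit.
Unset Printing Implicit Defensive.

Import Order.TTheory GRing.Theory Num.Theory.
Import numFieldNormedType.Exports.

Local Open Scope classical_set_scope.
Local Open Scope ring_scope.

(* Contract Rm = - R/(2(m-1)(m-2)) g (.) g + 1/(m-2) Rc (.) g + W with the complex
   structure J in two slots. Since Rm commutes with J this contraction of Rm is
   Rc again, whence (m-2) J(W) = (m-4) Rc + R/(m-1) g. So |W| controls R, and,
   when m > 4, also Rc and therefore Rm, pointwise.

   For m = 4 only R is controlled pointwise and Rc needs the flow, along which
   (Lap being half the Laplace-Beltrami operator)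
     d_t R = Lap R - R + |Rc|^2,
     d_t |Rc|^2 = Lap |Rc|^2 - 2 |d Rc|^2 + 2 Rm(Rc, Rc) - 2 |Rc|^2.
   In complex dimension 2, Cayley-Hamilton removes tr Rc^3 from Rm(Rc, Rc), which
   is then at most a |Rc|^2 + const, with a depending on the bounds for W and R.
   At a maximum of |Rc|^2 - 2a R at a positive time, the evolution equations give
   0 <= const - |Rc|^2 + a R, which bounds |Rc| there.

   The evolution equations are identities in the commutative ring of smooth
   functions: matrices commuting with J play the role of complex matrices, the
   Christoffel matrices are (d_a g) g^-1 with d_a = d/dz, and the curvature is
   their d/dzbar derivative. *)

(** * Derivations and Wirtinger operators *)

(** At m = 4 the part Rc (.) g of Rm contributes R |Rc|^2 and tr Rc^3 to Rm(Rc, Rc). A genuinely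
    cubic term could not be absorbed by any reaction term available; once tr Rc^3 is expressed
    through R and |Rc|^2, everything is linear in |Rc|^2 with coefficients bounded by W and R. The
    barrier works because d_t R contains |Rc|^2: subtracting 2a R removes exactly 2a |Rc|^2, and the
    -2 |Rc|^2 that comes from the term g of the normalised flow is left over to close the estimate,
    with a constant independent of time.

    The maximum has to be taken of one function on M x [0, T], continuous up to t = 0 and
    independent of charts, while transition maps are only known to be complex differentiable. Both
    properties are read off the flow equation, which expresses Rc by g and its time derivative.
    Local identities are needed twice: in space at each fixed t >= 0, and in space-time on the open
    set t > 0; one abstract family of directions serves for both. *)

Record derivation (A : comPzRingType) := Derivation {
  der :> A -> A;
  derD : {morph der : x y / x + y};
  derM : forall x y, der (x * y) = der x * y + x * der y }.

Arguments der : simpl never.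

Section Derivation.
Context {A : comPzRingType}.
Implicit Types (d : derivation A) (x y : A).

Lemma der0 d : d 0 = 0.
Proof. by apply: (addIr (d 0)); rewrite add0r -derD addr0. Qed.

Lemma derN d : {morph d : x / - x}.
Proof. by move=> x; apply: (addIr (d x)); rewrite -derD !addNr der0. Qed.

Lemma derB d : {morph d : x y / x - y}.
Proof. by move=> x y; rewrite derD derN. Qed.

Lemma der_sum d (I : Type) (r : seq I) (P : pred I) (F : I -> A) :
  d (\sum_(i <- r | P i) F i) = \sum_(i <- r | P i) d (F i).
Proof. exact: (big_morph d (derD d) (der0 d)). Qed.

Lemma der1 d : d 1 = 0.
Proof.
by apply: (addIr (d 1)); rewrite add0r -{3}[1]mulr1 derM mulr1 mul1r.
Qed.

Lemma der_nat d n : d n%:R = 0.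
Proof. by elim: n => [|n IHn]; rewrite ?der0 // mulrS derD der1 IHn addr0. Qed.

Lemma der_half d (h : A) : h + h = 1 -> d h = 0.
Proof.
move=> hh; have := derD d h h; rewrite hh der1 => e.
by rewrite -[LHS]mul1r -hh mulrDl -mulrDr -e mulr0.
Qed.

Lemma der_cstM d x y : d x = 0 -> d (x * y) = x * d y.
Proof. by move=> dx0; rewrite derM dx0 mul0r add0r. Qed.

Local Notation dmx d X := (map_mx (der d) X).

Lemma dmxD m n d (X Y : 'M[A]_(m, n)) : dmx d (X + Y) = dmx d X + dmx d Y.
Proof. by apply/matrixP=> i j; rewrite !mxE derD. Qed.

Lemma dmxN m n d (X : 'M[A]_(m, n)) : dmx d (- X) = - dmx d X.
Proof. by apply/matrixP=> i j; rewrite !mxE derN. Qed.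

Lemma dmxZ_cst m n d x (X : 'M[A]_(m, n)) : d x = 0 -> dmx d (x *: X) = x *: dmx d X.
Proof. by move=> dx0; apply/matrixP=> i j; rewrite !mxE der_cstM. Qed.

Lemma dmxM m n p d (X : 'M[A]_(m, n)) (Y : 'M[A]_(n, p)) :
  dmx d (X *m Y) = dmx d X *m Y + X *m dmx d Y.
Proof.
apply/matrixP=> i j; rewrite !mxE der_sum -big_split /=.
by apply: eq_bigr => k _; rewrite derM !mxE.
Qed.

Lemma dmx_cstM m n p d (X : 'M[A]_(m, n)) (Y : 'M[A]_(n, p)) :
  dmx d X = 0 -> dmx d (X *m Y) = X *m dmx d Y.
Proof. by move=> dX0; rewrite dmxM dX0 mul0mx add0r. Qed.

Lemma dmxT m n d (X : 'M[A]_(m, n)) : dmx d X^T = (dmx d X)^T.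
Proof. by apply/matrixP=> i j; rewrite !mxE. Qed.

Lemma der_mxtrace m d (X : 'M[A]_m) : d (\tr X) = \tr (dmx d X).
Proof. by rewrite /mxtrace der_sum; apply: eq_bigr => i _; rewrite mxE. Qed.

Lemma dmx_inv m d (X Y : 'M[A]_m) : X *m Y = 1%:M -> Y *m X = 1%:M ->
  dmx d Y = - (Y *m dmx d X *m Y).
Proof.
move=> XY YX; have d1 : dmx d (1%:M : 'M[A]_m) = 0.
  apply/matrixP=> i j; rewrite !mxE; case: eqP => _ /=; last exact: der0.
  by rewrite der1.
apply/eqP; rewrite -addr_eq0; apply/eqP.
have := congr1 (mulmx Y) (dmxM d X Y); rewrite XY d1 mulmx0 mulmxDr !mulmxA YX.
by rewrite mul1mx addrC => /esym.
Qed.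

Section LinComb.
Variables (m : nat) (c : 'I_m -> A) (p : 'I_m -> derivation A).

Fact lin_derD : {morph (fun x => \sum_b c b * p b x) : x y / x + y}.
Proof.
by move=> x y; rewrite -big_split; apply: eq_bigr => b _; rewrite derD mulrDr.
Qed.

Fact lin_derM x y : \sum_b c b * p b (x * y) =
  (\sum_b c b * p b x) * y + x * (\sum_b c b * p b y).
Proof.
rewrite mulr_suml mulr_sumr -big_split; apply: eq_bigr => b _ /=.
by rewrite derM; ring.
Qed.

Definition lin_der := Derivation lin_derD lin_derM.

Lemma lin_derE x : lin_der x = \sum_b c b * p b x.
Proof. by []. Qed.
End LinComb.

End Derivation.

Notation dmx d X := (map_mx (der d) X).

Section Wirtinger.
Context {A : comPzRingType} {m : nat}.
Variables (pd : 'I_m -> derivation A) (J : 'M[A]_m) (h : A).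
Hypothesis hh : h + h = 1.
Hypothesis pdC : forall a b x, pd a (pd b x) = pd b (pd a x).
Hypothesis pdJ : forall a, dmx (pd a) J = 0.
Hypothesis JJ : J *m J = - 1%:M.
Hypothesis JT : J^T = - J.
Implicit Types (X Y : 'M[A]_m) (s : bool).

(** The derivative along J e_a: vectors are rows, so J e_a has row a of J as its coordinates. *)
Definition pdJdir a : derivation A := lin_der (J a) pd.

(* On matrices commuting with J, multiplication by J plays the role of i:
   [wirt true] is d/dz and [wirt false] is d/dzbar. *)
Definition wirt s a X : 'M[A]_m :=
  h *: (dmx (pd a) X + (-1) ^+ s *: (J *m dmx (pdJdir a) X)).

Lemma pdJ_entry a i j : pd a (J i j) = 0.
Proof. by have /matrixP/(_ i j) := pdJ a; rewrite !mxE. Qed.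

Lemma pdJdirJ a : dmx (pdJdir a) J = 0.
Proof.
by apply/matrixP=> i j; rewrite !mxE lin_derE big1 // => b _; rewrite pdJ_entry mulr0.
Qed.

Lemma pd_pdJdirC a b x : pd a (pdJdir b x) = pdJdir b (pd a x).
Proof.
by rewrite !lin_derE der_sum; apply: eq_bigr => c _; rewrite der_cstM ?pdJ_entry // pdC.
Qed.

Lemma pdJdirC a b x : pdJdir a (pdJdir b x) = pdJdir b (pdJdir a x).
Proof.
transitivity (\sum_c \sum_d J a c * J b d * pd c (pd d x)).
  rewrite lin_derE; apply: eq_bigr => c _; rewrite pd_pdJdirC lin_derE mulr_sumr.
  by apply: eq_bigr => d _; rewrite mulrA (pdC c).
rewrite exchange_big lin_derE; apply: eq_bigr => d _; rewrite pd_pdJdirC lin_derE mulr_sumr.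
by apply: eq_bigr => c _; rewrite mulrCA mulrA.
Qed.

Lemma JJE i j : \sum_k J i k * J k j = - (i == j)%:R.
Proof. by have /matrixP/(_ i j) := JJ; rewrite !mxE. Qed.

Lemma pdJdir2 a x : \sum_b J a b * pdJdir b x = - pd a x.
Proof.
transitivity (\sum_c (\sum_b J a b * J b c) * pd c x).
  under eq_bigr do rewrite lin_derE mulr_sumr.
  rewrite exchange_big; apply: eq_bigr => c _; rewrite mulr_suml.
  by apply: eq_bigr => b _; rewrite mulrA.
under eq_bigr do rewrite JJE.
rewrite (bigD1 a) //= eqxx big1 ?addr0 ?mulN1r // => b /negPf.
by rewrite eq_sym => ->; rewrite oppr0 mul0r.
Qed.

Lemma sgn_der (d : derivation A) s : d ((-1) ^+ s) = 0.
Proof. by case: s; rewrite ?expr1 ?derN ?der1 ?oppr0 // expr0 der1. Qed.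

Let dh (d : derivation A) : d h = 0 := der_half d hh.

Lemma wirtD s a X Y : wirt s a (X + Y) = wirt s a X + wirt s a Y.
Proof. by rewrite /wirt !dmxD mulmxDr !scalerDr addrACA. Qed.

Lemma wirtN s a X : wirt s a (- X) = - wirt s a X.
Proof. by rewrite /wirt !dmxN mulmxN scalerN -opprD scalerN. Qed.

Lemma wirtB s a X Y : wirt s a (X - Y) = wirt s a X - wirt s a Y.
Proof. by rewrite wirtD wirtN. Qed.

(** The J in front of the second half of [wirt] has to pass the left factor; this is why commutation
    with J is checked for every matrix that gets differentiated. *)
Lemma wirtM s a X Y : J *m X = X *m J ->
  wirt s a (X *m Y) = wirt s a X *m Y + X *m wirt s a Y.
Proof.
move=> XJ; rewrite /wirt !dmxM -scalemxAl -scalemxAr -scalerDr; congr (_ *: _).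
rewrite [in RHS]mulmxDl [in RHS]mulmxDr [in RHS]addrACA; congr (_ + _).
by rewrite -scalemxAl -scalemxAr -scalerDr mulmxDr !mulmxA XJ.
Qed.

Lemma dmxC (d d' : derivation A) X : (forall x, d (d' x) = d' (d x)) ->
  dmx d (dmx d' X) = dmx d' (dmx d X).
Proof. by move=> dC; apply/matrixP=> i j; rewrite !mxE dC. Qed.

Lemma scalerC (c d : A) X : c *: (d *: X) = d *: (c *: X).
Proof. by rewrite !scalerA mulrC. Qed.

Lemma wirtZ s a c X : (forall d : derivation A, d c = 0) ->
  wirt s a (c *: X) = c *: wirt s a X.
Proof.
move=> dc; rewrite /wirt !dmxZ_cst ?dc // -scalemxAr.
by rewrite (scalerC _ c) -scalerDr scalerC.
Qed.

Lemma wirt_mulJ s a X : wirt s a (J *m X) = J *m wirt s a X.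
Proof.
rewrite /wirt !dmx_cstM ?pdJ ?pdJdirJ // -scalemxAr.
by congr (_ *: _); rewrite mulmxDr -scalemxAr.
Qed.

Lemma wirt_dmx s a (d : derivation A) X : dmx d J = 0 ->
    (forall b x, d (pd b x) = pd b (d x)) ->
    (forall b x, d (pdJdir b x) = pdJdir b (d x)) ->
  wirt s a (dmx d X) = dmx d (wirt s a X).
Proof.
move=> dJ dC dJC; rewrite /wirt dmxZ_cst // dmxD dmxZ_cst ?sgn_der // dmx_cstM //.
by rewrite (dmxC _ (dC a)) (dmxC _ (dJC a)).
Qed.

Lemma wirtC s t a b X : wirt s a (wirt t b X) = wirt t b (wirt s a X).
Proof.
rewrite [wirt t b X]/wirt wirtZ // wirtD wirtZ => [|d]; last exact: sgn_der.
rewrite wirt_mulJ !wirt_dmx ?pdJ ?pdJdirJ // => c x;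
  by [rewrite pdJdirC | rewrite pd_pdJdirC | rewrite pdC].
Qed.

Lemma wirt_pd a X : wirt true a X + wirt false a X = dmx (pd a) X.
Proof.
rewrite /wirt expr1 expr0 scale1r scaleN1r -scalerDr addrACA addNr addr0.
by rewrite scalerDr -scalerDl hh scale1r.
Qed.

Lemma commJ_dmx (d : derivation A) X : dmx d J = 0 -> J *m X = X *m J ->
  J *m dmx d X = dmx d X *m J.
Proof.
by move=> dJ XJ; rewrite -dmx_cstM // XJ dmxM dJ mulmx0 addr0.
Qed.

Lemma commJ_wirt s a X : J *m X = X *m J -> J *m wirt s a X = wirt s a X *m J.
Proof.
move=> XJ; rewrite /wirt -scalemxAl -scalemxAr; congr (_ *: _).
rewrite mulmxDr mulmxDl -scalemxAl -scalemxAr -mulmxA.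
by rewrite -!commJ_dmx ?pdJ ?pdJdirJ.
Qed.

(** Since J^T = -J, transposition is the conjugate transposition of complex matrices, and so
    exchanges d/dz and d/dzbar. *)
Lemma wirtT s a X : J *m X = X *m J -> (wirt s a X)^T = wirt (~~ s) a X^T.
Proof.
move=> XJ; rewrite /wirt linearZ linearD linearZ /= trmx_mul JT -!dmxT.
congr (_ *: (_ + _)); rewrite mulmxN -commJ_dmx ?pdJdirJ //; last first.
  by have := congr1 trmx XJ; rewrite !trmx_mul JT mulmxN mulNmx => /oppr_inj.
by rewrite signrN scaleNr scalerN.
Qed.

(** The direction enters complex linearly in d/dz and antilinearly in d/dzbar. *)
Lemma wirtJ s a X : \sum_b J a b *: wirt s b X = (-1) ^+ s *: - (J *m wirt s a X).
Proof.
transitivity (h *: (dmx (pdJdir a) X - (-1) ^+ s *: (J *m dmx (pd a) X))).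
  under eq_bigr do rewrite /wirt scalerA mulrC -scalerA scalerDr.
  rewrite -scaler_sumr big_split /=; congr (_ *: (_ + _)).
    by apply/matrixP=> i j; rewrite summxE !mxE lin_derE; apply: eq_bigr => b _; rewrite !mxE.
  rewrite -scalerN -mulmxN.
  under eq_bigr do rewrite scalerA mulrC -scalerA scalemxAr.
  rewrite -scaler_sumr -mulmx_sumr; congr (_ *: (_ *m _)).
  apply/matrixP=> i j; rewrite summxE !mxE -pdJdir2.
  by apply: eq_bigr => b _; rewrite !mxE.
rewrite /wirt -scalemxAr scalerN !scalerA mulrC -scalerA -scalerN; congr (_ *: _).
rewrite mulmxDr scalerDr -scalemxAr scalerA -expr2 sqrr_sign scale1r mulmxA JJ.
by rewrite mulNmx mul1mx opprD opprK addrC.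
Qed.

End Wirtinger.

(** * Kähler curvature over a differential ring *)

Lemma sum4_swap (A : nmodType) (I : finType) (F : I -> I -> I -> I -> A) :
  \sum_b \sum_d \sum_p \sum_q F b d p q = \sum_b \sum_d \sum_p \sum_q F p q b d.
Proof.
have e (G : I -> I -> I -> I -> A) : \sum_b \sum_d \sum_p \sum_q G b d p q =
    \sum_(x : I * I) \sum_(y : I * I) G x.1 x.2 y.1 y.2.
  by rewrite pair_bigA; apply: eq_bigr => x _; rewrite pair_bigA.
by rewrite !e exchange_big.
Qed.

Lemma mxtrace_mulE (A : pzSemiRingType) m (X Y : 'M[A]_m) :
  \tr (X *m Y) = \sum_p \sum_q X p q * Y q p.
Proof. by apply: eq_bigr => p _; rewrite mxE. Qed.

Lemma mx_mulE (A : pzSemiRingType) m (X Y : 'M[A]_m) i j :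
  (X *m Y) i j = \sum_k X i k * Y k j.
Proof. by rewrite mxE. Qed.

Lemma mxtrace_mulAC (A : comPzSemiRingType) m (X Y W : 'M[A]_m) :
  \tr (X *m Y *m W) = \tr (Y *m (W *m X)).
Proof. by rewrite -mulmxA mxtrace_mulC mulmxA. Qed.

(** The index computation behind [hess_contraction], with V the second covariant derivative of Rc
    and K the curvature. The left side contracts V with P in the derivative indices b, d and gi in
    the tensor indices p, q, then the other way round. Exchanging d with q is free by the first
    hypothesis; exchanging b with p costs the two curvature terms of the last one. *)
Lemma swap_contraction (A : comPzRingType) m (gi X : 'M[A]_m)
    (V K : 'I_m -> 'I_m -> 'M[A]_m) (P := gi *m X) :
    (forall b d p q, V b d p q = V b q p d) ->
    (forall b d p q, K b d p q = K p d b q) ->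
    (forall b d p q, V b d p q - V p d b q = (X *m K p d) b q - (X *m K b d) p q) ->
  \sum_b \sum_d P d b * \tr (V b d *m gi)
  - \sum_b \sum_d gi d b * \tr (X *m V b d *m gi)
  = \sum_b \sum_d (P *m X) d b * \tr (K b d *m gi)
    - \sum_b \sum_d P d b * \tr (K b d *m P).
Proof.
move=> Vr KC Vs.
have -> : \sum_b \sum_d gi d b * \tr (X *m V b d *m gi) =
    \sum_b \sum_d \sum_p \sum_q P d b * (gi q p * V p d b q).
  rewrite [RHS]sum4_swap; apply: eq_bigr => b _; apply: eq_bigr => d _.
  rewrite mxtrace_mulAC -/P mxtrace_mulE mulr_sumr; apply: eq_bigr => p _.
  by rewrite mulr_sumr; apply: eq_bigr => q _; rewrite Vr; ring.
have -> : \sum_b \sum_d P d b * \tr (V b d *m gi) =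
    \sum_b \sum_d \sum_p \sum_q P d b * (gi q p * V b d p q).
  apply: eq_bigr => b _; apply: eq_bigr => d _.
  rewrite mxtrace_mulE mulr_sumr; apply: eq_bigr => p _.
  by rewrite mulr_sumr; apply: eq_bigr => q _; ring.
have -> : \sum_b \sum_d P d b * \tr (K b d *m P) =
    \sum_b \sum_d \sum_p \sum_q P d b * (gi q p * (X *m K b d) p q).
  apply: eq_bigr => b _; apply: eq_bigr => d _.
  rewrite -mxtrace_mulAC mxtrace_mulE mulr_sumr; apply: eq_bigr => p _.
  by rewrite mulr_sumr; apply: eq_bigr => q _; ring.
have -> : \sum_b \sum_d (P *m X) d b * \tr (K b d *m gi) =
    \sum_b \sum_d \sum_p \sum_q P d b * (gi q p * (X *m K p d) b q).
  transitivity (\sum_d \sum_r \sum_b \sum_p \sum_q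
      P d b * (gi q p * (X b r * K p d r q))); last first.
    rewrite [RHS]exchange_big; apply: eq_bigr => d _.
    rewrite exchange_big; apply: eq_bigr => b _.
    rewrite exchange_big; apply: eq_bigr => p _.
    rewrite exchange_big; apply: eq_bigr => q _.
    by rewrite (mx_mulE X) !mulr_sumr.
  rewrite exchange_big; apply: eq_bigr => d _; apply: eq_bigr => r _.
  rewrite (mx_mulE P) mulr_suml; apply: eq_bigr => b _.
  rewrite mxtrace_mulE mulr_sumr; apply: eq_bigr => p _.
  by rewrite mulr_sumr; apply: eq_bigr => q _; rewrite KC; ring.
rewrite -!sumrB; apply: eq_bigr => b _; rewrite -!sumrB; apply: eq_bigr => d _.
rewrite -!sumrB; apply: eq_bigr => p _; rewrite -!sumrB; apply: eq_bigr => q _.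
by rewrite -!mulrBr Vs.
Qed.

Section Kahler.
Context {A : comPzRingType} {m : nat}.
Variables (pd : 'I_m -> derivation A) (J g gi : 'M[A]_m) (h : A).
Hypothesis hh : h + h = 1.
Hypothesis pdC : forall a b x, pd a (pd b x) = pd b (pd a x).
Hypothesis pdJ : forall a, dmx (pd a) J = 0.
Hypothesis JJ : J *m J = - 1%:M.
Hypothesis JT : J^T = - J.
Hypothesis gT : g^T = g.
Hypothesis gJ : J *m g = g *m J.
Hypothesis ggi : g *m gi = 1%:M.
Hypothesis gig : gi *m g = 1%:M.
Hypothesis g_closed : forall a b c,
  pd a ((J *m g) b c) + pd b ((J *m g) c a) + pd c ((J *m g) a b) = 0.
Implicit Types (X Y : 'M[A]_m) (a b c d p q : 'I_m).

Local Notation pJ := (pdJdir pd J).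
Local Notation D := (wirt pd J h true).
Local Notation Db := (wirt pd J h false).

(* h is 1/2 and gi is the inverse of g. *)
Definition alg_christoffel a b c : A :=
  h * \sum_d gi c d * (pd a (g b d) + pd b (g a d) - pd d (g a b)).

Definition Gam a : 'M[A]_m := \matrix_(b, c) alg_christoffel a b c.

Definition alg_curv a b : 'M[A]_m :=
  \matrix_(c, d)
    (pd a (alg_christoffel b c d) - pd b (alg_christoffel a c d)
     + \sum_e (alg_christoffel b c e * alg_christoffel a e d
               - alg_christoffel a c e * alg_christoffel b e d)).

Definition alg_ric : 'M[A]_m := \matrix_(b, d) \sum_a alg_curv a b d a.

Lemma two_torsion_free (x : A) : x + x = 0 -> x = 0.
Proof. by move=> x0; rewrite -[x]mul1r -hh mulrDl -mulrDr x0 mulr0. Qed.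

Lemma giT : gi^T = gi.
Proof.
rewrite -[LHS]mulmx1 -ggi mulmxA -[X in _ *m X *m _]gT -trmx_mul ggi.
by rewrite trmx1 mul1mx.
Qed.

Lemma giJ : J *m gi = gi *m J.
Proof.
by rewrite -[LHS]mul1mx -gig -!mulmxA (mulmxA g) -gJ -!mulmxA ggi mulmx1.
Qed.

Lemma gE a b : g a b = g b a.
Proof. by rewrite -[in LHS]gT mxE. Qed.

Lemma giE a b : gi a b = gi b a.
Proof. by rewrite -[in LHS]giT mxE. Qed.

Lemma JE a b : J a b = - J b a.
Proof. by have /matrixP/(_ b a) := JT; rewrite !mxE. Qed.

Lemma JgJ : J *m g *m J = - g.
Proof. by rewrite gJ -mulmxA JJ mulmxN mulmx1. Qed.

Lemma christoffelC a b c : alg_christoffel a b c = alg_christoffel b a c.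
Proof.
congr (_ * _); apply: eq_bigr => d _; congr (_ * _).
by rewrite (gE a b); ring.
Qed.

Lemma GamC a b c : Gam a b c = Gam b a c.
Proof. by rewrite !mxE christoffelC. Qed.

(** Contract the closedness of the Kähler form with J in one index; in two of the three terms J then
    disappears through J g J = -g and J J = -1. *)
Lemma closed_dir a b d :
  pJ a ((J *m g) b d) + pd b (g a d) - pd d (g a b) = 0.
Proof.
have : \sum_q J a q * (pd q ((J *m g) b d) + pd b ((J *m g) d q)
                       + pd d ((J *m g) q b)) = 0.
  by rewrite big1 // => q _; rewrite g_closed mulr0.
under eq_bigr do rewrite !mulrDr.
rewrite !big_split /= -lin_derE.
have -> : \sum_q J a q * pd b ((J *m g) d q) = pd b (g a d).
  under eq_bigr do rewrite -(der_cstM _ (pdJ_entry pdJ b a _)).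
  rewrite -der_sum; congr (pd b _).
  have e : (J *m g *m J) d a = - g d a by rewrite JgJ mxE.
  by rewrite (gE a d) -[g d a]opprK -e mxE -sumrN; apply: eq_bigr => q _; rewrite (JE a q) mulNr mulrC.
have -> // : \sum_q J a q * pd d ((J *m g) q b) = - pd d (g a b).
under eq_bigr do rewrite -(der_cstM _ (pdJ_entry pdJ d a _)).
rewrite -der_sum -derN; congr (pd d _).
transitivity ((J *m (J *m g)) a b); first by rewrite [in RHS]mxE.
by rewrite mulmxA JJ mulNmx mul1mx mxE.
Qed.

(* The closedness of the Kähler form trades the last two terms of the Christoffel
   symbol for a derivative of g along J. *)
Lemma GamE a : Gam a = D a g *m gi.
Proof.
apply/matrixP=> b c; rewrite !mxE /alg_christoffel mulr_sumr.
apply: eq_bigr => d _; rewrite (giE c d) !mxE [RHS]mulrC mulrCA; congr (_ * (_ * _)).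
rewrite expr1 mulN1r -addrA; congr (_ + _).
have := closed_dir a b d; rewrite mxE der_sum => /eqP; rewrite -addrA addrC addr_eq0.
move=> /eqP ->; congr (- _); apply: eq_bigr => p _.
by rewrite mxE der_cstM //; have /matrixP/(_ b p) := pdJdirJ pdJ a; rewrite !mxE.
Qed.

Lemma Gamg a : Gam a *m g = D a g.
Proof. by rewrite GamE -mulmxA gig mulmx1. Qed.

Lemma GamJ a : J *m Gam a = Gam a *m J.
Proof.
by rewrite GamE mulmxA commJ_wirt // -!mulmxA giJ.
Qed.

Lemma wirt1 s a : wirt pd J h s a 1%:M = 0.
Proof.
have d1 (d : derivation A) : dmx d (1%:M : 'M[A]_m) = 0.
  apply/matrixP=> i j; rewrite !mxE; case: eqP => _ /=; last exact: der0.
  by rewrite der1.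
by rewrite /wirt !d1 mulmx0 scaler0 addr0 scaler0.
Qed.

Lemma wirt_gi s a : wirt pd J h s a gi = - (gi *m wirt pd J h s a g *m gi).
Proof.
apply/eqP; rewrite -addr_eq0; apply/eqP.
have := congr1 (mulmx gi) (wirtM pd h s a gi gJ).
by rewrite ggi wirt1 mulmx0 mulmxDr !mulmxA gig mul1mx addrC => /esym.
Qed.

Lemma D_gi a : D a gi = - (gi *m Gam a).
Proof. by rewrite wirt_gi GamE mulmxA. Qed.

Lemma D_Gam a b : D a (Gam b) = D a (D b g) *m gi - Gam b *m Gam a.
Proof.
rewrite {1}GamE wirtM ?commJ_wirt // D_gi mulmxN; congr (_ - _).
by rewrite mulmxA -GamE.
Qed.

(** Split each [pd] into D + Db. By [D_Gam], D a (Gam b) is symmetric in a and b up to a product of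
    Christoffel matrices, and these products cancel the commutator: the curvature has no (2,0)
    part. *)
Lemma curvE a b : alg_curv a b = Db a (Gam b) - Db b (Gam a).
Proof.
have -> : alg_curv a b = dmx (pd a) (Gam b) - dmx (pd b) (Gam a)
                         + (Gam b *m Gam a - Gam a *m Gam b).
  apply/matrixP=> c d; rewrite !mxE -sumrB; congr (_ + _).
  by apply: eq_bigr => e _; rewrite !mxE.
rewrite -!(wirt_pd pd J hh) !D_Gam (wirtC hh pdC pdJ true true a b).
set X := D b (D a g) *m gi; set U := Gam b *m Gam a; set V := Gam a *m Gam b.
by apply/matrixP=> i j; rewrite !mxE; ring.
Qed.

Lemma curvJ a b : J *m alg_curv a b = alg_curv a b *m J.
Proof.
by rewrite curvE mulmxBr mulmxBl !commJ_wirt ?GamJ.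
Qed.

(** Half the d-th derivative of log det g, by [tauE]. *)
Definition tau d := \tr (Gam d).

(** J X is skew and gi symmetric. In complex terms, the trace of a self-adjoint endomorphism has no
    imaginary part. *)
Lemma mxtrace_sym_J X : X^T = X -> J *m X = X *m J -> \tr (J *m X *m gi) = 0.
Proof.
move=> XT XJ; apply: two_torsion_free.
rewrite -{1}mxtrace_tr !trmx_mul giT XT JT !mulmxN raddfN /= -XJ mxtrace_mulC.
by rewrite addNr.
Qed.

Lemma tauE d : tau d = h * \tr (dmx (pd d) g *m gi).
Proof.
rewrite /tau GamE /wirt -scalemxAl linearZ /= mulmxDl raddfD /=.
rewrite expr1 scaleN1r mulNmx raddfN /= mxtrace_sym_J ?subr0 //.
  by rewrite -dmxT gT.
by rewrite commJ_dmx ?pdJdirJ.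
Qed.

(** The trace of dg gi stands for the derivative of log det g, so that this is the symmetry of the
    second derivatives of log det g, with no logarithm in the ring. *)
Lemma der_trlog (d d' : derivation A) : (forall x, d (d' x) = d' (d x)) ->
  d (\tr (dmx d' g *m gi)) = d' (\tr (dmx d g *m gi)).
Proof.
move=> dC; rewrite !der_mxtrace !dmxM !(dmx_inv _ ggi gig) !mulmxN !raddfB /=.
rewrite (dmxC _ dC); congr (_ - _).
rewrite -[gi *m dmx d g *m gi]mulmxA (mulmxA (dmx d' g)).
by rewrite mxtrace_mulC !mulmxA.
Qed.

Lemma tau_closed a b : pd a (tau b) = pd b (tau a).
Proof.
by rewrite !tauE !der_cstM ?(der_half _ hh) // (der_trlog (pdC a b)).
Qed.

Lemma wirtE s a X i j : wirt pd J h s a X i j =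
  h * (pd a (X i j) + (-1) ^+ s * (J *m dmx (pJ a) X) i j).
Proof. by rewrite !mxE. Qed.

(** The real form of Rc = - d dbar log det g. In the trace of [curvE], the first term pairs a (0,1)
    direction with a (1,0) index and vanishes; in the second one the symmetry [GamC] makes the trace
    of Gam appear. *)
Lemma ricE b d : alg_ric b d = - (h * (pd b (tau d) + \sum_p J d p * pJ b (tau p))).
Proof.
rewrite mxE; under eq_bigr do rewrite curvE mxE [X in _ + X]mxE !wirtE.
rewrite sumrB.
have -> : \sum_a h * (pd a (Gam b d a) + (-1) ^+ false * (J *m dmx (pJ a) (Gam b)) d a) = 0.
  rewrite -mulr_sumr big_split /=.
  under [X in _ + X]eq_bigr do rewrite expr0 mul1r commJ_dmx ?pdJdirJ ?GamJ // mxE.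
  rewrite exchange_big /= -big_split big1 ?mulr0 // => p _ /=.
  under eq_bigr do rewrite mxE mulrC.
  by rewrite (pdJdir2 pd JJ) subrr.
rewrite sub0r -mulr_sumr big_split /=; congr (- (_ * (_ + _))).
  by rewrite -der_sum; congr (pd b _); apply: eq_bigr => a _; rewrite GamC.
under eq_bigr do rewrite expr0 mul1r mxE.
rewrite exchange_big; apply: eq_bigr => p _ /=; rewrite -mulr_sumr; congr (_ * _).
by rewrite der_sum; apply: eq_bigr => a _; rewrite mxE GamC.
Qed.

Lemma ricC b d : alg_ric b d = alg_ric d b.
Proof.
rewrite !ricE tau_closed; congr (- (_ * (_ + _))).
under eq_bigr do rewrite lin_derE mulr_sumr.
rewrite exchange_big; apply: eq_bigr => q _; rewrite lin_derE mulr_sumr.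
by apply: eq_bigr => p _; rewrite tau_closed mulrCA.
Qed.

Lemma ricT : alg_ric^T = alg_ric.
Proof. by apply/matrixP=> b d; rewrite mxE ricC. Qed.

Lemma J_ricE b d : (J *m alg_ric) b d =
  - (h * (pJ b (tau d) - \sum_p J d p * pd b (tau p))).
Proof.
rewrite mxE; under eq_bigr do rewrite ricE mulrN mulrCA mulrDr.
rewrite sumrN -mulr_sumr big_split /= -lin_derE; congr (- (_ * (_ + _))).
under eq_bigr do rewrite mulr_sumr.
rewrite exchange_big -sumrN; apply: eq_bigr => p _ /=.
under eq_bigr do rewrite mulrCA.
by rewrite -mulr_sumr (pdJdir2 pd JJ) mulrN.
Qed.

Lemma ricJ : J *m alg_ric = alg_ric *m J.
Proof.
apply/matrixP=> b d; rewrite J_ricE mxE.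
under [RHS]eq_bigr do rewrite ricE mulNr (JE _ d) mulrN opprK mulrAC -mulrA mulrDr.
rewrite -mulr_sumr -mulrN; congr (_ * _); rewrite big_split /= opprB; congr (_ + _).
under eq_bigr do rewrite mulr_sumr.
rewrite exchange_big /= (bigD1 d) //= [X in _ + X]big1 => [|p pd'].
  by under eq_bigr do rewrite mulrA; rewrite -mulr_suml (JJE JJ) eqxx mulN1r addr0.
under eq_bigr do rewrite mulrA.
by rewrite -mulr_suml (JJE JJ) eq_sym (negPf pd') oppr0 mul0r.
Qed.

Lemma mx_subE X Y i j : (X - Y) i j = X i j - Y i j.
Proof. by rewrite !mxE. Qed.

Lemma dmxE (d : derivation A) X i j : dmx d X i j = d (X i j).
Proof. by rewrite mxE. Qed.

Let dh (d : derivation A) : d h = 0 := der_half d hh.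

Lemma der_Jsum (d : derivation A) i (F : 'I_m -> A) : dmx d J = 0 ->
  d (\sum_p J i p * F p) = \sum_p J i p * d (F p).
Proof.
move=> dJ; rewrite der_sum; apply: eq_bigr => p _; rewrite der_cstM //.
by have /matrixP/(_ i p) := dJ; rewrite !mxE.
Qed.

(** The Kähler condition d_i X_{j kbar} = d_j X_{i kbar}. It holds for g and also for Rc, whose form
    is closed as well. *)
Definition d_symmetric X := forall a c d, D a X c d = D c X a d.

Lemma Db_symmetric X : X^T = X -> J *m X = X *m J -> d_symmetric X ->
  forall a p q, Db a X p q = Db q X p a.
Proof.
move=> XT XJ sX a p q.
have e b : Db b X = (D b X)^T by rewrite wirtT ?XT.
by rewrite !e mxE [RHS]mxE sX.
Qed.

Lemma g_d_symmetric : d_symmetric g.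
Proof.
by move=> a c d; rewrite -!Gamg !mxE; apply: eq_bigr => e _; rewrite GamC.
Qed.

(** Written through [tau], the left side involves second derivatives along a, J a, c and J c only,
    in a combination symmetric in a and c. *)
Lemma ric_d_symmetric : d_symmetric alg_ric.
Proof.
have dJ := pdJdirJ pdJ.
have e a c d : D a alg_ric c d = - (h * (h *
   ((pd a (pd c (tau d)) - pJ a (pJ c (tau d)))
   + (\sum_p J d p * pd a (pJ c (tau p)) + \sum_p J d p * pJ a (pd c (tau p)))))).
  rewrite wirtE expr1 mulN1r -dmx_cstM // [dmx _ _ _ _]mxE ricE J_ricE !derN !der_cstM //.
  by rewrite !derD derN !der_Jsum //; ring.
move=> a c d; rewrite !e (pdC a) (pdJdirC pdC pdJ a).
congr (- (_ * (_ * (_ + _)))); rewrite addrC; congr (_ + _).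
  by apply: eq_bigr => p _; rewrite (pd_pdJdirC pdC pdJ).
by apply: eq_bigr => p _; rewrite (pd_pdJdirC pdC pdJ).
Qed.

(** * Covariant derivatives of the Ricci tensor *)

Local Notation S := alg_ric.
Definition End_ric : 'M[A]_m := S *m gi.
Local Notation Am := End_ric.
(* Covariant derivatives of Rc: in a (1,0) direction Gam acts on the first index
   only, in a (0,1) direction its transpose acts on the second one. *)
Definition nabla_ric b : 'M[A]_m := D b S - Gam b *m S.
Local Notation T := nabla_ric.
Definition nablab_ric d : 'M[A]_m := Db d S - Am *m Db d g.
Local Notation Z := nablab_ric.
(* The (1,1) part of the curvature; the other parts vanish. *)
Definition Phi b d : 'M[A]_m := Db d (Gam b).
(** The derivative of Rc first along dbar_d, then along d_b. Of the indices of Z d only the row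
    index is of type (1,0), hence a single Christoffel term. *)
Definition hess_ric b d : 'M[A]_m := D b (Z d) - Gam b *m Z d.
Local Notation V := hess_ric.

Lemma AmJ : J *m Am = Am *m J.
Proof. by rewrite mulmxA ricJ -!mulmxA giJ. Qed.

Lemma TJ b : J *m T b = T b *m J.
Proof.
rewrite mulmxBr mulmxBl commJ_wirt ?ricJ // mulmxA GamJ -!mulmxA.
by rewrite ricJ.
Qed.

Lemma TC b p q : T b p q = T p b q.
Proof.
rewrite !mx_subE ric_d_symmetric; congr (_ - _).
by rewrite !mx_mulE; apply: eq_bigr => e _; rewrite GamC.
Qed.

Lemma Gam_tr d : (Gam d)^T = gi *m Db d g.
Proof. by rewrite GamE trmx_mul giT wirtT ?gT. Qed.

Lemma ZE d : Z d = (T d)^T.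
Proof.
rewrite /Z /T linearB /= trmx_mul ricT Gam_tr wirtT ?ricJ // ricT.
by rewrite mulmxA.
Qed.

Lemma ZC d p q : Z d p q = Z q p d.
Proof. by rewrite !ZE mxE [RHS]mxE TC. Qed.

Lemma Db_Am d : Db d Am = Z d *m gi.
Proof.
by rewrite wirtM ?ricJ // wirt_gi mulmxBl mulmxN !mulmxA.
Qed.

Lemma D_Am b : D b Am = T b *m gi + (Gam b *m Am - Am *m Gam b).
Proof.
rewrite wirtM ?ricJ // D_gi mulmxN mulmxBl !mulmxA.
by rewrite -addrA (addrA (- _)) addNr add0r.
Qed.

Lemma D_cov_symr (Y : 'I_m -> 'M[A]_m) b d p q :
    (forall d p q, Y d p q = Y q p d) ->
  (D b (Y d) - Gam b *m Y d) p q = (D b (Y q) - Gam b *m Y q) p d.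
Proof.
move=> YC; rewrite !mx_subE !wirtE !mx_mulE YC.
by congr (_ * (_ + _ * _) - _); apply: eq_bigr => k _; rewrite ?dmxE (YC d).
Qed.

Lemma V_symr b d p q : V b d p q = V b q p d.
Proof. exact: D_cov_symr ZC. Qed.

Lemma Db_swap (X : 'I_m -> 'M[A]_m) d :
    (forall b, J *m X b = X b *m J) -> (forall b p q, X b p q = X p b q) ->
  forall b p q, Db d (X b) p q = Db d (X p) b q.
Proof.
move=> XJ XC b p q; rewrite !wirtE XC; congr (_ * (_ + _ * _)).
have dJ := pdJdirJ pdJ d.
rewrite !commJ_dmx // !mx_mulE; apply: eq_bigr => e _.
by rewrite !dmxE XC.
Qed.

(** The Ricci identity: the first two terms are the derivative of Rc taken in the other order, and
    the bracket is the curvature acting on each index of Rc. *)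
Lemma VE b d :
  V b d = Db d (T b) - T b *m gi *m Db d g + (Phi b d *m S - Am *m Phi b d *m g).
Proof.
rewrite /hess_ric /nablab_ric /Phi.
have -> : D b (Db d S - Am *m Db d g)
    = Db d (D b S) - (D b Am *m Db d g + Am *m Db d (D b g)).
  rewrite wirtB (wirtM _ _ _ _ _ AmJ) (wirtC hh pdC pdJ true false b d S).
  by rewrite (wirtC hh pdC pdJ true false b d g).
have -> : Db d (T b) = Db d (D b S) - (Db d (Gam b) *m S + Gam b *m Db d S).
  by rewrite wirtB (wirtM _ _ _ _ _ (GamJ b)).
have -> : Db d (D b g) = Db d (Gam b) *m g + Gam b *m Db d g.
  by rewrite -Gamg (wirtM _ _ _ _ _ (GamJ b)).
rewrite D_Am; move: (T b) (Gam b) (Db d g) (Db d (Gam b)) (Db d S) (D b S) Am.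
move=> t G dg dG dS DS a; move: (Db d DS) => e.
rewrite !mulmxBr !mulmxDr !mulmxDl !mulNmx !mulmxA.
by apply/matrixP=> i j; rewrite !mxE; ring.
Qed.

Lemma PhiC b d p q : Phi b d p q = Phi p d b q.
Proof. exact: (Db_swap d GamJ GamC). Qed.

(** The curvature with all indices lowered, up to sign: by [mxtrace_K] its trace is -Rc. *)
Definition Kcurv b d : 'M[A]_m := Phi b d *m g.
Local Notation K := Kcurv.

Lemma KC b d p q : K b d p q = K p d b q.
Proof. by rewrite !mx_mulE; apply: eq_bigr => e _; rewrite PhiC. Qed.

(** By the classical formula K = d dbar g - (d g) gi (dbar g), the fact e below, the symmetry in the
    barred indices d and q reduces to that of dbar g. *)
Lemma K_symr b d p q : K b d p q = K b q p d.
Proof.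
have Dg := Db_symmetric gT gJ g_d_symmetric.
have e c : K b c = D b (Db c g) - Gam b *m Db c g.
  rewrite /K /Phi (wirtC hh pdC pdJ true false b c g) -Gamg wirtM ?GamJ //.
  by rewrite addrK.
by rewrite !e; exact: (D_cov_symr (Y := fun c => Db c g)).
Qed.

(** All terms of [VE] except the last are symmetric in b and p. *)
Lemma V_swap b d p q : V b d p q - V p d b q =
  (Am *m K p d) b q - (Am *m K b d) p q.
Proof.
have e c r : V c d r q = Db d (T c) r q - (T c *m (gi *m Db d g)) r q
    + ((Phi c d *m S) r q - (Am *m K c d) r q).
  by rewrite VE -!mulmxA mxE !mx_subE.
have e1 : Db d (T b) p q = Db d (T p) b q by exact: (Db_swap d TJ TC).
have e2 (X : 'M[A]_m) : (T b *m X) p q = (T p *m X) b q.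
  by rewrite !mx_mulE; apply: eq_bigr => k _; rewrite TC.
have e3 : (Phi b d *m S) p q = (Phi p d *m S) b q.
  by rewrite !mx_mulE; apply: eq_bigr => k _; rewrite PhiC.
rewrite (e b p) (e p b) e1 (e2 (gi *m Db d g)) e3 opprD addrACA subrr add0r opprD addrACA subrr add0r.
by rewrite opprK addrC.
Qed.

Lemma J_Gam r : J *m Gam r = \sum_c J r c *: Gam c.
Proof.
have e c : J r c *: Gam c = (J r c *: D c g) *m gi by rewrite GamE scalemxAl.
under eq_bigr do rewrite e.
rewrite -mulmx_suml (wirtJ pd h JJ) expr1 scaleN1r opprK GamE.
by rewrite mulmxA.
Qed.

Lemma mxtrace_Phi r d : \tr (Phi r d) = - S r d.
Proof.
rewrite ricC ricE opprK /Phi /wirt linearZ raddfD /= expr0 scale1r.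
congr (_ * (_ + _)); first by rewrite -der_mxtrace.
have dJ := pdJdirJ pdJ d.
rewrite -dmx_cstM // -der_mxtrace J_Gam raddf_sum -der_Jsum //.
by congr (pJ d _); apply: eq_bigr => c _; exact: mxtraceZ.
Qed.

Lemma mxtrace_K r d : \tr (K r d *m gi) = - S r d.
Proof. by rewrite -mulmxA ggi mulmx1 mxtrace_Phi. Qed.

(** The J-invariant part of the Hessian of f, a real substitute for d dbar f. *)
Definition Jhess (f : A) b d : A := h * (pd b (pd d f) + pJ b (pJ d f)).

(** The hypothesis says that the complex trace of X is real; the mixed terms, which carry one J,
    then drop out. *)
Lemma mxtrace_wirt2 X b d : \tr (J *m X) = 0 ->
  \tr (D b (Db d X)) = h * Jhess (\tr X) b d.
Proof.
move=> trJX; have dJ := pdJdirJ pdJ.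
rewrite [Db d X]/wirt (wirtZ pd J h) // linearZ /=; congr (_ * _).
rewrite expr0 scale1r -dmx_cstM // wirtD raddfD /=.
rewrite /wirt !linearZ /= -mulrDr; congr (_ * _).
rewrite !raddfD /= !expr1 !scaleN1r !raddfN /= -!dmx_cstM // -!der_mxtrace trJX.
rewrite ?der0 ?subr0 ?addr0 ?add0r.
by rewrite mulmxA JJ mulNmx mul1mx raddfN derN derN /= opprK.
Qed.

Lemma trJAm : \tr (J *m Am) = 0.
Proof. by rewrite mulmxA mxtrace_sym_J ?ricT ?ricJ. Qed.

Lemma trJAm2 : \tr (J *m (Am *m Am)) = 0.
Proof.
have -> : J *m (Am *m Am) = J *m (Am *m S) *m gi by rewrite -!mulmxA.
rewrite mxtrace_sym_J //; first by rewrite !trmx_mul ricT giT mulmxA.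
by rewrite mulmxA AmJ -!mulmxA ricJ.
Qed.

Lemma D_Db_Am b d : D b (Db d Am) =
  V b d *m gi + (Gam b *m (Z d *m gi) - Z d *m gi *m Gam b).
Proof.
rewrite Db_Am; have ZJ : J *m Z d = Z d *m J.
  by rewrite mulmxBr mulmxBl commJ_wirt ?ricJ // mulmxA AmJ -!mulmxA commJ_wirt.
rewrite (wirtM _ _ _ _ _ ZJ) D_gi /hess_ric (mulmxBl (D b (Z d))) mulmxN !mulmxA.
by rewrite addrA subrK; congr (_ - _); rewrite !mulmxA.
Qed.

Lemma mxtrace_D_Db_Am b d : \tr (D b (Db d Am)) = \tr (V b d *m gi).
Proof.
by rewrite D_Db_Am raddfD raddfB /= [\tr (_ *m Gam b)]mxtrace_mulC subrr addr0.
Qed.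

Lemma mxtrace_D_Db_Am2 b d : \tr (D b (Db d (Am *m Am))) =
  (\tr (Am *m V b d *m gi) + \tr (T b *m gi *m (T d)^T *m gi)) *+ 2.
Proof.
have AmDJ := commJ_wirt h pdJ false d AmJ.
rewrite (wirtM _ _ _ _ _ AmJ) wirtD (wirtM _ _ _ _ _ AmJ) (wirtM _ _ _ _ _ AmDJ).
rewrite !mxtraceD (mxtrace_mulC _ Am) (mxtrace_mulC (Db d Am)).
suff e : \tr (D b Am *m Db d Am) + \tr (Am *m D b (Db d Am)) =
    \tr (Am *m V b d *m gi) + \tr (T b *m gi *m (T d)^T *m gi).
  by rewrite mulr2n -e [X in X + _ = _]addrC.
rewrite D_Db_Am D_Am Db_Am -ZE; move: (T b) (Z d) (V b d) (Gam b) Am => t z v G a.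
rewrite !mulmxDl !mulmxDr !mulmxN !mulNmx !mulmxA !raddfD /= !raddfN /=.
have -> : \tr (G *m a *m z *m gi) = \tr (a *m z *m gi *m G).
  by rewrite -!mulmxA [LHS]mxtrace_mulC -!mulmxA.
ring.
Qed.

(* The Hessian of f has no first order terms in the directions (d/dz, d/dzbar), so
   that no Christoffel symbols are needed. *)
Definition alg_lapl (f : A) : A := h * \sum_b \sum_d gi b d * pd b (pd d f).

(** As gi is J-invariant, it sees only the J-invariant part of the Hessian. *)
Lemma alg_laplE f : alg_lapl f = \sum_b \sum_d gi b d * (h * Jhess f b d).
Proof.
have JgiJ : J^T *m gi *m J = gi by rewrite JT mulNmx giJ mulNmx -mulmxA JJ mulmxN mulmx1 opprK.
have e : \sum_b \sum_d gi b d * pJ b (pJ d f) = \sum_b \sum_d gi b d * pd b (pd d f).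
  transitivity (\sum_p \sum_q \sum_b \sum_d gi b d * (J b p * J d q * pd p (pd q f))).
    transitivity (\sum_b \sum_d \sum_p \sum_q gi b d * (J b p * J d q * pd p (pd q f))).
      apply: eq_bigr => b _; apply: eq_bigr => d _.
      rewrite lin_derE mulr_sumr; apply: eq_bigr => p _.
      rewrite lin_derE -mulr_sumr; congr (_ * _).
      rewrite (der_Jsum d _ (pdJ p)) mulr_sumr; apply: eq_bigr => q _.
      by rewrite mulrA.
    by rewrite sum4_swap.
  apply: eq_bigr => p _; apply: eq_bigr => q _.
  have -> : gi p q = \sum_b \sum_d gi b d * (J b p * J d q).
    rewrite -[in LHS]JgiJ mxE exchange_big; apply: eq_bigr => d _.
    by rewrite mxE mulr_suml; apply: eq_bigr => b _; rewrite mxE; ring.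
  rewrite mulr_suml; apply: eq_bigr => b _.
  by rewrite mulr_suml; apply: eq_bigr => d _; rewrite mulrA.
rewrite /alg_lapl /Jhess.
transitivity (h * (h * (\sum_b \sum_d gi b d * pd b (pd d f)
    + \sum_b \sum_d gi b d * pJ b (pJ d f)))).
  by rewrite e mulrDr -mulrDl hh mul1r.
rewrite -big_split !mulr_sumr; apply: eq_bigr => b _.
rewrite -big_split !mulr_sumr; apply: eq_bigr => d _ /=.
by ring.
Qed.

Definition alg_scal : A := \tr Am.
Definition alg_ric2 : A := \tr (Am *m Am).
Definition alg_grad2 : A := \sum_b \sum_d gi b d * \tr (T b *m gi *m (T d)^T *m gi).
Local Notation P := (gi *m Am).
(** P is Rc with both indices raised, and this is - Rm(Rc, Rc), as [Rm_ric_ric] shows. *)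
Definition curv_ric_ric : A := \sum_b \sum_d P d b * \tr (K b d *m P).

Lemma lapl_scal : alg_lapl alg_scal = \sum_b \sum_d gi b d * \tr (V b d *m gi).
Proof.
rewrite alg_laplE; apply: eq_bigr => b _; apply: eq_bigr => d _.
by rewrite -mxtrace_wirt2 ?trJAm // mxtrace_D_Db_Am.
Qed.

Lemma lapl_ric2 : alg_lapl alg_ric2 =
  (\sum_b \sum_d gi d b * \tr (Am *m V b d *m gi) + alg_grad2) *+ 2.
Proof.
rewrite alg_laplE -big_split -sumrMnl; apply: eq_bigr => b _.
rewrite -big_split -sumrMnl; apply: eq_bigr => d _ /=.
by rewrite -mxtrace_wirt2 ?trJAm2 // mxtrace_D_Db_Am2 (giE d b) -mulrDr mulrnAr.
Qed.

(* The curvature terms come from commuting the two covariant derivatives of Rc. *)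
Lemma hess_contraction :
  \sum_b \sum_d P d b * \tr (V b d *m gi) =
  \sum_b \sum_d gi d b * \tr (Am *m V b d *m gi)
  - \tr (Am *m Am *m Am) - curv_ric_ric.
Proof.
have := swap_contraction gi V_symr KC V_swap; rewrite -/curv_ric_ric => /eqP.
rewrite subr_eq => /eqP ->; rewrite addrC -addrA; congr (_ + (_ + _)).
have -> : \tr (Am *m Am *m Am) = \tr (P *m Am *m S).
  by rewrite -mulmxA mxtrace_mulC -!mulmxA [RHS]mxtrace_mulC -!mulmxA.
rewrite [in RHS]mxtrace_mulC mxtrace_mulE -sumrN; apply: eq_bigr => b _.
rewrite -sumrN; apply: eq_bigr => d _.
by rewrite mxtrace_K mulrN mulrC.
Qed.

(** * Evolution of R and of |Rc|^2 *)

Section Flow.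
Variable dt : derivation A.
Hypothesis dtC : forall a x, dt (pd a x) = pd a (dt x).
Hypothesis dtJ : dmx dt J = 0.
Hypothesis dtg : dmx dt g = g - S.

(** Along the flow the time derivative of log det g is tr (1 - Rc gi) = m - R, and it commutes with
    [pd d]. *)
Lemma dt_tau d : dt (tau d) = - (h * pd d alg_scal).
Proof.
rewrite tauE der_cstM // (der_trlog (dtC d)) dtg mulmxBl ggi raddfB /= mxtrace1.
by rewrite derB -mulrN; congr (_ * _); rewrite -mulr_natr mul1r der_nat sub0r.
Qed.

Lemma dt_pJ a x : dt (pJ a x) = pJ a (dt x).
Proof. by rewrite !lin_derE der_Jsum //; apply: eq_bigr => p _; rewrite dtC. Qed.

(** By [ricE] and [dt_tau] the left side is a J-invariant Hessian of R, that is, of the trace of Rc.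
    Curvature enters only later, when the derivatives are moved so as to form the Laplacian of
    Rc. *)
Lemma dt_ric : dmx dt S = \matrix_(b, d) \tr (V b d *m gi).
Proof.
apply/matrixP=> b d; rewrite dmxE [RHS]mxE -mxtrace_D_Db_Am mxtrace_wirt2 ?trJAm //.
rewrite ricE derN der_cstM // derD dtC der_Jsum // dt_tau.
under eq_bigr do rewrite dt_pJ dt_tau derN der_cstM // mulrN mulrCA.
rewrite sumrN -mulr_sumr derN der_cstM // -opprD -mulrDr mulrN opprK /Jhess.
by rewrite (der_Jsum d _ (pdJdirJ pdJ b)).
Qed.

Lemma dt_End_ric : dmx dt Am = dmx dt S *m gi - Am + Am *m Am.
Proof.
rewrite dmxM (dmx_inv _ ggi gig) dtg mulmxBr mulmxBl gig mul1mx opprB mulmxBr.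
by rewrite -addrA; congr (_ + _); rewrite addrC !mulmxA.
Qed.

Lemma evolution_scal : dt alg_scal = alg_lapl alg_scal - alg_scal + alg_ric2.
Proof.
rewrite der_mxtrace dt_End_ric !mxtraceD raddfN /= lapl_scal dt_ric.
congr (_ - _ + _); rewrite mxtrace_mulE; apply: eq_bigr => b _.
by apply: eq_bigr => d _; rewrite mxE mulrC giE.
Qed.

(** The cubic term tr (Am Am Am) produced by differentiating gi cancels the one in
    [hess_contraction], which leaves Rm(Rc, Rc) as the only reaction term of third order. *)
Lemma evolution_ric2 : dt alg_ric2 =
  alg_lapl alg_ric2 - alg_grad2 *+ 2 - curv_ric_ric *+ 2 - alg_ric2 *+ 2.
Proof.
rewrite der_mxtrace dmxM mxtraceD (mxtrace_mulC _ Am) -mulr2n dt_End_ric.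
rewrite mulmxDr mulmxBr mulmxA !mxtraceD raddfN /= lapl_ric2 mulmxA.
have -> : \tr (Am *m dmx dt S *m gi) = \sum_b \sum_d P d b * \tr (V b d *m gi).
  rewrite mxtrace_mulAC mxtrace_mulE dt_ric; apply: eq_bigr => b _.
  by apply: eq_bigr => d _; rewrite mxE mulrC.
rewrite hess_contraction -!mulrnBl; congr (_ *+ _).
rewrite addrK /alg_ric2 !mulmxA.
move: (\sum_b _) (\tr _) curv_ric_ric alg_ric2.
by move=> a t k n; ring.
Qed.

End Flow.

(** * The contraction Rm(Rc, Rc) *)

Definition alg_Rm a b c d : A := \sum_e alg_curv a b d e * g e c.

Lemma KJ a b : J *m K a b = K a b *m J.
Proof. by rewrite mulmxA commJ_wirt ?GamJ // -!mulmxA gJ. Qed.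

Lemma PJ : J *m P = P *m J.
Proof. by rewrite mulmxA giJ -(mulmxA gi J) AmJ mulmxA. Qed.

Lemma PT : P^T = P.
Proof. by rewrite !trmx_mul giT ricT -mulmxA. Qed.

Lemma PE a b : P a b = P b a.
Proof. by rewrite -[in LHS]PT mxE. Qed.

(** Both b and d are of type (1,0), so the slice X of K anticommutes with J, whereas P commutes with
    it; conjugating by J shows that tr (X P) is its own opposite. *)
Lemma K_contraction0 a c : \sum_b \sum_d K b a d c * P b d = 0.
Proof.
pose X : 'M[A]_m := \matrix_(b, d) K b a d c.
have XE b d : X b d = K b a d c by rewrite mxE.
have JTE b d : J^T b d = J d b by rewrite mxE.
have JX : J *m X = - (X *m J).
  rewrite -mulmxN -JT; apply/matrixP=> q d.
  transitivity ((J *m K d a) q c).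
    by rewrite !mx_mulE; apply: eq_bigr => b _; rewrite XE KC.
  rewrite KJ; transitivity ((K q a *m J) d c).
    by rewrite !mx_mulE; apply: eq_bigr => e _; rewrite KC.
  rewrite -KJ !mx_mulE; apply: eq_bigr => b _.
  by rewrite XE JTE mulrC.
have -> : \sum_b \sum_d K b a d c * P b d = \tr (X *m P).
  rewrite mxtrace_mulE; apply: eq_bigr => b _; apply: eq_bigr => d _.
  by rewrite XE PE.
apply: two_torsion_free; apply/eqP; rewrite addr_eq0; apply/eqP.
transitivity (\tr (J *m (X *m P) *m J)).
  rewrite (mulmxA J X P) JX !mulNmx -(mulmxA (X *m J)) -PJ (mulmxA (X *m J)).
  by rewrite -(mulmxA X J) JJ mulmxN mulmx1 mulNmx opprK.
by rewrite mxtrace_mulC (mulmxA J J) JJ mulNmx mul1mx raddfN.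
Qed.

(** By [curvE] the lowered curvature is K b a d c - K a b d c. The first term contracts to 0, the
    second, after [K_symr], to [curv_ric_ric]. *)
Lemma Rm_ric_ric : \sum_a \sum_b \sum_c \sum_d alg_Rm a b c d * (P a c * P b d) =
  - curv_ric_ric.
Proof.
have RmE a b c d : alg_Rm a b c d = K b a d c - K a b d c.
  rewrite -[LHS]/(\sum_e alg_curv a b d e * g e c) -mx_mulE curvE mulmxBl.
  by rewrite mx_subE.
transitivity (\sum_a \sum_c \sum_b \sum_d (K b a d c - K a b d c) * (P a c * P b d)).
  apply: eq_bigr => a _; rewrite exchange_big; apply: eq_bigr => c _.
  by apply: eq_bigr => b _; apply: eq_bigr => d _; rewrite RmE.
rewrite -sumrN; apply: eq_bigr => a _; rewrite -sumrN; apply: eq_bigr => c _.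
transitivity (P a c * (\sum_b \sum_d K b a d c * P b d)
              - P a c * (\sum_b \sum_d K a c d b * P b d)).
  rewrite -mulrBr -sumrB mulr_sumr; apply: eq_bigr => b _.
  rewrite -sumrB mulr_sumr; apply: eq_bigr => d _.
  by rewrite (K_symr a b d c) mulrCA mulrBl.
rewrite K_contraction0 mulr0 sub0r (PE a c) mxtrace_mulE exchange_big.
by [].
Qed.

End Kahler.

(** * Derivatives along vectors *)

Section Calculus.
Context {R : realType} {V : normedModType R}.
Implicit Types (f : V -> R) (x y u w e : V).

Lemma is_derive_line f y u (s : R) :
  derivable f (y + s *: u) u ->
  is_derive s (1 : R) (fun s : R => f (y + s *: u)) ('D_u f (y + s *: u)).
Proof.
rewrite /derivable /derive => df.
have e : (fun h : R => h^-1 *: (((fun s => f (y + s *: u)) \o shift s) (h *: 1)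
    - f (y + s *: u)))
  = (fun h => h^-1 *: ((f \o shift (y + s *: u)) (h *: u) - f (y + s *: u))).
  apply/funext => h /=; congr (_ *: (f _ - _)).
  by rewrite [h *: 1]mulr1 scalerDl addrCA.
by split; rewrite /derivable /derive e.
Qed.

Lemma MVT_line f y u (h : R) :
  (forall s : R, `|s| <= `|h| -> derivable f (y + s *: u) u) ->
  exists2 s : R, `|s| <= `|h| & f (y + h *: u) - f y = h * 'D_u f (y + s *: u).
Proof.
move=> df; pose phi (s : R) := f (y + s *: u).
have dphi (s : R) : `|s| <= `|h| -> is_derive s (1 : R) phi ('D_u f (y + s *: u)).
  by move=> /df; exact: is_derive_line.
have cphi (s : R) : `|s| <= `|h| -> {for s, continuous phi}.
  move=> /dphi[ds _]; apply/differentiable_continuous.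
  exact/derivable1_diffP.
have phi0 : phi 0 = f y by rewrite /phi scale0r addr0.
have phih : phi h = f (y + h *: u) by [].
have [h0|h0] := leP 0 h.
  have sub s : s \in `[0, h] -> `|s| <= `|h|.
    by rewrite in_itv /= => /andP[s0 sh]; rewrite !ger0_norm.
  have [s|//|s sI e] := @MVT_segment _ phi (fun s => 'D_u f (y + s *: u)) 0 h h0.
  - by move=> /subset_itv_oo_cc /sub /dphi.
  - by apply: continuous_in_subspaceT => s; rewrite inE /= => /sub /cphi.
  by exists s; [exact: sub|rewrite -phi0 -phih e subr0 mulrC].
have sub s : s \in `[h, 0] -> `|s| <= `|h|.
  by rewrite in_itv /= => /andP[s0 sh]; rewrite !ler0_norm ?(ltW h0) // lerN2.
have [s|//|s sI e] := @MVT_segment _ phi (fun s => 'D_u f (y + s *: u)) h 0 (ltW h0).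
- by move=> /subset_itv_oo_cc /sub /dphi.
- by apply: continuous_in_subspaceT => s; rewrite inE /= => /sub /cphi.
by exists s; [exact: sub|rewrite -phi0 -phih -opprB e sub0r mulrN opprK mulrC].
Qed.

Lemma close_mid (a b p q eps : R) : p = q ->
  `|a - p| <= eps / 2 -> `|b - q| <= eps / 2 -> `|a - b| <= eps.
Proof.
move=> -> Ha Hb; have -> : a - b = (a - q) - (b - q) by ring.
by apply: le_trans (ler_normB _ _) _; rewrite [leRHS]splitr lerD.
Qed.

Section OpenSet.
Variables (D : set V) (openD : open D).

(* Two-direction form of "continuous partial derivatives imply differentiable". *)
Lemma is_derive_addZ f u w (c : R) x : D x ->
    (forall y, D y -> derivable f y u) ->
    {for x, continuous ('D_u f)} -> derivable f x w ->
  is_derive x (c *: u + w) f (c * 'D_u f x + 'D_w f x).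
Proof.
move=> Dx du cu dw.
suff H : (fun h : R => h^-1 *: ((f \o shift x) (h *: (c *: u + w)) - f x)) @ 0^'
    --> c * 'D_u f x + 'D_w f x.
  split; first by apply/cvg_ex; exists (c * 'D_u f x + 'D_w f x).
  exact: cvg_lim H.
(* The increment is split at x + h w. Its part A along u starts from a moving point, hence the mean
   value theorem and the continuity of 'D_u f at x. *)
pose A (h : R) := h^-1 *: (f (x + h *: w + (h * c) *: u) - f (x + h *: w)).
have -> : (fun h : R => h^-1 *: ((f \o shift x) (h *: (c *: u + w)) - f x)) =
    A \+ (fun h : R => h^-1 *: ((f \o shift x) (h *: w) - f x)).
  apply/funext => h /=; rewrite -scalerDr; congr (_ *: _).
  rewrite /A (addrC (h *: w) x) addrA subrK; congr (f _ - _).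
  by rewrite scalerDr scalerA addrC -addrA (addrC (_ *: u)).
apply: cvgD; last exact: dw.
apply/cvgrPdist_le => eps eps0.
have c1 : 0 < `|c| + 1 by rewrite ltr_pwDr.
have ec0 : 0 < eps / (`|c| + 1) by rewrite divr_gt0.
have /cvgrPdist_le/(_ _ ec0)/nbhs_ballP[r /= r0 Hr] := cu.
have /nbhs_ballP[r' /= r'0 Hr'] : nbhs x D by exact: open_nbhs_nbhs.
pose d := Num.min r r' / (`|w| + `|c| * `|u| + 1).
have den : 0 < `|w| + `|c| * `|u| + 1 by rewrite ltr_wpDl // addr_ge0 // mulr_ge0.
have d0 : 0 < d by rewrite divr_gt0 // lt_min r0.
exists d => //= h; rewrite /= sub0r normrN => hd h0.
have near (s : R) : `|s| <= `|h * c| -> `|x - (x + h *: w + s *: u)| < Num.min r r'.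
  move=> sh; rewrite -addrA opprD addNKr normrN.
  apply: le_lt_trans (ler_normD _ _) _; rewrite !normrZ.
  apply: (@le_lt_trans _ _ (`|h| * (`|w| + `|c| * `|u| + 1))); last first.
    by rewrite -ltr_pdivlMr.
  rewrite mulrDr mulr1 -[leLHS]addr0 lerD // mulrDr lerD // mulrA ler_wpM2r //.
  by rewrite -normrM.
have [s|s sh e] := @MVT_line f (x + h *: w) u (h * c).
  move=> /near; rewrite lt_min => /andP[_ nr'].
  by apply: du; apply: Hr'; rewrite -ball_normE.
rewrite /A e -[_ *: _]/(h^-1 * _) -mulrA mulKf // -mulrBr normrM.
have := near _ sh; rewrite lt_min => /andP[nr _].
apply: le_trans (_ : (`|c| + 1) * (eps / (`|c| + 1)) <= _); last first.
  by rewrite mulrC divfK // gt_eqF.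
rewrite ler_pM // ?lerDl // distrC.
rewrite distrC; apply: Hr.
by rewrite -ball_normE.
Qed.

Lemma is_derive_lincomb (I : Type) (v : I -> V) (c : I -> R) (s : seq I) f :
    (forall i y, D y -> derivable f y (v i)) ->
    (forall i y, D y -> {for y, continuous ('D_(v i) f)}) ->
  forall y, D y -> is_derive y (\sum_(i <- s) c i *: v i) f
                     (\sum_(i <- s) c i * 'D_(v i) f y).
Proof.
move=> df cf; elim: s => [|i s IHs] y Dy.
  by rewrite !big_nil; exact: is_derive0.
have [dy e] := IHs y Dy.
rewrite !big_cons; have := is_derive_addZ (c i) Dy (df i) (cf i y Dy) dy.
by rewrite e.
Qed.

(** The mean value theorem applied in each direction to the second difference of f. As this
    difference is symmetric in u and w, Schwarz's theorem [derive_commute] follows. *)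
Lemma derive_mixed_point f u w x (r : R) : 0 < r ->
    (forall y, D y -> derivable f y u) -> (forall y, D y -> derivable ('D_u f) y w) ->
    (forall y, `|x - y| < r -> D y) ->
  forall h : R, 0 < h -> h * (`|u| + `|w|) < r ->
  exists2 p, `|x - p| < r &
    f (x + h *: u + h *: w) - f (x + h *: u) - f (x + h *: w) + f x
    = h * (h * 'D_w ('D_u f) p).
Proof.
move=> r0 du dw Hr h h0 hr.
have near (s t : R) : `|s| <= `|h| -> `|t| <= `|h| -> `|x - (x + s *: u + t *: w)| < r.
  move=> sh th; rewrite -addrA opprD addNKr normrN.
  apply: le_lt_trans (ler_normD _ _) _; rewrite !normrZ.
  apply: le_lt_trans hr; rewrite mulrDr -{1 2}(gtr0_norm h0).
  by rewrite lerD // ler_wpM2r.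
have near0 (s : R) : `|s| <= `|h| -> `|x - (x + s *: u)| < r.
  by move=> sh; rewrite -[x + s *: u]addr0 -(scale0r w) near // normr0.
pose fh y := f (y + h *: w).
pose G := fh - f.
have dG (s : R) : `|s| <= `|h| -> is_derive (x + s *: u) u G
    ('D_u f (x + s *: u + h *: w) - 'D_u f (x + s *: u)).
  move=> sh.
  have dfa : derivable fh (x + s *: u) u /\
      'D_u fh (x + s *: u) = 'D_u f (x + s *: u + h *: w).
    rewrite /derivable /derive.
    have -> : (fun k : R => k^-1 *: ((fh \o shift (x + s *: u)) (k *: u) - fh (x + s *: u))) =
        (fun k => k^-1 *: ((f \o shift (x + s *: u + h *: w)) (k *: u)
         - f (x + s *: u + h *: w))).
      by apply/funext => k /=; rewrite /fh !addrA.
    by split => //; apply: du; apply: Hr; apply: near.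
  have dfb : derivable f (x + s *: u) u by apply: du; apply: Hr; exact: near0.
  by split; [exact: derivableB dfa.1 dfb|rewrite (deriveB dfa.1 dfb) dfa.2].
have [s|s sh e] := @MVT_line G x u h; first by move=> /dG[].
have [t|t th e'] := @MVT_line ('D_u f) (x + s *: u) w h.
  by move=> th; apply: dw; apply: Hr; apply: near.
exists (x + s *: u + t *: w); first exact: near.
rewrite -e'; have [_ <-] := dG s sh; rewrite -e /G /fh !fctE.
by rewrite opprB addrA addrAC.
Qed.

Lemma derive_commute f u w x : D x ->
    (forall y, D y -> derivable f y u) -> (forall y, D y -> derivable f y w) ->
    (forall y, D y -> derivable ('D_u f) y w) ->
    (forall y, D y -> derivable ('D_w f) y u) ->
    {for x, continuous ('D_w ('D_u f))} -> {for x, continuous ('D_u ('D_w f))} ->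
  'D_w ('D_u f) x = 'D_u ('D_w f) x.
Proof.
move=> Dx du dw duw dwu cuw cwu; apply/eqP; rewrite -subr_eq0 -normr_le0.
apply/ler_addgt0Pl => eps eps0; rewrite addr0.
have e20 : 0 < eps / 2 by rewrite divr_gt0.
have /cvgrPdist_le/(_ _ e20)/nbhs_ballP[r1 /= r10 H1] := cuw.
have /cvgrPdist_le/(_ _ e20)/nbhs_ballP[r2 /= r20 H2] := cwu.
have /nbhs_ballP[r3 /= r30 H3] : nbhs x D by exact: open_nbhs_nbhs.
pose r := Num.min r1 (Num.min r2 r3).
have r0 : 0 < r by rewrite !lt_min r10 r20.
have rD y : `|x - y| < r -> D y.
  by rewrite !lt_min => /and3P[_ _ ?]; apply: H3; rewrite -ball_normE.
have den : 0 < `|u| + `|w| + 1 by rewrite ltr_wpDl // addr_ge0.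
pose h := r / (`|u| + `|w| + 1).
have h0 : 0 < h by rewrite divr_gt0.
have hr : h * (`|u| + `|w|) < r.
  by rewrite /h mulrAC ltr_pdivrMr // ltr_pM2l // ltrDl.
have [p pr ep] := derive_mixed_point r0 du duw rD h0 hr.
have [|q qr eq] := derive_mixed_point r0 dw dwu rD h0 (_ : h * (`|w| + `|u|) < r).
  by rewrite addrC.
have e : 'D_w ('D_u f) p = 'D_u ('D_w f) q.
  have hn0 : h != 0 by rewrite gt_eqF.
  have canc (c d : R) : h * (h * c) = h * (h * d) -> c = d by move=> /(mulfI hn0)/(mulfI hn0).
  refine (canc _ _ (etrans (esym ep) (etrans _ eq))).
  by rewrite (addrAC x (h *: u)); ring.
apply: (close_mid e).
  by apply: H1; rewrite -ball_normE; move: pr; rewrite !lt_min => /and3P[].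
by apply: H2; rewrite -ball_normE; move: qr; rewrite !lt_min => /and3P[].
Qed.

End OpenSet.
End Calculus.

Lemma derive_near_max (R : realType) (phi psi : R -> R) :
    (\forall s \near (0 : R), is_derive s (1 : R) phi (psi s)) ->
    (\forall s \near (0 : R), phi s <= phi 0) -> psi 0 = 0.
Proof.
move=> /nbhs_ballP[r1 /= r10 H1] /nbhs_ballP[r2 /= r20 H2].
pose r := Num.min r1 r2; have r0 : 0 < r by rewrite lt_min r10.
have rI s : s \in `]- r, r[ -> `|s| < r by rewrite in_itv /= ltr_norml.
have [//|s /rI||s /rI|_ D0] := @derive1_at_max _ phi (- r) r 0.
- by clearbody r; lra.
- rewrite lt_min => /andP[sr1 _].
  by have [] : is_derive s (1 : R) phi (psi s) by apply: H1; rewrite -ball_normE /= sub0r normrN.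
- by rewrite in_itv /= r0 oppr_lt0 r0.
- rewrite lt_min => /andP[_ sr2].
  by apply: H2; rewrite -ball_normE /= sub0r normrN.
suff [_ <-] : is_derive (0 : R) (1 : R) phi (psi 0) by [].
by apply: H1; rewrite -ball_normE /= sub0r normrN normr0.
Qed.

(** If l were positive, psi, which vanishes at 0, would be positive just to the right of 0, and by
    the mean value theorem phi would exceed phi 0 there. *)
Lemma derive2_near_max (R : realType) (phi psi : R -> R) (l : R) :
    (\forall s \near (0 : R), is_derive s (1 : R) phi (psi s)) ->
    is_derive (0 : R) (1 : R) psi l ->
    (\forall s \near (0 : R), phi s <= phi 0) -> l <= 0.
Proof.
move=> dphi dpsi mphi; have psi0 := derive_near_max dphi mphi.
rewrite leNgt; apply/negP => l0.
have [dp el] := dpsi.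
have : (fun h : R => h^-1 *: ((psi \o shift 0) (h *: 1) - psi 0)) @ 0^' --> l.
  by rewrite -el; exact: dp.
move=> /cvgrPdist_lt/(_ _ l0) => near0.
have [r /= r0 Hr] : exists2 r : R, 0 < r & forall h, `|h| < r -> h != 0 -> 0 < h^-1 * psi h.
  move: near0 => /nbhs_ballP[r /= r0 Hr]; exists r => // h hr h0.
  have := Hr h; rewrite /ball /= sub0r normrN => /(_ hr h0).
  rewrite addr0 [h *: 1]mulr1 psi0 subr0 -[_ *: _]/(_ * _) => Hd.
  by have := ler_norm (l - h^-1 * psi h); lra.
move: dphi mphi => /nbhs_ballP[r1 /= r10 H1] /nbhs_ballP[r2 /= r20 H2].
pose d := Num.min r (Num.min r1 r2) / 2.
have m0 : 0 < Num.min r (Num.min r1 r2) by rewrite !lt_min r0 r10.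
have d0 : 0 < d by rewrite divr_gt0.
have dm : d < Num.min r (Num.min r1 r2) by rewrite ltr_pdivrMr // ltr_pMr // ltr1n.
have sd s : 0 <= s <= d -> [/\ `|s| < r, is_derive s (1 : R) phi (psi s) & phi s <= phi 0].
  move=> /andP[s0 sd']; have := le_lt_trans sd' dm; rewrite !lt_min => /and3P[sr sr1 sr2].
  have sb q : s < q -> ball (0 : R) q s by rewrite -ball_normE /= sub0r normrN ger0_norm.
  by split; [rewrite ger0_norm|apply: H1; exact: sb|apply: H2; exact: sb].
have [s||s sI e] := @MVT _ phi psi 0 d d0.
- by rewrite in_itv /= => /andP[s0 s1]; have [] := sd s; rewrite ?(ltW s0) ?(ltW s1).
- apply: continuous_in_subspaceT => s; rewrite inE /= in_itv /= => /sd[_ [ds _] _].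
  by apply/differentiable_continuous; exact/derivable1_diffP.
move: sI; rewrite in_itv /= => /andP[s0 s1].
have [] := sd s; first by rewrite (ltW s0) (ltW s1).
move=> sr _ _; have := Hr s sr; rewrite gt_eqF // => /(_ isT).
rewrite pmulr_rgt0 ?invr_gt0 // => psis.
have [_ _] := sd d (introT andP (conj (ltW d0) (lexx d))).
rewrite -subr_le0 e subr0 => /le_gtF.
by rewrite mulr_gt0.
Qed.

(** One-sided, because a maximum over [0, T] may sit at the final time T and then compares with
    earlier times only. *)
Lemma derive_left_max (R : realType) (phi : R -> R) (l : R) :
    is_derive (0 : R) (1 : R) phi l ->
    (\forall s \near (0 : R), s <= 0 -> phi s <= phi 0) -> 0 <= l.
Proof.
move=> [dp el] mphi; rewrite leNgt; apply/negP => l0.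
have : (fun h : R => h^-1 *: ((phi \o shift 0) (h *: 1) - phi 0)) @ 0^' --> l.
  by rewrite -el; exact: dp.
have nl0 : 0 < - l by rewrite oppr_gt0.
move=> /cvgrPdist_lt/(_ _ nl0)/nbhs_ballP[r /= r0 Hr].
move: mphi => /nbhs_ballP[r' /= r'0 Hr'].
pose h := - (Num.min r r' / 2).
have m0 : 0 < Num.min r r' by rewrite lt_min r0.
have h0 : h < 0 by rewrite oppr_lt0 divr_gt0.
have hm : `|h| < Num.min r r'.
  by rewrite normrN gtr0_norm ?divr_gt0 // ltr_pdivrMr // ltr_pMr // ltr1n.
move: hm; rewrite lt_min => /andP[hr hr'].
have := Hr h; rewrite /ball /= sub0r normrN => /(_ hr); rewrite lt_eqF // => /(_ isT).
rewrite addr0 [h *: 1]mulr1 -[_ *: _]/(_ * _) => Hd.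
have : phi h <= phi 0 by apply: Hr'; [rewrite -ball_normE /= sub0r normrN|exact: ltW].
rewrite -subr_le0 => ph.
have : 0 <= h^-1 * (phi h - phi 0) by apply: mulr_le0 => //; rewrite invr_le0 ltW.
by have := ler_norm (h^-1 * (phi h - phi 0) - l); rewrite distrC in Hd; lra.
Qed.

(** * The ring of smooth functions *)

(** Openness is bundled so that the ring structure on [smooth_ring] depends on data alone. *)
Record open_set (V : topologicalType) := OpenSet {
  oset :> set V;
  open_oset : open oset
}.

Section SmoothRing.
Context {R : realType} {V : normedModType R} {O : Type}.
Variables (v : O -> V) (D : open_set V).
Local Notation T := (set_type (oset D)).
Implicit Types (F G : T -> R) (f : V -> R) (o : O) (u : T).

(* Elements of the ring are functions on the subtype of D, extended by 0 in order
   to be differentiated. *)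
Definition ext0 F : V -> R := fun x => oapp F 0 (insub x).

Lemma ext0E F u : ext0 F (val u) = F u.
Proof. by rewrite /ext0 valK. Qed.

Lemma ext0D F G : ext0 (F + G) = ext0 F + ext0 G.
Proof. by apply/funext => x; rewrite /ext0 !fctE; case: insub => //=; rewrite addr0. Qed.

Lemma ext0M F G : ext0 (F * G) = ext0 F * ext0 G.
Proof. by apply/funext => x; rewrite /ext0 !fctE; case: insub => //=; rewrite mulr0. Qed.

Lemma ext0N F : ext0 (- F) = - ext0 F.
Proof. by apply/funext => x; rewrite /ext0 !fctE; case: insub => //=; rewrite oppr0. Qed.

Lemma near_oset u : \forall x \near val u, oset D x.
Proof.
by apply: open_nbhs_nbhs; split; [exact: open_oset|exact: set_valP].
Qed.

Definition restr f : T -> R := fun u => f (val u).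

Lemma ext0_restr f u : \forall x \near val u, f x = ext0 (restr f) x.
Proof.
apply: filterS (near_oset u) => x Dx.
by rewrite -[x in RHS](SubK T (mem_set Dx : x \in oset D)) ext0E /restr SubK.
Qed.

Lemma ext0_restr_continuous f u :
  {for val u, continuous f} -> {for val u, continuous (ext0 (restr f))}.
Proof.
move=> cf; rewrite /prop_for /continuous_at ext0E.
by apply: cvg_trans cf; apply: near_eq_cvg; exact: ext0_restr.
Qed.

Definition pder o F : T -> R := fun u => 'D_(v o) (ext0 F) (val u).

(** Recursion on the order, rather than on lists of directions, makes stability under products and
    inverses a single use of the Leibniz rule per step. *)
Fixpoint Ck (k : nat) F : Prop :=
  (forall u, {for val u, continuous (ext0 F)}) /\
  if k is k'.+1 then
    (forall u o, derivable (ext0 F) (val u) (v o)) /\ (forall o, Ck k' (pder o F))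
  else True.

Lemma CkW k F : Ck k.+1 F -> Ck k F.
Proof. by elim: k F => [|k IHk] F [cF [dF /= sF]]; split=> //; split=> // o; exact: IHk. Qed.

Lemma pderD o F G : (forall u, derivable (ext0 F) (val u) (v o)) ->
  (forall u, derivable (ext0 G) (val u) (v o)) -> pder o (F + G) = pder o F + pder o G.
Proof.
by move=> dF dG; apply/funext => u; rewrite /pder ext0D deriveD.
Qed.

Lemma pderN o F : (forall u, derivable (ext0 F) (val u) (v o)) ->
  pder o (- F) = - pder o F.
Proof. by move=> dF; apply/funext => u; rewrite /pder ext0N deriveN. Qed.

Lemma pderM o F G : (forall u, derivable (ext0 F) (val u) (v o)) ->
  (forall u, derivable (ext0 G) (val u) (v o)) ->
  pder o (F * G) = pder o F * G + F * pder o G.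
Proof.
move=> dF dG; apply/funext => u.
transitivity (G u * pder o F u + F u * pder o G u); last by rewrite mulrC.
by rewrite {1}/pder ext0M (deriveM (dF u) (dG u)) !ext0E addrC.
Qed.

Lemma CkD k F G : Ck k F -> Ck k G -> Ck k (F + G).
Proof.
elim: k F G => [|k IHk] F G [cF dF] [cG dG]; split.
- by move=> u; rewrite ext0D; exact: continuousD (cF u) (cG u).
- by [].
- by move=> u; rewrite ext0D; exact: continuousD (cF u) (cG u).
case: dF => dF sF; case: dG => dG sG; split => [u o|o].
  by rewrite ext0D; exact: derivableD (dF u o) (dG u o).
by rewrite (pderD (dF^~ o) (dG^~ o)); exact: IHk (sF o) (sG o).
Qed.

Lemma CkN k F : Ck k F -> Ck k (- F).
Proof.
elim: k F => [|k IHk] F [cF dF]; split.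
- by move=> u; rewrite ext0N; exact: continuousN (cF u).
- by [].
- by move=> u; rewrite ext0N; exact: continuousN (cF u).
case: dF => dF sF; split => [u o|o].
  by rewrite ext0N; exact: derivableN (dF u o).
by rewrite (pderN (dF^~ o)); exact: IHk (sF o).
Qed.

Lemma CkM k F G : Ck k F -> Ck k G -> Ck k (F * G).
Proof.
elim: k F G => [|k IHk] F G hF hG; split.
- by move=> u; rewrite ext0M; exact: continuousM (hF.1 u) (hG.1 u).
- by [].
- by move=> u; rewrite ext0M; exact: continuousM (hF.1 u) (hG.1 u).
case: (hF.2) (hG.2) => dF sF [dG sG]; split => [u o|o].
  by rewrite ext0M; exact: derivableM (dF u o) (dG u o).
rewrite (pderM (dF^~ o) (dG^~ o)).
by apply: CkD; [exact: IHk (sF o) (CkW hG)|exact: IHk (CkW hF) (sG o)].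
Qed.

Lemma pder_restr o f : pder o (restr f) = restr ('D_(v o) f).
Proof.
apply/funext => u; rewrite /pder /restr; apply: near_eq_derive.
by apply: filterS (ext0_restr f u) => x ->.
Qed.

Definition iter_der (s : seq O) f : V -> R := foldr (fun o f => 'D_(v o) f) f s.

Definition smooth_along f := forall (s : seq O) x, oset D x ->
  {for x, continuous (iter_der s f)} /\ forall o, derivable (iter_der s f) x (v o).

Lemma smooth_along_der o f : smooth_along f -> smooth_along ('D_(v o) f).
Proof.
move=> sf s x Dx.
have -> : iter_der s ('D_(v o) f) = iter_der (rcons s o) f by rewrite /iter_der foldr_rcons.
exact: sf.
Qed.

Lemma Ck_restr k f : smooth_along f -> Ck k (restr f).
Proof.
elim: k f => [|k IHk] f sf; split.
- by move=> u; apply: ext0_restr_continuous; apply: (sf [::] _ (set_valP u)).1.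
- by [].
- by move=> u; apply: ext0_restr_continuous; apply: (sf [::] _ (set_valP u)).1.
split=> [u o|o].
  apply: near_eq_derivable (ext0_restr f u) _.
  exact: (sf [::] _ (set_valP u)).2.
by rewrite pder_restr; apply: IHk; exact: smooth_along_der.
Qed.

Lemma smooth_along_cst (c : R) : smooth_along (cst c).
Proof.
have e s : exists c', iter_der s (cst c) = cst c'.
  elim: s => [|o s [c' IHs]]; first by exists c.
  exists 0; rewrite /iter_der /= -/(iter_der s _) IHs.
  by apply/funext => x; rewrite derive_cst.
move=> s x _; have [c' ->] := e s; split=> [|o]; first exact: cst_continuous.
exact: derivable_cst.
Qed.

Definition smooth_fun : {pred T -> R} := [pred F | `[< forall k, Ck k F >]].

Lemma smooth_funP F : reflect (forall k, Ck k F) (F \in smooth_fun).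
Proof. by rewrite inE; exact: asboolP. Qed.

Lemma smooth_fun_subring : subring_closed smooth_fun.
Proof.
split.
- by apply/smooth_funP => k; exact: (Ck_restr k (smooth_along_cst 1)).
- move=> F G /smooth_funP sF /smooth_funP sG; apply/smooth_funP => k.
  by apply: CkD => //; exact: CkN.
- move=> F G /smooth_funP sF /smooth_funP sG; apply/smooth_funP => k.
  exact: CkM.
Qed.

HB.instance Definition _ :=
  GRing.isSubringClosed.Build (T -> R) smooth_fun smooth_fun_subring.

Record smooth_ring := SmoothFun {
  smooth_val :> T -> R;
  smooth_valP : smooth_val \in smooth_fun
}.

HB.instance Definition _ := [isSub for smooth_val].
HB.instance Definition _ := [Choice of smooth_ring by <:].
HB.instance Definition _ :=
  GRing.SubChoice_isSubComPzRing.Build _ _ smooth_ring smooth_fun_subring.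

Local Notation A := smooth_ring.

Lemma smoothP (F : A) k : Ck k (val F).
Proof. by move: k; apply/smooth_funP; exact: (valP F). Qed.

Lemma smooth_derivable (F : A) u o : derivable (ext0 (val F)) (val u) (v o).
Proof. exact: (smoothP F 1).2.1. Qed.

Lemma pder_smooth o (F : A) : pder o (val F) \in smooth_fun.
Proof. by apply/smooth_funP => k; have [_ [_]] := smoothP F k.+1; apply. Qed.

Definition sder o (F : A) : A := SmoothFun (pder_smooth o F).

Lemma sderD o : {morph sder o : F G / F + G}.
Proof.
by move=> F G; apply: val_inj; rewrite /= pderD // => u; exact: smooth_derivable.
Qed.

Lemma sderM o (F G : A) : sder o (F * G) = sder o F * G + F * sder o G.
Proof.
by apply: val_inj; rewrite /= pderM // => u; exact: smooth_derivable.
Qed.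

Definition smooth_der o : derivation A := Derivation (@sderD o) (@sderM o).

(** Schwarz's theorem. The extension by 0 of a derivative agrees with the derivative of the
    extension only on D, so that each hypothesis of [derive_commute] is transported along an
    equality near the point. *)
Lemma pder_comm F o o' : (forall k, Ck k F) -> pder o (pder o' F) = pder o' (pder o F).
Proof.
move=> sF; apply/funext => u; rewrite /pder.
have near_ext G w x : oset D x -> 'D_w (ext0 (pder o G)) x = 'D_w ('D_(v o) (ext0 G)) x.
  move=> Dx; apply: near_eq_derive.
  apply: filterS (open_nbhs_nbhs (conj (open_oset D) Dx)) => y Dy.
  by rewrite -(SubK T (mem_set Dy : y \in oset D)) ext0E.
have e p F' (y : V) : oset D y -> ext0 (pder p F') y = 'D_(v p) (ext0 F') y.
  by move=> Dy; rewrite -(SubK T (mem_set Dy : y \in oset D)) ext0E.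
have dd G p q : (forall k, Ck k G) -> forall y, oset D y ->
    derivable ('D_(v p) (ext0 G)) y (v q).
  move=> sG y Dy; apply: (@near_eq_derivable _ _ _ (ext0 (pder p G))).
    apply: filterS (open_nbhs_nbhs (conj (open_oset D) Dy)) => z Dz; exact: e.
  have := ((sG 2).2.2 p).2.1 (exist _ y (mem_set Dy)) q.
  by [].
have d1 p y : oset D y -> derivable (ext0 F) y (v p).
  by move=> Dy; exact: ((sF 1).2.1 (exist _ y (mem_set Dy)) p).
have cc p q : {for val u, continuous ('D_(v q) ('D_(v p) (ext0 F)))}.
  have : {for val u, continuous (ext0 (pder q (pder p F)))}.
    exact: (((sF 2).2.2 p).2.2 q).1 u.
  have ne : \forall y \near val u, ext0 (pder q (pder p F)) y = 'D_(v q) ('D_(v p) (ext0 F)) y.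
    apply: filterS (near_oset u) => y Dy; rewrite e //.
    apply: near_eq_derive; apply: filterS (open_nbhs_nbhs (conj (open_oset D) Dy)) => z Dz.
    exact: e.
  rewrite /prop_for /continuous_at (nbhs_singleton ne) => c.
  by apply: cvg_trans c; apply: near_eq_cvg; apply: filterS ne => y ->.
have ed p q : 'D_(v p) (ext0 (pder q F)) (val u) = 'D_(v p) ('D_(v q) (ext0 F)) (val u).
  apply: near_eq_derive; apply: filterS (near_oset u) => y Dy; exact: e.
rewrite !ed; apply: (derive_commute (open_oset D)) => //.
- exact: set_valP.
- by move=> y; exact: d1.
- by move=> y; exact: d1.
- by move=> y; exact: dd.
- by move=> y; exact: dd.
Qed.

Lemma smooth_der_comm o o' (F : A) :
  smooth_der o (smooth_der o' F) = smooth_der o' (smooth_der o F).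
Proof. by apply: val_inj; apply: pder_comm => k; exact: smoothP. Qed.

Definition smooth_of f (sf : smooth_along f) : A :=
  SmoothFun (introT (smooth_funP _) (fun k => Ck_restr k sf)).

Definition smooth_cst (c : R) : A := smooth_of (smooth_along_cst c).

Lemma smooth_cst_der o c : smooth_der o (smooth_cst c) = 0.
Proof.
apply: val_inj; rewrite /= pder_restr; apply/funext => u.
by rewrite /restr derive_cst.
Qed.

(** The derivative of 1/F is - F' (1/F) (1/F), which involves 1/F at one order less. *)
Lemma Ck_inv k F : (forall u, F u != 0) -> (forall k, Ck k F) ->
  Ck k (fun u => (F u)^-1).
Proof.
move=> F0 sF.
have e : ext0 (fun u => (F u)^-1) = (fun x => (ext0 F x)^-1).
  by apply/funext => x; rewrite /ext0; case: insub => //=; rewrite invr0.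
have c u : {for val u, continuous (ext0 (fun u => (F u)^-1))}.
  rewrite e; apply: continuousV; first by rewrite ext0E.
  exact: (sF 0).1.
elim: k => [|k IHk]; split => //; split => [u o|o].
  by rewrite e; apply: derivableV; [rewrite ext0E|exact: (sF 1%N).2.1].
have -> : pder o (fun u => (F u)^-1) =
    - (pder o F * ((fun u => (F u)^-1) * (fun u => (F u)^-1))).
  apply/funext => u; rewrite /pder e deriveV ?ext0E //; last exact: (sF 1%N).2.1.
  rewrite !fctE -[_ *: _]/(_ * _) mulNr; congr (- _).
  by rewrite mulrC -invfM expr2.
apply: CkN; apply: CkM; last exact: CkM.
by have [_ [_]] := sF k.+1; apply.
Qed.

Lemma smooth_inv (F : A) : (forall u, val F u != 0) -> exists G : A, F * G = 1.
Proof.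
move=> F0; have sG : (fun u => (val F u)^-1) \in smooth_fun.
  by apply/smooth_funP => k; apply: Ck_inv => // k'; exact: smoothP.
exists (SmoothFun sG); apply: val_inj; apply/funext => u /=.
exact: mulfV.
Qed.

Definition eval_at u (F : A) : R := val F u.

Fact eval_at_zmod u : zmod_morphism (eval_at u). Proof. by []. Qed.
Fact eval_at_monoid u : monoid_morphism (eval_at u). Proof. by []. Qed.
HB.instance Definition _ u := GRing.isZmodMorphism.Build A R (eval_at u) (eval_at_zmod u).
HB.instance Definition _ u := GRing.isMonoidMorphism.Build A R (eval_at u) (eval_at_monoid u).

Lemma smooth_eqP (F G : A) : (forall u, eval_at u F = eval_at u G) -> F = G.
Proof. by move=> FG; apply: val_inj; apply/funext. Qed.

(** Cramer's rule: a determinant without zeros is a unit of the ring, by [smooth_inv]. *)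
Lemma smooth_mx_inv m (X : 'M[A]_m) : (forall u, \det (map_mx (eval_at u) X) != 0) ->
  exists Y : 'M[A]_m, X *m Y = 1%:M /\ Y *m X = 1%:M.
Proof.
move=> X0; have [|d Xd] := @smooth_inv (\det X).
  by move=> u; have := X0 u; rewrite det_map_mx.
exists (d *: \adj X); split.
  by rewrite -scalemxAr mul_mx_adj scale_scalar_mx mulrC Xd.
by rewrite -scalemxAl mul_adj_mx scale_scalar_mx mulrC Xd.
Qed.

End SmoothRing.

Lemma JmxJ (R : realType) (n : nat) : @Jmx R n *m Jmx = - 1%:M.
Proof.
rewrite mulmx_block !mulmx0 !mul0mx !mul1mx !add0r !addr0 mulmx1.
by rewrite [RHS](_ : _ = block_mx (- 1%:M) 0 0 (- 1%:M)) // scalar_mx_block opp_block_mx !oppr0.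
Qed.

Lemma JmxT (R : realType) (n : nat) : (@Jmx R n)^T = - Jmx.
Proof.
by rewrite tr_block_mx opp_block_mx !trmx0 linearN /= trmx1 !oppr0 opprK.
Qed.

(** * Curvature and evolution along a family of directions *)

Section Geometry.
Context {R : realType} {V : normedModType R} {O : Type} {n : nat}.
Variables (v : O -> V) (D : open_set V) (sp : 'I_(n + n) -> O).
Variable gam : V -> 'M[R]_(n + n).
Hypothesis gam_smooth : forall a b, smooth_along v D (fun x => gam x a b).
Local Notation T := (set_type (oset D)).
Local Notation A := (smooth_ring v D).
Local Notation m := (n + n)%N.
Implicit Types (a b c d : 'I_m) (u : T) (x : V) (F : A).

(* Covers both a chart (v ranges over the coordinate vectors) and space-time, where
   v has one more vector, for time, and sp selects the spatial ones. *)
Definition dirpart a (f : V -> R) : V -> R := 'D_(v (sp a)) f.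

Definition dir_christoffel a b c x : R :=
  2^-1 * \sum_d invmx (gam x) c d *
    (dirpart a (fun y => gam y b d) x + dirpart b (fun y => gam y a d) x
     - dirpart d (fun y => gam y a b) x).

Definition dir_curv a b x : 'M[R]_m :=
  \matrix_(c, d)
    (dirpart a (dir_christoffel b c d) x - dirpart b (dir_christoffel a c d) x
     + \sum_e (dir_christoffel b c e x * dir_christoffel a e d x
               - dir_christoffel a c e x * dir_christoffel b e d x)).

Definition dir_ric x : 'M[R]_m := \matrix_(b, d) \sum_a dir_curv a b x d a.

Definition smooth_metric : 'M[A]_m := \matrix_(a, b) smooth_of (gam_smooth a b).
Local Notation G := smooth_metric.
Definition smooth_J : 'M[A]_m := map_mx (smooth_cst v D) Jmx.
Local Notation J := smooth_J.
Definition smooth_pd a : derivation A := smooth_der v D (sp a).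
Local Notation pd := smooth_pd.
Definition smooth_half : A := smooth_cst v D 2^-1.
Local Notation h := smooth_half.
Local Notation ev u := (@eval_at R V O v D u).

Lemma eval_mxP k l (X Y : 'M[A]_(k, l)) :
  (forall u, map_mx (ev u) X = map_mx (ev u) Y) -> X = Y.
Proof.
move=> XY; apply/matrixP=> i j; apply: smooth_eqP => u.
by have /matrixP/(_ i j) := XY u; rewrite !mxE.
Qed.

Lemma eval_G u : map_mx (ev u) G = gam (val u).
Proof. by apply/matrixP=> i j; rewrite !mxE. Qed.

Lemma eval_J u : map_mx (ev u) J = Jmx.
Proof. by apply/matrixP=> i j; rewrite !mxE. Qed.

Lemma half_half : h + h = 1.
Proof.
apply: smooth_eqP => u; rewrite raddfD rmorph1.
change (2^-1 + 2^-1 = 1 :> R); lra.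
Qed.

Lemma smooth_pdC a b F : pd a (pd b F) = pd b (pd a F).
Proof. exact: smooth_der_comm. Qed.

Lemma smooth_der_J o : dmx (smooth_der v D o) J = 0.
Proof. by apply/matrixP=> i j; rewrite !mxE; exact: smooth_cst_der. Qed.

Lemma smooth_JJ : J *m J = - 1%:M.
Proof. by apply: eval_mxP => u; rewrite map_mxM !eval_J map_mxN map_mx1 JmxJ. Qed.

Lemma smooth_JT : J^T = - J.
Proof. by apply: eval_mxP => u; rewrite -map_trmx map_mxN !eval_J JmxT. Qed.

Lemma eval_pd a F (f : V -> R) u : val F = restr f -> ev u (pd a F) = dirpart a f (val u).
Proof. by move=> Ff; rewrite /eval_at /= Ff pder_restr. Qed.

Hypothesis gamT : forall x, oset D x -> (gam x)^T = gam x.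
Hypothesis gamJ : forall x, oset D x -> Jmx *m gam x *m Jmx^T = gam x.
Hypothesis gam_closed : forall x a b c, oset D x ->
  dirpart a (fun y => (Jmx *m gam y) b c) x + dirpart b (fun y => (Jmx *m gam y) c a) x
  + dirpart c (fun y => (Jmx *m gam y) a b) x = 0.

Lemma smooth_GT : G^T = G.
Proof.
by apply: eval_mxP => u; rewrite -map_trmx !eval_G gamT //; exact: set_valP.
Qed.

Lemma commJ_of (X : 'M[R]_m) : Jmx *m X *m Jmx^T = X -> Jmx *m X = X *m Jmx.
Proof.
move=> e; rewrite -[in RHS]e -!mulmxA JmxT mulNmx JmxJ.
by rewrite opprK mulmx1.
Qed.

Lemma smooth_GJ : J *m G = G *m J.
Proof.
apply: eval_mxP => u; rewrite !map_mxM !eval_G !eval_J; apply: commJ_of.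
by apply: gamJ; exact: set_valP.
Qed.

Lemma smooth_closed a b c :
  pd a ((J *m G) b c) + pd b ((J *m G) c a) + pd c ((J *m G) a b) = 0.
Proof.
have e d p q u : ev u (pd d ((J *m G) p q)) = dirpart d (fun y => (Jmx *m gam y) p q) (val u).
  apply: eval_pd; apply/funext => w.
  transitivity (map_mx (ev w) (J *m G) p q); first by rewrite [RHS]mxE.
  by rewrite map_mxM eval_J eval_G.
apply: smooth_eqP => u; rewrite !raddfD raddf0 /= !e.
by apply: gam_closed; exact: set_valP.
Qed.

Variable Gi : 'M[A]_m.
Hypothesis GGi : G *m Gi = 1%:M.
Hypothesis GiG : Gi *m G = 1%:M.

Lemma eval_Gi u : map_mx (ev u) Gi = invmx (gam (val u)).
Proof.
have e : gam (val u) *m map_mx (ev u) Gi = 1%:M by rewrite -eval_G -map_mxM GGi map_mx1.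
have gu : gam (val u) \in unitmx by exact: (mulmx1_unit e).1.
by rewrite -[RHS]mulmx1 -e mulKmx.
Qed.

Lemma val_christoffel a b c :
  val (alg_christoffel pd G Gi h a b c) = restr (dir_christoffel a b c).
Proof.
apply/funext => u; rewrite -[LHS]/(ev u _) /alg_christoffel rmorphM /=.
congr (_ * _); rewrite rmorph_sum; apply: eq_bigr => d _.
have e : ev u (Gi c d) = invmx (gam (val u)) c d by rewrite -eval_Gi mxE.
have eG p q r : ev u (pd p (G q r)) = dirpart p (fun y => gam y q r) (val u).
  by apply: eval_pd; rewrite mxE.
by rewrite rmorphM rmorphB rmorphD /= e !eG.
Qed.

Lemma eval_curv a b u : map_mx (ev u) (alg_curv pd G Gi h a b) = dir_curv a b (val u).
Proof.
pose ch := alg_christoffel pd G Gi h.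
have eP p q c d : ev u (pd p (ch q c d)) = dirpart p (dir_christoffel q c d) (val u).
  exact: eval_pd (val_christoffel _ _ _).
have eC q c d : ev u (ch q c d) = dir_christoffel q c d (val u).
  exact: (congr1 (fun F : T -> R => F u) (val_christoffel q c d)).
have -> : alg_curv pd G Gi h a b = \matrix_(c, d) (pd a (ch b c d) - pd b (ch a c d)
  + \sum_e (ch b c e * ch a e d - ch a c e * ch b e d)) by [].
clearbody ch; apply/matrixP=> c d; rewrite !mxE rmorphD rmorphB rmorph_sum /= !eP.
by congr (_ + _); apply: eq_bigr => e _; rewrite rmorphB !rmorphM /= !eC.
Qed.

Lemma eval_ric u : map_mx (ev u) (alg_ric pd G Gi h) = dir_ric (val u).
Proof.
apply/matrixP=> b d; rewrite mxE [alg_ric _ _ _ _ _ _]mxE [RHS]mxE rmorph_sum.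
by apply: eq_bigr => a _; rewrite -eval_curv [RHS]mxE.
Qed.

Lemma dir_curvJ a b u : Jmx *m dir_curv a b (val u) = dir_curv a b (val u) *m Jmx.
Proof.
rewrite -eval_curv -(eval_J u) -!map_mxM; congr map_mx.
exact: (curvJ half_half smooth_pdC (fun a => smooth_der_J (sp a)) smooth_JJ smooth_JT
  smooth_GT smooth_GJ GGi GiG smooth_closed).
Qed.

Lemma dir_ricT u : (dir_ric (val u))^T = dir_ric (val u).
Proof.
rewrite -eval_ric map_trmx; congr map_mx.
exact: (ricT half_half smooth_pdC (fun a => smooth_der_J (sp a)) smooth_JJ smooth_JT
  smooth_GT smooth_GJ GGi GiG smooth_closed).
Qed.

Lemma dir_ricJ u : Jmx *m dir_ric (val u) = dir_ric (val u) *m Jmx.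
Proof.
rewrite -eval_ric -(eval_J u) -!map_mxM; congr map_mx.
exact: (ricJ half_half smooth_pdC (fun a => smooth_der_J (sp a)) smooth_JJ smooth_JT
  smooth_GT smooth_GJ GGi GiG smooth_closed).
Qed.

Lemma ext0_pder p (F : A) x : oset D x ->
  ext0 (smooth_val (smooth_der v D p F)) x = 'D_(v p) (ext0 (smooth_val F)) x.
Proof. by move=> Dx; rewrite -(SubK T (mem_set Dx : x \in oset D)) ext0E. Qed.

Lemma near_line u (e : V) : \forall s \near (0 : R), oset D (val u + s *: e).
Proof.
have c : {for 0, continuous (fun s : R => val u + s *: e)}.
  apply: continuousD; first exact: cst_continuous.
  exact: scalel_continuous.
by apply: c; rewrite /= scale0r addr0; exact: near_oset.
Qed.

(** The derivative along the constant vector [dirvec c], taken inside the ring so that it can be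
    iterated. *)
Definition dirder (c : 'I_m -> R) (F : A) : A :=
  \sum_(a < m) smooth_cst v D (c a) * pd a F.
Definition dirvec (c : 'I_m -> R) : V := \sum_(a < m) c a *: v (sp a).

Lemma is_derive_dirvec (c : 'I_m -> R) (F : A) x : oset D x ->
  is_derive x (dirvec c) (ext0 (smooth_val F)) (ext0 (smooth_val (dirder c F)) x).
Proof.
move=> Dx.
have -> : ext0 (smooth_val (dirder c F)) x =
    \sum_(a < m) c a * 'D_(v (sp a)) (ext0 (smooth_val F)) x.
  rewrite -(SubK T (mem_set Dx : x \in oset D)) ext0E -[LHS]/(ev _ _).
  by rewrite rmorph_sum; apply: eq_bigr => a _; rewrite rmorphM.
apply: (is_derive_lincomb (open_oset D) (v := fun a => v (sp a))) => //.
  move=> a y Dy; have := @smooth_derivable _ _ _ v D F (exist _ y (mem_set Dy)) (sp a).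
  by [].
move=> a y Dy.
have ne : \forall z \near y, ext0 (smooth_val (pd a F)) z = 'D_(v (sp a)) (ext0 (smooth_val F)) z.
  apply: filterS (open_nbhs_nbhs (conj (open_oset D) Dy)) => z Dz.
  exact: ext0_pder.
have := (smoothP (pd a F) 0).1 (exist _ y (mem_set Dy)).
rewrite /prop_for /continuous_at (nbhs_singleton ne) => cy.
by apply: cvg_trans cy; apply: near_eq_cvg; apply: filterS ne => z ->.
Qed.

Lemma near_is_derive_dirvec (c : 'I_m -> R) (F : A) u : \forall s \near (0 : R),
  is_derive s (1 : R) (fun s : R => ext0 (smooth_val F) (val u + s *: dirvec c))
    (ext0 (smooth_val (dirder c F)) (val u + s *: dirvec c)).
Proof.
apply: filterS (near_line u (dirvec c)) => s Ds.
have [dF <-] := is_derive_dirvec c F Ds.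
exact: is_derive_line.
Qed.

Lemma dirder2_max (c : 'I_m -> R) (F : A) u :
    (\forall s \near (0 : R),
       ext0 (smooth_val F) (val u + s *: dirvec c) <= ext0 (smooth_val F) (val u)) ->
  ev u (dirder c (dirder c F)) <= 0.
Proof.
move=> mF; apply: (derive2_near_max (near_is_derive_dirvec c F u)).
  have := nbhs_singleton (near_is_derive_dirvec c (dirder c F) u).
  by rewrite scale0r addr0 ext0E.
by rewrite scale0r addr0.
Qed.

Lemma eval_dirder2 (c : 'I_m -> R) (F : A) u : ev u (dirder c (dirder c F)) =
  \sum_(a < m) \sum_(b < m) c a * c b * ev u (pd a (pd b F)).
Proof.
rewrite /dirder rmorph_sum; apply: eq_bigr => a _ /=.
rewrite rmorphM der_sum rmorph_sum mulr_sumr; apply: eq_bigr => b _ /=.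
by rewrite (der_cstM _ (smooth_cst_der _ _ _ _)) rmorphM mulrA.
Qed.

(** The factorisation of the inverse metric turns the Laplacian at the point u into a nonnegative
    multiple of the sum of the second derivatives along the rows of C, and none of these is positive
    at a maximum. *)
Lemma lapl_max (C : 'M[R]_m) (F : A) u : invmx (gam (val u)) = C^T *m C ->
    (forall c : 'I_m -> R, \forall s \near (0 : R),
       ext0 (smooth_val F) (val u + s *: dirvec c) <= ext0 (smooth_val F) (val u)) ->
  ev u (alg_lapl pd Gi h F) <= 0.
Proof.
move=> giC mF; rewrite /alg_lapl rmorphM rmorph_sum /=.
rewrite mulr_ge0_le0 //; first by rewrite /eval_at /= /restr /= invr_ge0.
have -> : \sum_(a < m) ev u (\sum_(b < m) Gi a b * pd a (pd b F)) =
    \sum_(k < m) ev u (dirder (C k) (dirder (C k) F)).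
  under [RHS]eq_bigr do rewrite eval_dirder2.
  rewrite exchange_big; apply: eq_bigr => a _; rewrite rmorph_sum exchange_big.
  apply: eq_bigr => b _; rewrite rmorphM -mulr_suml; congr (_ * _).
  transitivity (map_mx (ev u) Gi a b); first by rewrite mxE.
  by rewrite eval_Gi giC mxE; apply: eq_bigr => k _; rewrite mxE.
by apply: sumr_le0 => k _; apply: dirder2_max.
Qed.

Lemma time_max (tau : O) (F : A) u :
    (\forall s \near (0 : R), s <= 0 ->
       ext0 (smooth_val F) (val u + s *: v tau) <= ext0 (smooth_val F) (val u)) ->
  0 <= ev u (smooth_der v D tau F).
Proof.
move=> mF.
apply: (@derive_left_max _ (fun s : R => ext0 (smooth_val F) (val u + s *: v tau))).
  have := @is_derive_line R V (ext0 (smooth_val F)) (val u) (v tau) 0.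
  rewrite scale0r addr0 -(ext0_pder _ _ (set_valP u)) ext0E; apply.
  exact: smooth_derivable.
by rewrite scale0r addr0.
Qed.

(** With the same factorisation the sum becomes one of squares: U k is the covariant derivative of
    Rc along row k of C, and C U k C^T has its components in the frame. *)
Lemma eval_grad2_ge0 (C : 'M[R]_m) u : invmx (gam (val u)) = C^T *m C ->
  0 <= ev u (alg_grad2 pd J G Gi h).
Proof.
move=> giC; rewrite /alg_grad2.
move: (nabla_ric pd J G Gi h) => Tn; pose t b := map_mx (ev u) (Tn b).
pose U k : 'M[R]_m := \sum_b C k b *: t b.
have -> : ev u (\sum_b \sum_d Gi b d * \tr (Tn b *m Gi *m (Tn d)^T *m Gi)) =
    \sum_k \tr ((C *m U k *m C^T) *m (C *m U k *m C^T)^T).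
  transitivity (\sum_b \sum_d (\sum_k C k b * C k d) *
      \tr (t b *m (C^T *m C) *m (t d)^T *m (C^T *m C))).
    rewrite rmorph_sum; apply: eq_bigr => b _; rewrite rmorph_sum; apply: eq_bigr => d _.
    rewrite rmorphM -giC -eval_Gi /t map_trmx -!map_mxM -trace_map_mx; congr (_ * _).
    transitivity (map_mx (ev u) Gi b d); first by rewrite mxE.
    by rewrite eval_Gi giC mxE; apply: eq_bigr => k _; rewrite mxE.
  transitivity (\sum_k \sum_b \sum_d C k b * C k d *
      \tr (t b *m (C^T *m C) *m (t d)^T *m (C^T *m C))).
    rewrite [RHS]exchange_big; apply: eq_bigr => b _; rewrite [RHS]exchange_big.
    by apply: eq_bigr => d _; rewrite mulr_suml.
  apply: eq_bigr => k _; rewrite !trmx_mul trmxK -!mulmxA [RHS]mxtrace_mulC -!mulmxA.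
  rewrite /U mulmx_suml raddf_sum; apply: eq_bigr => b _ /=.
  rewrite linear_sum /= mulmx_suml !mulmx_sumr raddf_sum; apply: eq_bigr => d _ /=.
  rewrite [(_ *: _)^T]linearZ /= -!(scalemxAl, scalemxAr).
  by rewrite !mxtraceZ mulrA -!mulmxA.
apply: sumr_ge0 => k _; rewrite mxtrace_mulE; apply: sumr_ge0 => p _.
by apply: sumr_ge0 => q _; rewrite [_^T _ _]mxE -expr2 sqr_ge0.
Qed.

Definition dir_Rm x : tensor4 := fun a b c d =>
  \sum_e dir_curv a b x d e * gam x e c.
Definition dir_scal x : R := \tr (dir_ric x *m invmx (gam x)).
Definition dir_ric2 x : R :=
  \tr (dir_ric x *m invmx (gam x) *m (dir_ric x *m invmx (gam x))).
Definition dir_Rm_ric_ric x : R :=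
  \sum_a \sum_b \sum_c \sum_d dir_Rm x a b c d *
    ((invmx (gam x) *m (dir_ric x *m invmx (gam x))) a c
     * (invmx (gam x) *m (dir_ric x *m invmx (gam x))) b d).

Lemma eval_scal u : ev u (alg_scal pd G Gi h) = dir_scal (val u).
Proof. by rewrite /alg_scal -trace_map_mx map_mxM eval_Gi eval_ric. Qed.

Lemma eval_ric2 u : ev u (alg_ric2 pd G Gi h) = dir_ric2 (val u).
Proof. by rewrite /alg_ric2 -trace_map_mx !map_mxM eval_Gi eval_ric. Qed.

Lemma eval_Rm_ric_ric u : ev u (curv_ric_ric pd J G Gi h) = - dir_Rm_ric_ric (val u).
Proof.
have := Rm_ric_ric half_half smooth_pdC (fun a => smooth_der_J (sp a)) smooth_JJ smooth_JT
  smooth_GT smooth_GJ GGi GiG smooth_closed.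
move=> /(congr1 (ev u)); rewrite rmorphN => e; rewrite -[LHS]opprK -[X in - X]e {e}.
congr (- _).
have eP a c : ev u ((Gi *m End_ric pd G Gi h) a c) =
    (invmx (gam (val u)) *m (dir_ric (val u) *m invmx (gam (val u)))) a c.
  transitivity (map_mx (ev u) (Gi *m End_ric pd G Gi h) a c); first by rewrite [RHS]mxE.
  by rewrite !map_mxM eval_Gi eval_ric.
rewrite rmorph_sum; apply: eq_bigr => a _; rewrite rmorph_sum; apply: eq_bigr => b _.
rewrite rmorph_sum; apply: eq_bigr => c _; rewrite rmorph_sum; apply: eq_bigr => d _ /=.
rewrite !rmorphM /= !eP; congr (_ * _).
rewrite /alg_Rm rmorph_sum; apply: eq_bigr => e _; rewrite rmorphM /= -eval_curv.
by congr (_ * _); [rewrite [RHS]mxE|rewrite -eval_G [RHS]mxE].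
Qed.

(** Subtract B times the evolution of R from that of |Rc|^2. At the maximum the time derivative is
    nonnegative, the Laplacian nonpositive, and the gradient term has a favourable sign; what
    remains is of order zero. *)
Lemma flow_at_max (tau : O) (C : 'M[R]_m) (B : R) u :
    (forall x a b, oset D x ->
       'D_(v tau) (fun y => gam y a b) x = gam x a b - dir_ric x a b) ->
    invmx (gam (val u)) = C^T *m C ->
    (forall c : 'I_m -> R, \forall s \near (0 : R),
       dir_ric2 (val u + s *: dirvec c) - B * dir_scal (val u + s *: dirvec c)
       <= dir_ric2 (val u) - B * dir_scal (val u)) ->
    (\forall s \near (0 : R), s <= 0 ->
       dir_ric2 (val u + s *: v tau) - B * dir_scal (val u + s *: v tau)
       <= dir_ric2 (val u) - B * dir_scal (val u)) ->
  0 <= dir_Rm_ric_ric (val u) *+ 2 - dir_ric2 (val u) *+ 2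
       - B * (dir_ric2 (val u) - dir_scal (val u)).
Proof.
move=> flow giC mspace mtime.
pose F : A := alg_ric2 pd G Gi h - smooth_cst v D B * alg_scal pd G Gi h.
have extF x : oset D x -> ext0 (smooth_val F) x = dir_ric2 x - B * dir_scal x.
  move=> Dx; rewrite -(SubK T (mem_set Dx : x \in oset D)) ext0E -[LHS]/(ev _ _).
  by rewrite rmorphB rmorphM /= eval_scal eval_ric2.
have DF : 0 <= ev u (smooth_der v D tau F).
  apply: time_max; rewrite extF; last exact: set_valP.
  apply: filterS2 mtime (near_line u (v tau)) => s ms Ds s0.
  by rewrite extF //; exact: ms.
have LF : ev u (alg_lapl pd Gi h F) <= 0.
  apply: lapl_max giC _ => c; rewrite extF; last exact: set_valP.
  apply: filterS2 (mspace c) (near_line u (dirvec c)) => s ms Ds.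
  by rewrite extF.
have dtg : dmx (smooth_der v D tau) G = G - alg_ric pd G Gi h.
  apply: eval_mxP => w; rewrite map_mxB eval_G eval_ric.
  apply/matrixP=> a b; rewrite [RHS]mxE [X in _ = _ + X]mxE -flow; last exact: set_valP.
  rewrite [LHS]mxE [dmx _ _ _ _]mxE /eval_at /= (_ : smooth_val _ = restr (fun y => gam y a b)).
    by rewrite pder_restr.
  by rewrite mxE.
have dtC a F' : smooth_der v D tau (pd a F') = pd a (smooth_der v D tau F').
  exact: smooth_der_comm.
have eR := evolution_scal half_half smooth_pdC (fun a => smooth_der_J (sp a)) smooth_JJ
  smooth_JT smooth_GT smooth_GJ GGi GiG smooth_closed dtC (smooth_der_J tau) dtg.
have eN := evolution_ric2 half_half smooth_pdC (fun a => smooth_der_J (sp a)) smooth_JJ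
  smooth_JT smooth_GT smooth_GJ GGi GiG smooth_closed dtC (smooth_der_J tau) dtg.
have cB o : smooth_der v D o (smooth_cst v D B) = 0 by exact: smooth_cst_der.
have laplF : alg_lapl pd Gi h F = alg_lapl pd Gi h (alg_ric2 pd G Gi h)
    - smooth_cst v D B * alg_lapl pd Gi h (alg_scal pd G Gi h).
  rewrite /alg_lapl mulrCA -mulrBr; congr (_ * _); rewrite mulr_sumr -sumrB.
  apply: eq_bigr => a _; rewrite mulr_sumr -sumrB; apply: eq_bigr => b _.
  by rewrite !derB (der_cstM _ (cB _)) (der_cstM _ (cB _)) mulrBr mulrCA.
have := eval_grad2_ge0 giC.
move: DF LF; rewrite laplF derB (der_cstM _ (cB _)) eR eN.
rewrite !(rmorphB, rmorphD, rmorphM, rmorphMn) /= eval_Rm_ric_ric.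
rewrite eval_scal eval_ric2.
have -> : ev u (smooth_cst v D B) = B by [].
move: (ev u _) (ev u _) (ev u _) (dir_Rm_ric_ric _) (dir_ric2 _) (dir_scal _).
by move=> l1 gr l2 k r2 r; rewrite !mulr2n; nra.
Qed.

End Geometry.

(** * Orthonormal frames and the Weyl tensor *)

(** The rows of C are the frame. Gram-Schmidt by induction on blocks: C is block triangular, and its
    last block comes from the Schur complement d - b^T b / s. *)
Lemma orthonormal_frame (R : realType) m (h : 'M[R]_m) : h^T = h ->
    (forall x : 'rV_m, x != 0 -> 0 < (x *m h *m x^T) 0 0) ->
  exists C : 'M[R]_m, C *m h *m C^T = 1%:M.
Proof.
elim: m h => [|m IHm] h hT hpos; first by exists 1%:M; apply/matrixP=> -[].
rewrite -[m.+1]/(1 + m)%N in h hT hpos *.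
pose a := ulsubmx h; pose b := ursubmx h; pose d := drsubmx h.
have hE : h = block_mx a b b^T d.
  rewrite -[LHS]submxK; congr block_mx.
  by rewrite -[in LHS]hT /b trmx_ursub.
have dT : d^T = d by rewrite /d trmx_drsub hT.
pose s := a 0 0; have aE : a = s%:M by exact: mx11_scalar.
have quad x y : (row_mx x y *m h *m (row_mx x y)^T) =
    x *m a *m x^T + y *m b^T *m x^T + (x *m b *m y^T + y *m d *m y^T).
  by rewrite hE mul_row_block tr_row_mx mul_row_col !mulmxDl.
have s0 : 0 < s.
  have := hpos (row_mx 1%:M 0); rewrite quad !mul0mx !trmx0 !mulmx0 !addr0 mul1mx.
  rewrite trmx1 mulmx1; apply; apply/eqP => /matrixP/(_ 0 (lshift _ 0)).
  by rewrite row_mxEl !mxE eqxx => /eqP; rewrite oner_eq0.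
have [||C' C'E] := IHm (d - s^-1 *: (b^T *m b)).
- by rewrite linearB linearZ /= trmx_mul trmxK dT.
(* Completing the square: for this choice of the first coordinate, h takes the value of the Schur
   complement at x. *)
- move=> x x0; have := hpos (row_mx (- (s^-1 *: (x *m b^T))) x).
  rewrite quad aE => H; have nz : (row_mx (- (s^-1 *: (x *m b^T))) x) != 0.
    by apply: contra x0 => /eqP/(congr1 rsubmx); rewrite row_mxKr linear0 => ->.
  move: (H nz); set z := (X in X 0 0) => z0; congr (0 < _): z0.
  congr (fun_of_matrix _ 0 0); rewrite {}/z mul_mx_scalar scalerN scalerA mulfV ?gt_eqF //.
  rewrite scale1r mulNmx addNr add0r !mulNmx mulmxBr mulmxBl addrC; congr (_ - _).
  by rewrite -!scalemxAl -scalemxAr -scalemxAl !mulmxA.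
pose r := Num.sqrt s; have r0 : r != 0 by rewrite gt_eqF // sqrtr_gt0.
have rr : r * r = s by rewrite -expr2 sqr_sqrtr // ltW.
exists (block_mx (r^-1)%:M 0 (- (s^-1 *: (C' *m b^T))) C').
rewrite hE mulmx_block !mul0mx !addr0 tr_block_mx trmx0 tr_scalar_mx mulmx_block.
have X0 : - (s^-1 *: (C' *m b^T)) *m a + C' *m b^T = 0.
  by rewrite aE mulNmx mul_mx_scalar scalerA mulfV ?gt_eqF // scale1r addNr.
rewrite X0 !mul0mx !mulmx0 !addr0 add0r aE -!scalar_mxM (scalar_mx_block 1 m).
congr block_mx.
- by congr (_%:M); rewrite -rr mulrA mulVf // mul1r mulfV.
- rewrite linearN linearZ /= trmx_mul trmxK mulmxN -scalemxAr !mul_scalar_mx scalerA.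
  rewrite -scalemxAl -scaleNr -scalerDl.
  by rewrite [X in X *: _](_ : _ = 0) ?scale0r // -rr; field.
rewrite -[RHS]C'E mulmxBr mulNmx addrC; congr ((_ - _) *m _).
by rewrite -scalemxAl -scalemxAr mulmxA.
Qed.

Section Frame.
Context {R : realType} {m : nat}.
Implicit Types (h k C : 'M[R]_m) (X Y : @tensor4 R m) (p q r s a b c d : 'I_m).

Definition frame_tensor C X : tensor4 := fun p q r s =>
  \sum_a \sum_b \sum_c \sum_d C p a * C q b * C r c * C s d * X a b c d.

Lemma sum4E (F : 'I_m -> 'I_m -> 'I_m -> 'I_m -> R) :
  \sum_a \sum_b \sum_c \sum_d F a b c d =
  \sum_(x : 'I_m * 'I_m * ('I_m * 'I_m)) F x.1.1 x.1.2 x.2.1 x.2.2.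
Proof.
rewrite pair_bigA -(pair_bigA _ (fun x y => F x.1 x.2 y.1 y.2)) /=.
by apply: eq_bigr => x _; rewrite pair_bigA.
Qed.

Lemma prod_sum4 (f1 f2 f3 f4 : 'I_m -> R) :
  (\sum_a f1 a) * (\sum_b f2 b) * (\sum_c f3 c) * (\sum_d f4 d) =
  \sum_a \sum_b \sum_c \sum_d f1 a * f2 b * f3 c * f4 d.
Proof.
rewrite -!mulrA mulr_suml; apply: eq_bigr => a _.
rewrite mulr_suml mulr_sumr; apply: eq_bigr => b _.
rewrite mulr_suml !mulr_sumr; apply: eq_bigr => c _.
by rewrite !mulr_sumr; apply: eq_bigr => d _; rewrite !mulrA.
Qed.

(** Each of the four inverse metrics splits as a sum over frame indices, so that the double sum over
    components becomes a sum of squares of frame components. *)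
Lemma tensor4_normE h C X : invmx h = C^T *m C ->
  tensor4_norm h X = Num.sqrt (\sum_p \sum_q \sum_r \sum_s frame_tensor C X p q r s ^+ 2).
Proof.
move=> hC; congr Num.sqrt; rewrite !sum4E.
pose B (k x : 'I_m * 'I_m * ('I_m * 'I_m)) :=
  C k.1.1 x.1.1 * C k.1.2 x.1.2 * C k.2.1 x.2.1 * C k.2.2 x.2.2.
pose X' (x : 'I_m * 'I_m * ('I_m * 'I_m)) := X x.1.1 x.1.2 x.2.1 x.2.2.
transitivity (\sum_x \sum_y (\sum_k B k x * B k y) * (X' x * X' y)).
  apply: eq_bigr => x _; rewrite sum4E; apply: eq_bigr => y _.
  rewrite -/(X' x) -/(X' y) -mulrA hC; congr (_ * _).
  have e a b : (C^T *m C) a b = \sum_k C k a * C k b.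
    by rewrite mxE; apply: eq_bigr => k _; rewrite mxE.
  rewrite !e prod_sum4 !sum4E; apply: eq_bigr => k _.
  by rewrite /B; ring.
transitivity (\sum_k (\sum_x B k x * X' x) ^+ 2); last first.
  by apply: eq_bigr => k _; rewrite /frame_tensor sum4E.
transitivity (\sum_x \sum_k \sum_y (B k x * X' x) * (B k y * X' y)).
  apply: eq_bigr => x _; rewrite exchange_big; apply: eq_bigr => y _.
  by rewrite mulr_suml; apply: eq_bigr => k _; ring.
rewrite exchange_big; apply: eq_bigr => k _; rewrite expr2 mulr_suml.
by apply: eq_bigr => x _; rewrite mulr_sumr.
Qed.

Lemma frame_tensor_le h C X p q r s : invmx h = C^T *m C ->
  `|frame_tensor C X p q r s| <= tensor4_norm h X.
Proof.
move=> /tensor4_normE ->; rewrite -sqrtr_sqr; apply: ler_wsqrtr.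
rewrite sum4E (bigD1 (p, q, (r, s))) //= lerDl.
by apply: sumr_ge0 => x _; rewrite sqr_ge0.
Qed.

Lemma tensor4_norm_le h C X w : invmx h = C^T *m C ->
    (forall p q r s, `|frame_tensor C X p q r s| <= w) ->
  tensor4_norm h X <= Num.sqrt ((m ^ 4)%:R * w ^+ 2).
Proof.
move=> /tensor4_normE -> Xw; apply: ler_wsqrtr.
have -> : (m ^ 4)%:R * w ^+ 2 = \sum_(p < m) \sum_(q < m) \sum_(r < m) \sum_(s < m) w ^+ 2.
  rewrite !sumr_const !card_ord -!mulrnA mulr_natl; congr (_ *+ _).
apply: ler_sum => p _; apply: ler_sum => q _; apply: ler_sum => r _; apply: ler_sum => s _.
rewrite -[leLHS]real_normK ?num_real //.
by rewrite lerXn2r // nnegrE (le_trans (normr_ge0 _) (Xw p q r s)).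
Qed.

Lemma frame_tensorD C X Y p q r s :
  frame_tensor C (fun a b c d => X a b c d + Y a b c d) p q r s =
  frame_tensor C X p q r s + frame_tensor C Y p q r s.
Proof.
rewrite /frame_tensor !sum4E -big_split; apply: eq_bigr => x _ /=.
by rewrite mulrDr.
Qed.

Lemma frame_tensorZ C (k : R) X p q r s :
  frame_tensor C (fun a b c d => k * X a b c d) p q r s =
  k * frame_tensor C X p q r s.
Proof.
rewrite /frame_tensor !sum4E mulr_sumr; apply: eq_bigr => x _ /=.
by rewrite mulrCA.
Qed.

Definition frame_mx C h : 'M[R]_m := C *m h *m C^T.

Lemma frame_mxE C h p r : frame_mx C h p r = \sum_a \sum_c C p a * C r c * h a c.
Proof.
rewrite /frame_mx mxE exchange_big; apply: eq_bigr => c _.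
rewrite !mxE mulr_suml; apply: eq_bigr => a _; ring.
Qed.

Lemma frame_kulkarni_nomizu C h k p q r s :
  frame_tensor C (kulkarni_nomizu h k) p q r s =
  kulkarni_nomizu (frame_mx C h) (frame_mx C k) p q r s.
Proof.
have e (u v : 'M[R]_m) p' q' r' s' : frame_mx C u p' r' * frame_mx C v q' s' =
    \sum_a \sum_c \sum_b \sum_d (C p' a * C r' c * u a c) * (C q' b * C s' d * v b d).
  rewrite !frame_mxE mulr_suml; apply: eq_bigr => a _.
  rewrite mulr_suml; apply: eq_bigr => c _; rewrite mulr_sumr; apply: eq_bigr => b _.
  by rewrite mulr_sumr.
rewrite /kulkarni_nomizu !e /frame_tensor.
have -> : \sum_a \sum_c \sum_b \sum_d
     C p a * C r c * h a c * (C q b * C s d * k b d) =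
   \sum_a \sum_b \sum_c \sum_d C p a * C q b * C r c * C s d * (h a c * k b d).
  apply: eq_bigr => a _; rewrite exchange_big; apply: eq_bigr => b _.
  by apply: eq_bigr => c _; apply: eq_bigr => d _; ring.
have -> : \sum_a \sum_c \sum_b \sum_d
     C q a * C s c * h a c * (C p b * C r d * k b d) =
   \sum_a \sum_b \sum_c \sum_d C p a * C q b * C r c * C s d * (h b d * k a c).
  transitivity (\sum_b \sum_d \sum_a \sum_c C q b * C s d * h b d * (C p a * C r c * k a c)) => //.
  rewrite sum4_swap; apply: eq_bigr => a _; rewrite exchange_big.
  by apply: eq_bigr => b _; apply: eq_bigr => c _; apply: eq_bigr => d _; ring.
have -> : \sum_a \sum_c \sum_b \sum_d
     C p a * C s c * h a c * (C q b * C r d * k b d) =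
   \sum_a \sum_b \sum_c \sum_d C p a * C q b * C r c * C s d * (h a d * k b c).
  apply: eq_bigr => a _; rewrite exchange_big; apply: eq_bigr => b _.
  by rewrite exchange_big; apply: eq_bigr => c _; apply: eq_bigr => d _; ring.
have -> : \sum_a \sum_c \sum_b \sum_d
     C q a * C r c * h a c * (C p b * C s d * k b d) =
   \sum_a \sum_b \sum_c \sum_d C p a * C q b * C r c * C s d * (h b c * k a d).
  transitivity (\sum_b \sum_c \sum_a \sum_d C q b * C r c * h b c * (C p a * C s d * k a d)) => //.
  rewrite sum4_swap; apply: eq_bigr => a _; rewrite exchange_big.
  apply: eq_bigr => b _; rewrite exchange_big.
  by apply: eq_bigr => c _; apply: eq_bigr => d _; ring.
rewrite !sum4E -big_split -!sumrB; apply: eq_bigr => x _ /=.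
by ring.
Qed.

End Frame.

Lemma ler_norm_sum_const (R : realType) m (F : 'I_m -> R) (w : R) :
  (forall i, `|F i| <= w) -> `|\sum_i F i| <= m%:R * w.
Proof.
move=> Fw; apply: le_trans (ler_norm_sum _ _ _) _.
apply: le_trans (ler_sum _ (fun i _ => Fw i)) _.
by rewrite sumr_const card_ord mulr_natl.
Qed.

(** J J^T = 1, so the rows of J are unit vectors. *)
Lemma skew_orthogonal_le1 (R : realType) m (J : 'M[R]_m) i j :
  J *m J = - 1%:M -> J^T = - J -> `|J i j| <= 1.
Proof.
move=> JJ JT; have : (J *m J^T) i i = 1 by rewrite JT mulmxN JJ opprK mxE eqxx.
rewrite mxE (bigD1 j) //= mxE => e.
have : J i j * J i j <= 1.
  rewrite -e lerDl; apply: sumr_ge0 => k _; rewrite mxE -expr2; exact: sqr_ge0.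
by rewrite -expr2 -real_normK ?num_real // expr_le1.
Qed.

(** * Contraction of the Weyl tensor with J *)

Section FrameAlgebra.
Context {R : realType} {m : nat}.
Implicit Types (S J : 'M[R]_m) (X W : @tensor4 R m) (p q r s t : 'I_m).

Definition weyl_part S X : tensor4 := fun p q r s =>
  X p q r s
  + \tr S / (2 * (m%:R - 1) * (m%:R - 2)) * kulkarni_nomizu 1%:M 1%:M p q r s
  - (m%:R - 2)^-1 * kulkarni_nomizu S 1%:M p q r s.

(** The trace over the first and third slots after J has been applied to the last two. On a tensor
    whose last two slots are J-invariant, such as Rm, it is the ordinary Ricci contraction. *)
Definition J_contraction J X q s : R :=
  \sum_p \sum_r \sum_t J p r * J s t * X p q r t.

(** Two of the four terms vanish since J is skew, the other two give S each. The ordinary trace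
    would be (m - 2) S + tr S g; this difference is why W, although trace-free, has a J-contraction
    that remembers Rc. *)
Lemma J_contraction_kn J S q s : J *m J = - 1%:M -> J^T = - J -> S^T = S ->
  J *m S = S *m J -> J_contraction J (kulkarni_nomizu S 1%:M) q s = 2 * S q s.
Proof.
move=> JJ JT ST SJ.
have JE p r : J p r = - J r p by have /matrixP/(_ r p) := JT; rewrite !mxE.
have SE p r : S p r = S r p by rewrite -[in LHS]ST mxE.
have tr0 : \sum_p \sum_r J p r * S p r = 0.
  have : \tr (J *m S) = - \tr (J *m S).
    by rewrite -{1}mxtrace_tr trmx_mul ST JT mulmxN raddfN /= mxtrace_mulC.
  have -> : \tr (J *m S) = \sum_p \sum_r J p r * S p r.
    rewrite mxtrace_mulE; apply: eq_bigr => p _; apply: eq_bigr => r _.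
    by rewrite SE.
  lra.
have delta (F : 'I_m -> R) k : \sum_t F t * (1%:M : 'M[R]_m) k t = F k.
  rewrite (bigD1 k) //= big1 ?addr0 => [|i ik]; first by rewrite mxE eqxx mulr1.
  by rewrite mxE eq_sym (negPf ik) mulr0.
have e1 : \sum_p \sum_r \sum_t J p r * J s t * (S p r * (1%:M : 'M[R]_m) q t) = 0.
  transitivity ((\sum_p \sum_r J p r * S p r) * J s q); last by rewrite tr0 mul0r.
  rewrite mulr_suml; apply: eq_bigr => p _; rewrite mulr_suml; apply: eq_bigr => r _.
  by rewrite -(delta (fun t => J p r * S p r * J s t)); apply: eq_bigr => t _; ring.
have e2 : \sum_p \sum_r \sum_t J p r * J s t * (S q t * (1%:M : 'M[R]_m) p r) = 0.
  apply: big1 => p _; rewrite exchange_big big1 // => t _ /=.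
  transitivity (J p p * J s t * S q t); last first.
    by have := JE p p => /eqP; rewrite -subr_eq0 opprK -mulr2n mulrn_eq0 /= => /eqP ->;
      rewrite !mul0r.
  by rewrite -(delta (fun r => J p r * J s t * S q t)); apply: eq_bigr => r _; ring.
have e3 : \sum_p \sum_r \sum_t J p r * J s t * (S p t * (1%:M : 'M[R]_m) q r) = - S q s.
  transitivity ((J *m S *m J) s q).
    rewrite [RHS]mxE; apply: eq_bigr => p _; rewrite exchange_big [in RHS]mxE mulr_suml.
    apply: eq_bigr => t _; rewrite (SE t p).
    by rewrite -(delta (fun r => J s t * S p t * J p r)); apply: eq_bigr => r _; ring.
  by rewrite SJ -mulmxA JJ mulmxN mulmx1 mxE SE.
have e4 : \sum_p \sum_r \sum_t J p r * J s t * (S q r * (1%:M : 'M[R]_m) p t) = - S q s.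
  transitivity ((J *m (J *m S)) s q).
    rewrite [RHS]mxE; apply: eq_bigr => p _; rewrite [in RHS]mxE mulr_sumr.
    apply: eq_bigr => r _; rewrite (SE r q).
    by rewrite -(delta (fun t => J s t * (J p r * S q r))); apply: eq_bigr => t _; ring.
  by rewrite mulmxA JJ mulNmx mul1mx mxE SE.
transitivity (\sum_p \sum_r \sum_t J p r * J s t * (S p r * (1%:M : 'M[R]_m) q t)
  + \sum_p \sum_r \sum_t J p r * J s t * (S q t * (1%:M : 'M[R]_m) p r)
  - \sum_p \sum_r \sum_t J p r * J s t * (S p t * (1%:M : 'M[R]_m) q r)
  - \sum_p \sum_r \sum_t J p r * J s t * (S q r * (1%:M : 'M[R]_m) p t)).
  rewrite -big_split -!sumrB; apply: eq_bigr => p _.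
  rewrite -big_split -!sumrB; apply: eq_bigr => r _.
  rewrite -big_split -!sumrB; apply: eq_bigr => t _ /=.
  by rewrite /kulkarni_nomizu; ring.
by rewrite e1 e2 e3 e4; ring.
Qed.

Lemma J_contraction_lin J X Y W (k l : R) q s :
  J_contraction J (fun p q r s => X p q r s + k * Y p q r s - l * W p q r s) q s =
  J_contraction J X q s + k * J_contraction J Y q s - l * J_contraction J W q s.
Proof.
rewrite /J_contraction !mulr_sumr -big_split -sumrB; apply: eq_bigr => p _ /=.
rewrite !mulr_sumr -big_split -sumrB; apply: eq_bigr => r _ /=.
rewrite !mulr_sumr -big_split -sumrB; apply: eq_bigr => t _ /=.
by ring.
Qed.

Variables (S J : 'M[R]_m) (X : @tensor4 R m).
Hypothesis m3 : (2 < m)%N.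
Hypothesis contraction : forall q s, \sum_p X p q p s = S q s.
Hypothesis ST : S^T = S.
Hypothesis JJ : J *m J = - 1%:M.
Hypothesis JT : J^T = - J.
Hypothesis SJ : J *m S = S *m J.
Hypothesis XJ : forall p q r s, \sum_r' \sum_s' J r r' * J s s' * X p q r' s' = X p q r s.

Local Notation rho := (\tr S).
Local Notation M := (m%:R : R).

Lemma m2_gt0 : 0 < M - 2.
Proof. by rewrite subr_gt0 ltr_nat. Qed.

Lemma m1_gt0 : 0 < M - 1.
Proof. by have := m2_gt0; lra. Qed.

Lemma J_contraction_weyl q s :
  (M - 2) * J_contraction J (weyl_part S X) q s
  = (M - 4) * S q s + rho / (M - 1) * (q == s)%:R.
Proof.
have n1 : M - 1 != 0 by rewrite gt_eqF // m1_gt0.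
have n2 : M - 2 != 0 by rewrite gt_eqF // m2_gt0.
rewrite J_contraction_lin !J_contraction_kn ?trmx1 ?mulmx1 ?mul1mx //.
have -> : J_contraction J X q s = S q s.
  rewrite -contraction; apply: eq_bigr => p _; exact: XJ.
rewrite [1%:M _ _]mxE; set d := (_ == _)%:R.
by field; rewrite n1 n2.
Qed.

(** In the trace of [J_contraction_weyl] the coefficient of rho is (M - 4) + M / (M - 1) = (M - 2)^2
    / (M - 1), which does not vanish at M = 4. *)
Lemma scal_weyl : rho = (M - 1) / (M - 2) * \sum_q J_contraction J (weyl_part S X) q q.
Proof.
have n1 : M - 1 != 0 by rewrite gt_eqF // m1_gt0.
have n2 : M - 2 != 0 by rewrite gt_eqF // m2_gt0.
have e : (M - 2) * (\sum_q J_contraction J (weyl_part S X) q q) =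
    (M - 4) * rho + M * (rho / (M - 1)).
  rewrite mulr_sumr; under eq_bigr do rewrite J_contraction_weyl eqxx mulr1.
  by rewrite big_split /= -mulr_sumr sumr_const card_ord mulr_natl.
apply: (mulfI n2); rewrite mulrCA e; field.
by rewrite n1 n2.
Qed.

Section WeylBound.
Variable w : R.
Hypothesis Ww : forall p q r s, `|weyl_part S X p q r s| <= w.

Lemma J_contraction_le q s : `|J_contraction J (weyl_part S X) q s| <= M ^+ 3 * w.
Proof.
have -> : M ^+ 3 * w = M * (M * (M * w)) by ring.
apply: ler_norm_sum_const => p; apply: ler_norm_sum_const => r.
apply: ler_norm_sum_const => t; rewrite !normrM -[leRHS]mul1r ler_pM //.
by rewrite mulr_ile1 // skew_orthogonal_le1.
Qed.

Lemma scal_le : `|rho| <= (M - 1) / (M - 2) * (M ^+ 4 * w).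
Proof.
have c0 : 0 <= (M - 1) / (M - 2) by rewrite divr_ge0 // ltW ?m1_gt0 ?m2_gt0.
rewrite [X in `|X|]scal_weyl normrM (ger0_norm c0) ler_wpM2l //.
have -> : M ^+ 4 * w = M * (M ^+ 3 * w) by ring.
by apply: ler_norm_sum_const => q; exact: J_contraction_le.
Qed.

Lemma ric_le q s : (4 < m)%N -> `|S q s| <=
  ((M - 2) * (M ^+ 3 * w) + (M ^+ 4 * w) / (M - 2)) / (M - 4).
Proof.
move=> m4; have M4 : 0 < M - 4 by rewrite subr_gt0 ltr_nat.
rewrite ler_pdivlMr // mulrC -[X in X * _](gtr0_norm M4) -normrM.
have -> : (M - 4) * S q s = (M - 2) * J_contraction J (weyl_part S X) q s
    - rho / (M - 1) * (q == s)%:R by rewrite J_contraction_weyl addrK.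
apply: le_trans (ler_normB _ _) _; rewrite lerD //.
  by rewrite normrM (gtr0_norm m2_gt0) ler_wpM2l ?J_contraction_le // ltW // m2_gt0.
rewrite !normrM normfV (gtr0_norm m1_gt0).
apply: le_trans (_ : `|rho| / (M - 1) <= _).
  rewrite ler_piMr //; first by rewrite divr_ge0 // ltW ?m1_gt0.
  by case: eqP => _; rewrite ?normr1 // normr0.
rewrite ler_pdivrMr ?m1_gt0 //; apply: le_trans scal_le _.
by rewrite le_eqVlt; apply/orP; left; apply/eqP; ring.
Qed.

End WeylBound.

Lemma kn_le (Q : 'M[R]_m) (k : R) p q r s : (forall i j, `|Q i j| <= k) ->
  `|kulkarni_nomizu Q 1%:M p q r s| <= 4 * k.
Proof.
move=> Qk; have h i j i' j' : `|Q i j * (1%:M : 'M[R]_m) i' j'| <= k.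
  rewrite normrM -[leRHS]mulr1 ler_pM //.
  by rewrite mxE; case: eqP => _; rewrite ?normr1 // normr0.
rewrite /kulkarni_nomizu.
have -> : 4 * k = k + k + k + k by ring.
by rewrite !(le_trans (ler_normB _ _), lerD) // (le_trans (ler_normD _ _)) // lerD.
Qed.

(** As M >= 3, both denominators are at least 1. The scalar part is then at most 4 M k and the Ricci
    part at most 4 k. *)
Lemma weyl_kn_le (k : R) p q r s : (forall i j, `|S i j| <= k) ->
  `|weyl_part S X p q r s - X p q r s| <= 8 * M * k.
Proof.
move=> Sk; have k0 : 0 <= k by exact: le_trans (normr_ge0 _) (Sk p q).
have rhok : `|rho| <= M * k by exact: ler_norm_sum_const.
have M3 : 3 <= M by rewrite ler_nat.
have -> : weyl_part S X p q r s - X p q r s =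
    rho / (2 * (M - 1) * (M - 2)) * kulkarni_nomizu 1%:M 1%:M p q r s
    - (M - 2)^-1 * kulkarni_nomizu S 1%:M p q r s by rewrite /weyl_part; ring.
have k1 : `|kulkarni_nomizu (1%:M : 'M[R]_m) 1%:M p q r s| <= 4.
  rewrite -[leRHS]mulr1; apply: kn_le => i j.
  by rewrite mxE; case: eqP => _; rewrite ?normr1 // normr0.
have k2 := kn_le p q r s Sk.
apply: le_trans (ler_normB _ _) _.
have d1 : `|rho / (2 * (M - 1) * (M - 2))| <= M * k.
  rewrite normrM normfV -[leRHS]mulr1 ler_pM // invf_le1 ?ger0_norm; nra.
have d2 : `|(M - 2)^-1| <= 1 by rewrite normfV invf_le1 ?ger0_norm; lra.
rewrite !normrM.
have b1 : `|rho / (2 * (M - 1) * (M - 2))| * `|kulkarni_nomizu 1%:M 1%:M p q r s| <= M * k * 4.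
  by rewrite ler_pM.
have b2 : `|(M - 2)^-1| * `|kulkarni_nomizu S 1%:M p q r s| <= 1 * (4 * k) by rewrite ler_pM.
by rewrite normrM in b1; nra.
Qed.

Lemma ric_contraction_le (w : R) q s : (forall p q r s, `|X p q r s| <= w) ->
  `|S q s| <= M * w.
Proof. by move=> Xw; rewrite -contraction; apply: ler_norm_sum_const. Qed.

End FrameAlgebra.

(** * Traces and contractions of Rc in real dimension four *)

Lemma mxtrace_2x2 (R : comPzRingType) (X : 'M[R]_2) : \tr X = X 0 0 + X 1 1.
Proof. by rewrite /mxtrace 2!big_ord_recl big_ord0 addr0; congr (_ + X _ _); apply: val_inj. Qed.

Lemma mulmx_2x2 (R : comPzRingType) (X Y : 'M[R]_2) i j :
  (X *m Y) i j = X i 0 * Y 0 j + X i 1 * Y 1 j.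
Proof.
rewrite mxE 2!big_ord_recl big_ord0 addr0.
by congr (_ + X _ _ * Y _ _); apply: val_inj.
Qed.

(* As a complex 2x2 matrix of real trace, A satisfies Cayley-Hamilton, and its
   trace-free part has trace-free cube. *)
Lemma mxtrace_cube (R : realType) n (A : 'M[R]_(n + n)) : n = 2%N ->
    Jmx *m A = A *m Jmx -> \tr (Jmx *m A) = 0 ->
  \tr (A *m A *m A) = 3 / 4 * (\tr A * \tr (A *m A)) - 8^-1 * \tr A ^+ 3.
Proof.
move=> n2; subst n; rewrite -[A]submxK; set P := ulsubmx A; set Q := ursubmx A.
rewrite !mulmx_block !mul0mx !mul1mx !mulmx0 !mulmx1 !mulNmx !mul1mx !mulmxN !mulmx1.
rewrite !addr0 !add0r => /eq_block_mx[e1 e2 _ _].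
(* A is the real form of the complex matrix P + iQ, and the hypothesis on its trace says tr Q =
   0. *)
have -> : dlsubmx A = - Q by rewrite e1.
have -> : drsubmx A = P by rewrite e2.
rewrite !mxtrace_block !mxtraceD !mxtrace_2x2 => trQ.
have q11 : Q 1 1 = - Q 0 0.
  by move: trQ; rewrite !mxE; lra.
have aE (X Y : 'M[R]_2) i j : (X + Y) i j = X i j + Y i j by rewrite mxE.
have nE (X : 'M[R]_2) i j : (- X) i j = - X i j by rewrite mxE.
rewrite !(mulmx_2x2, aE, nE) q11; clearbody P Q.
by field.
Qed.

Lemma frame_mx_comp (R : realType) m (C C' h : 'M[R]_m) :
  frame_mx C (frame_mx C' h) = frame_mx (C *m C') h.
Proof. by rewrite /frame_mx trmx_mul !mulmxA. Qed.

Lemma kn_contraction (R : realType) m (Q S : 'M[R]_m) : Q^T = Q -> S^T = S ->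
  \sum_p \sum_q \sum_r \sum_s kulkarni_nomizu Q 1%:M p q r s * (S p r * S q s) =
  2 * \tr (Q *m S) * \tr S - 2 * \tr (Q *m S *m S).
Proof.
move=> QT ST.
have SE p r : S p r = S r p by rewrite -[in LHS]ST mxE.
have delta (F : 'I_m -> R) k : \sum_t F t * (1%:M : 'M[R]_m) k t = F k.
  rewrite (bigD1 k) //= big1 ?addr0 => [|i ik]; first by rewrite mxE eqxx mulr1.
  by rewrite mxE eq_sym (negPf ik) mulr0.
have e1 : \sum_p \sum_q \sum_r \sum_s Q p r * (1%:M : 'M[R]_m) q s * (S p r * S q s) =
    \tr (Q *m S) * \tr S.
  rewrite mxtrace_mulE mulr_suml; apply: eq_bigr => p _; rewrite exchange_big mulr_suml.
  apply: eq_bigr => r _; rewrite mulr_sumr; apply: eq_bigr => q _.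
  rewrite (SE r p) -(delta (fun s => Q p r * S p r * S q s)).
  by apply: eq_bigr => s _; ring.
have e2 : \sum_p \sum_q \sum_r \sum_s Q q s * (1%:M : 'M[R]_m) p r * (S p r * S q s) =
    \tr (Q *m S) * \tr S.
  rewrite exchange_big -e1; apply: eq_bigr => q _; apply: eq_bigr => p _.
  by rewrite exchange_big; apply: eq_bigr => s _; apply: eq_bigr => r _; ring.
have e3 : \sum_p \sum_q \sum_r \sum_s Q p s * (1%:M : 'M[R]_m) q r * (S p r * S q s) =
    \tr (Q *m S *m S).
  apply: eq_bigr => p _; rewrite mxE; apply: eq_bigr => q _.
  rewrite exchange_big mxE mulr_suml; apply: eq_bigr => s _.
  rewrite -(delta (fun r => Q p s * S s q * S r p)); apply: eq_bigr => r _.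
  by rewrite (SE s q) (SE r p); ring.
have e4 : \sum_p \sum_q \sum_r \sum_s Q q r * (1%:M : 'M[R]_m) p s * (S p r * S q s) =
    \tr (Q *m S *m S).
  rewrite exchange_big; apply: eq_bigr => q _; rewrite mxE; apply: eq_bigr => p _.
  rewrite mxE mulr_suml; apply: eq_bigr => r _.
  rewrite -(delta (fun s => Q q r * S r p * S s q)); apply: eq_bigr => s _.
  by rewrite (SE r p) (SE s q); ring.
have -> : 2 * \tr (Q *m S) * \tr S - 2 * \tr (Q *m S *m S) =
  \tr (Q *m S) * \tr S + \tr (Q *m S) * \tr S - \tr (Q *m S *m S) - \tr (Q *m S *m S) by ring.
rewrite -{1}e1 -{1}e2 -{1}e3 -e4 !sum4E -big_split -!sumrB; apply: eq_bigr => x _ /=.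
by rewrite /kulkarni_nomizu; ring.
Qed.

(** The product S p r * S q s is at most half the sum of the squares; m^2 counts the two indices
    that each square leaves free. *)
Lemma tensor_contraction_le (R : realType) m (W : @tensor4 R m) (S : 'M[R]_m) w :
    0 <= w -> S^T = S -> (forall p q r s, `|W p q r s| <= w) ->
  `|\sum_p \sum_q \sum_r \sum_s W p q r s * (S p r * S q s)|
  <= w * (m ^ 2)%:R * \tr (S *m S).
Proof.
move=> w0 ST Ww; rewrite sum4E; apply: le_trans (ler_norm_sum _ _ _) _.
have -> : w * (m ^ 2)%:R * \tr (S *m S) = \sum_(x : 'I_m * 'I_m * ('I_m * 'I_m))
    w * ((S x.1.1 x.2.1 ^+ 2 + S x.1.2 x.2.2 ^+ 2) / 2).
  have SS : \tr (S *m S) = \sum_p \sum_r S p r ^+ 2.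
    rewrite mxtrace_mulE; apply: eq_bigr => p _; apply: eq_bigr => r _.
    by rewrite expr2 -[in X in _ * X]ST mxE.
  have e : \sum_(p < m) \sum_(q < m) \sum_(r < m) \sum_(s < m) S p r ^+ 2 = (m ^ 2)%:R * \tr (S *m S).
    rewrite SS mulr_sumr; apply: eq_bigr => p _.
    rewrite exchange_big mulr_sumr; apply: eq_bigr => r _.
    by rewrite !sumr_const card_ord -mulrnA mulr_natl.
  have e' : \sum_(p < m) \sum_(q < m) \sum_(r < m) \sum_(s < m) S q s ^+ 2 = (m ^ 2)%:R * \tr (S *m S).
    rewrite -e exchange_big; apply: eq_bigr => q _; apply: eq_bigr => p _.
    by rewrite exchange_big.
  rewrite -(sum4E (fun p q r s => w * ((S p r ^+ 2 + S q s ^+ 2) / 2))).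
  transitivity (w / 2 * ((m ^ 2)%:R * \tr (S *m S) + (m ^ 2)%:R * \tr (S *m S))).
    by field.
  rewrite -{1}e -e' !sum4E -big_split mulr_sumr; apply: eq_bigr => x _ /=.
  by ring.
apply: ler_sum => x _; rewrite !normrM ler_pM ?mulr_ge0 //.
have := sqr_ge0 (`|S x.1.1 x.2.1| - `|S x.1.2 x.2.2|).
rewrite -(real_normK (num_real (S x.1.1 x.2.1))) -(real_normK (num_real (S x.1.2 x.2.2))).
by move: `|S x.1.1 x.2.1| `|S x.1.2 x.2.2| => u1 u2 ?; lra.
Qed.

(** * Curvature components in an orthonormal frame *)

Section LocalFrame.
Context {R : realType} {m : nat}.
Variables (g : 'rV[R]_m -> 'M[R]_m) (x : 'rV[R]_m) (C : 'M[R]_m).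
Hypothesis CgC : C *m g x *m C^T = 1%:M.
Local Notation G := (g x).
Local Notation S := (frame_mx C (Rc g x)).
Local Notation X := (frame_tensor C (Rm g x)).
Local Notation Om := (curvature_op g x).
Implicit Types (a b c d p q r s : 'I_m).

Lemma frame_unit : C \in unitmx.
Proof. by have := mulmx1_unit CgC; rewrite unitmx_mul => -[/andP[]]. Qed.

Lemma metricT : G^T = G.
Proof.
have Cu := frame_unit; have CTu : C^T \in unitmx by rewrite unitmx_tr.
apply: (can_inj (mulKmx Cu)); apply: (can_inj (mulmxK CTu)).
by rewrite CgC -[RHS]trmx1 -CgC !trmx_mul trmxK mulmxA.
Qed.

Lemma frame_inv : C *m (G *m C^T) = 1%:M. Proof. by rewrite mulmxA. Qed.

Lemma frame_inv' : G *m C^T *m C = 1%:M. Proof. exact: mulmx1C frame_inv. Qed.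

Lemma invmx_frame : invmx G = C^T *m C.
Proof.
have GG : G *m (C^T *m C) = 1%:M by rewrite mulmxA frame_inv'.
by rewrite -[LHS]mulmx1 -GG mulKmx //; exact: (mulmx1_unit GG).1.
Qed.

Lemma invmx_frameC a c : invmx G a c = invmx G c a.
Proof. by rewrite invmx_frame -{1}[C^T *m C]trmxK mxE trmx_mul trmxK. Qed.

Lemma frame_det : \det G != 0.
Proof.
have := congr1 (fun X => \det X) frame_inv; rewrite !det_mulmx det1 => d.
by apply/eqP => d0; move: d; rewrite d0 mul0r mulr0 => /eqP; rewrite eq_sym oner_eq0.
Qed.

Lemma frame_metric : frame_mx C G = 1%:M. Proof. exact: CgC. Qed.

Lemma mxtrace_frame (h : 'M[R]_m) : \tr (frame_mx C h) = \tr (h *m invmx G).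
Proof. by rewrite invmx_frame /frame_mx -mulmxA mxtrace_mulC mulmxA. Qed.

Lemma frame_mxM (h k : 'M[R]_m) :
  frame_mx C h *m frame_mx C k = frame_mx C (h *m invmx G *m k).
Proof. by rewrite /frame_mx invmx_frame !mulmxA. Qed.

Lemma frame_contraction q s : \sum_p X p q p s = S q s.
Proof.
have RcE b d : \sum_a \sum_c (C^T *m C) a c * Rm g x a b c d = Rc g x b d.
  rewrite [RHS]mxE; apply: eq_bigr => a _; rewrite -invmx_frame.
  transitivity (\sum_e Om a b d e * (G *m invmx G) e a).
    transitivity (\sum_c \sum_e invmx G a c * (Om a b d e * G e c)).
      by apply: eq_bigr => c _; rewrite mulr_sumr.
    rewrite exchange_big; apply: eq_bigr => e _.
    rewrite mx_mulE mulr_sumr; apply: eq_bigr => c _.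
    by rewrite (invmx_frameC a c) mulrC mulrA.
  rewrite invmx_frame mulmxA frame_inv' (bigD1 a) //= big1 ?addr0 => [|e ea].
    by rewrite [1%:M _ _]mxE eqxx mulr1.
  by rewrite [1%:M _ _]mxE (negPf ea) mulr0.
rewrite frame_mxE.
transitivity (\sum_b \sum_d \sum_a \sum_c C q b * C s d * ((C^T *m C) a c * Rm g x a b c d)).
  transitivity (\sum_a \sum_b \sum_c \sum_d \sum_p
      C p a * C q b * C p c * C s d * Rm g x a b c d).
    rewrite exchange_big; apply: eq_bigr => a _; rewrite exchange_big; apply: eq_bigr => b _.
    by rewrite exchange_big; apply: eq_bigr => c _; rewrite exchange_big.
  transitivity (\sum_a \sum_c \sum_b \sum_d C q b * C s d * ((C^T *m C) a c * Rm g x a b c d)).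
    apply: eq_bigr => a _; rewrite exchange_big; apply: eq_bigr => c _.
    apply: eq_bigr => b _; apply: eq_bigr => d _.
    rewrite [(C^T *m C) a c]mxE mulr_suml mulr_sumr; apply: eq_bigr => p _.
    by rewrite [C^T a p]mxE; ring.
  by rewrite sum4_swap.
apply: eq_bigr => b _; apply: eq_bigr => d _; rewrite -RcE mulr_sumr.
by apply: eq_bigr => a _; rewrite mulr_sumr.
Qed.

Lemma scalar_curvatureE : scalar_curvature g x = \tr S.
Proof.
rewrite mxtrace_frame mxtrace_mulE.
by apply: eq_bigr => a _; apply: eq_bigr => b _; rewrite mulrC invmx_frameC.
Qed.

Lemma frame_weyl p q r s : frame_tensor C (weyl g x) p q r s = weyl_part S X p q r s.
Proof.
rewrite /weyl_part -frame_metric -!frame_kulkarni_nomizu -scalar_curvatureE.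
rewrite -mulNr -!frame_tensorZ -!frame_tensorD; congr (frame_tensor C _ p q r s).
by apply/funext => a; apply/funext => b; apply/funext => c; apply/funext => d;
  rewrite /weyl mulNr.
Qed.

Lemma frame_Rm_ric_ric :
  \sum_a \sum_b \sum_c \sum_d Rm g x a b c d *
    ((invmx G *m (Rc g x *m invmx G)) a c * (invmx G *m (Rc g x *m invmx G)) b d)
  = \sum_p \sum_q \sum_r \sum_s X p q r s * (S p r * S q s).
Proof.
have PE a c : (invmx G *m (Rc g x *m invmx G)) a c = \sum_p \sum_r C p a * C r c * S p r.
  have -> : invmx G *m (Rc g x *m invmx G) = frame_mx C^T S.
    by rewrite /frame_mx invmx_frame trmxK !mulmxA.
  by rewrite frame_mxE; apply: eq_bigr => p _; apply: eq_bigr => r _; rewrite !mxE.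
transitivity (\sum_(y : 'I_m * 'I_m * ('I_m * 'I_m)) \sum_(z : 'I_m * 'I_m * ('I_m * 'I_m))
  C z.1.1 y.1.1 * C z.1.2 y.1.2 * C z.2.1 y.2.1 * C z.2.2 y.2.2
  * Rm g x y.1.1 y.1.2 y.2.1 y.2.2 * (S z.1.1 z.2.1 * S z.1.2 z.2.2)).
  rewrite sum4E; apply: eq_bigr => y _; rewrite !PE.
  rewrite -(sum4E (fun p q r s => C p y.1.1 * C q y.1.2 * C r y.2.1 * C s y.2.2
    * Rm g x y.1.1 y.1.2 y.2.1 y.2.2 * (S p r * S q s))).
  move: (Rm g x _ _ _ _) => ry; rewrite mulr_suml mulr_sumr; apply: eq_bigr => p _.
  rewrite [RHS]exchange_big mulr_suml mulr_sumr; apply: eq_bigr => r _ /=.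
  rewrite mulr_sumr mulr_sumr; apply: eq_bigr => q _; rewrite !mulr_sumr.
  by apply: eq_bigr => s _; ring.
rewrite exchange_big sum4E; apply: eq_bigr => z _.
rewrite /frame_tensor sum4E mulr_suml; apply: eq_bigr => y _.
by [].
Qed.

Lemma norm_frame_le p r : (Rc g x)^T = Rc g x -> S p r ^+ 2 <= \tr (S *m S).
Proof.
move=> RcT; have ST : S^T = S by rewrite /frame_mx !trmx_mul trmxK RcT mulmxA.
rewrite mxtrace_mulE (bigD1 p) //= (bigD1 r) //=.
have -> : S r p = S p r by rewrite -[in LHS]ST mxE.
rewrite -addrA lerDl addr_ge0 //; first apply: sumr_ge0 => k _.
  by rewrite (_ : S k p = S p k) -?expr2 ?sqr_ge0 // -[in LHS]ST mxE.
apply: sumr_ge0 => k _; apply: sumr_ge0 => l _.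
by rewrite (_ : S l k = S k l) -?expr2 ?sqr_ge0 // -[in LHS]ST mxE.
Qed.

Lemma Rm_norm_le w rc : (2 < m)%N -> 0 <= w ->
    (forall p q r s, `|frame_tensor C (weyl g x) p q r s| <= w) ->
    (forall i j, `|S i j| <= rc) ->
  tensor4_norm G (Rm g x) <= Num.sqrt ((m ^ 4)%:R * (w + 8 * m%:R * rc) ^+ 2).
Proof.
move=> m3 w0 Ww Src; apply: (tensor4_norm_le invmx_frame) => p q r s.
have := weyl_kn_le X m3 p q r s Src; have := Ww p q r s; rewrite frame_weyl.
move: (weyl_part _ _ _ _ _ _) (X _ _ _ _) => wp xp.
rewrite !ler_norml; lra.
Qed.

Lemma weyl_norm_le w : (2 < m)%N -> tensor4_norm G (Rm g x) <= w ->
  tensor4_norm G (weyl g x) <= Num.sqrt ((m ^ 4)%:R * (w + 8 * m%:R * (m%:R * w)) ^+ 2).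
Proof.
move=> m3 Rmw; apply: (tensor4_norm_le invmx_frame) => p q r s.
have Xw p' q' r' s' : `|X p' q' r' s'| <= w.
  exact: le_trans (frame_tensor_le _ _ _ _ _ invmx_frame) Rmw.
have Sw i j : `|S i j| <= m%:R * w by apply: ric_contraction_le Xw; exact: frame_contraction.
have := weyl_kn_le X m3 p q r s Sw; have := Xw p q r s; rewrite frame_weyl.
move: (weyl_part _ _ _ _ _ _) (X _ _ _ _) (8 * m%:R * (_ * w)) => wp xp k.
rewrite !ler_norml; lra.
Qed.

End LocalFrame.

Section KahlerFrame.
Context {R : realType} {n : nat}.
Local Notation m := (n + n)%N.
Variables (g : 'rV[R]_m -> 'M[R]_m) (x : 'rV[R]_m) (C : 'M[R]_m).
Hypothesis CgC : C *m g x *m C^T = 1%:M.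
Local Notation G := (g x).
Local Notation S := (frame_mx C (Rc g x)).
Local Notation X := (frame_tensor C (Rm g x)).
Local Notation Om := (curvature_op g x).
Implicit Types (a b c d p q r s : 'I_m).
Hypothesis m3 : (2 < m)%N.
Hypothesis GJ : Jmx *m G = G *m Jmx.
Hypothesis RcT : (Rc g x)^T = Rc g x.
Hypothesis RcJ : Jmx *m Rc g x = Rc g x *m Jmx.
Hypothesis OmJ : forall a b, Jmx *m Om a b = Om a b *m Jmx.

(** J conjugated into the frame: G C^T is the inverse of C, by [frame_inv]. *)
Definition frame_J : 'M[R]_m := C *m Jmx *m (G *m C^T).
Local Notation J := frame_J.

Lemma frame_Jmul (h : 'M[R]_m) : J *m (C *m h) = C *m (Jmx *m h).
Proof.
by rewrite /frame_J -!mulmxA (mulmxA C^T) (mulmxA G) (mulmxA G) (frame_inv' CgC) mul1mx.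
Qed.

Lemma frame_inv2 : C^T *m C *m G = 1%:M.
Proof.
by apply: mulmx1C; rewrite mulmxA; exact: frame_inv' CgC.
Qed.

Lemma frame_JJ : J *m J = - 1%:M.
Proof.
have e : J = C *m (Jmx *m (G *m C^T)) by rewrite /frame_J -mulmxA.
by rewrite {2}e frame_Jmul (mulmxA Jmx) JmxJ mulNmx mul1mx mulmxN mulmxA CgC.
Qed.

Lemma frame_JT : J^T = - J.
Proof.
rewrite /frame_J !trmx_mul trmxK JmxT (metricT CgC) -!mulmxA !mulNmx !mulmxN.
by rewrite (mulmxA G) -GJ !mulmxA.
Qed.

Lemma frame_SJ : J *m S = S *m J.
Proof.
have e : S = C *m (Rc g x *m C^T) by rewrite /frame_mx mulmxA.
rewrite {1}e frame_Jmul (mulmxA Jmx) RcJ /frame_mx /frame_J -!mulmxA; congr (_ *m (_ *m _)).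
by rewrite (mulmxA Jmx) GJ (mulmxA C^T) -(mulmxA G) (mulmxA _ G) frame_inv2 mul1mx.
Qed.

(** The curvature endomorphisms and the metric commute with J, so Rm is J-invariant in its last two
    slots. *)
Lemma frame_XJ p q r s : \sum_r' \sum_s' J r r' * J s s' * X p q r' s' = X p q r s.
Proof.
pose N a b : 'M[R]_m := (Om a b *m G)^T.
have XE r' s' : X p q r' s' = \sum_a \sum_b C p a * C q b * frame_mx C (N a b) r' s'.
  apply: eq_bigr => a _; apply: eq_bigr => b _.
  rewrite frame_mxE mulr_sumr; apply: eq_bigr => c _.
  rewrite mulr_sumr; apply: eq_bigr => d _.
  by rewrite [N a b c d]mxE mx_mulE /Rm; ring.
have NJ a b : frame_mx J (frame_mx C (N a b)) = frame_mx C (N a b).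
  have JC : J *m C = C *m Jmx by have := frame_Jmul 1%:M; rewrite !mulmx1.
  rewrite frame_mx_comp JC -frame_mx_comp; congr (frame_mx C _).
  rewrite /frame_mx /N -{1}[Jmx]trmxK -!trmx_mul; congr trmx.
  rewrite JmxT mulmxN -(mulmxA (Om a b)) -GJ mulmxN mulmxA -OmJ !mulmxA.
  by rewrite JmxJ !mulNmx opprK mul1mx.
transitivity (\sum_a \sum_b C p a * C q b * frame_mx J (frame_mx C (N a b)) r s).
  transitivity (\sum_r' \sum_s' \sum_a \sum_b C p a * C q b *
      (J r r' * J s s' * frame_mx C (N a b) r' s')).
    apply: eq_bigr => r' _; apply: eq_bigr => s' _; rewrite XE mulr_sumr.
    apply: eq_bigr => a _; rewrite mulr_sumr; apply: eq_bigr => b _; ring.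
  rewrite sum4_swap; apply: eq_bigr => a _; apply: eq_bigr => b _.
  rewrite frame_mxE mulr_sumr; apply: eq_bigr => r' _.
  by rewrite mulr_sumr.
by rewrite XE; apply: eq_bigr => a _; apply: eq_bigr => b _; rewrite NJ.
Qed.

Lemma frame_ST : S^T = S.
Proof. by rewrite /frame_mx !trmx_mul trmxK RcT mulmxA. Qed.

(** The traces are those of Rc g^-1, which commutes with the standard [Jmx], so that the block form
    used by [mxtrace_cube] is available. *)
Lemma frame_cube : n = 2%N ->
  \tr (S *m S *m S) = 3 / 4 * (\tr S * \tr (S *m S)) - 8^-1 * \tr S ^+ 3.
Proof.
move=> n2; pose A := Rc g x *m invmx G.
have Gu : G \in unitmx by apply: (mulmx1_unit (B := C^T *m C) _).1; rewrite mulmxA (frame_inv' CgC).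
have giJ : Jmx *m invmx G = invmx G *m Jmx.
  apply: (can_inj (mulmxK Gu)); apply: (can_inj (mulKmx Gu)).
  by rewrite -[in LHS]mulmxA mulVmx // mulmx1 -[in RHS]mulmxA GJ !mulmxA mulmxV // mul1mx.
have AJ : Jmx *m A = A *m Jmx by rewrite /A mulmxA RcJ -mulmxA giJ mulmxA.
have trJA : \tr (Jmx *m A) = 0.
  have e : \tr (Jmx *m A) = \tr (J *m S).
    have -> : S = C *m (Rc g x *m C^T) by rewrite /frame_mx mulmxA.
    by rewrite frame_Jmul /A mulmxA -(mxtrace_frame CgC) /frame_mx !mulmxA.
  have : \tr (J *m S) = - \tr (J *m S).
    rewrite -[LHS]mxtrace_tr trmx_mul frame_JT frame_ST.
    by rewrite mulmxN raddfN /= mxtrace_mulC.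
  by rewrite -e; move: (\tr _) => k; lra.
rewrite !(frame_mxM CgC) !(mxtrace_frame CgC).
have := mxtrace_cube n2 AJ trJA; rewrite /A !mulmxA; exact.
Qed.

Section WeylBound.
Variable w : R.
Hypothesis Ww : forall p q r s, `|frame_tensor C (weyl g x) p q r s| <= w.

Let Ww' p q r s : `|weyl_part S X p q r s| <= w.
Proof. by rewrite -frame_weyl. Qed.

Lemma frame_scal_le : `|\tr S| <= (m%:R - 1) / (m%:R - 2) * (m%:R ^+ 4 * w).
Proof.
by apply: (@scal_le R m S J X) => //; [exact: frame_contraction | exact: frame_ST
  | exact: frame_JJ | exact: frame_JT | exact: frame_SJ | exact: frame_XJ].
Qed.

Lemma frame_ric_le q s : (4 < m)%N -> `|S q s| <=
  ((m%:R - 2) * (m%:R ^+ 3 * w) + (m%:R ^+ 4 * w) / (m%:R - 2)) / (m%:R - 4).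
Proof.
by apply: (@ric_le R m S J X) => //; [exact: frame_contraction | exact: frame_ST
  | exact: frame_JJ | exact: frame_JT | exact: frame_SJ | exact: frame_XJ].
Qed.

Lemma frame_Rm_ric_ric_le : 0 <= w -> n = 2%N ->
  \sum_p \sum_q \sum_r \sum_s X p q r s * (S p r * S q s) <=
  (16 * w + 5 / 12 * `|\tr S|) * \tr (S *m S) + 24^-1 * `|\tr S| ^+ 3.
Proof.
move=> w0 n2; have tr3 := frame_cube n2; have m4 : m%:R = 4 :> R by rewrite n2.
have XW p q r s : X p q r s = weyl_part S X p q r s
    - \tr S / 12 * kulkarni_nomizu 1%:M 1%:M p q r s
    + 2^-1 * kulkarni_nomizu S 1%:M p q r s.
  by rewrite /weyl_part m4; field.
have -> : \sum_p \sum_q \sum_r \sum_s X p q r s * (S p r * S q s) =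
    \sum_p \sum_q \sum_r \sum_s weyl_part S X p q r s * (S p r * S q s)
    - \tr S / 12 * (\sum_p \sum_q \sum_r \sum_s
        kulkarni_nomizu 1%:M 1%:M p q r s * (S p r * S q s))
    + 2^-1 * (\sum_p \sum_q \sum_r \sum_s
        kulkarni_nomizu S 1%:M p q r s * (S p r * S q s)).
  rewrite !sum4E !mulr_sumr -sumrB -big_split; apply: eq_bigr => y _ /=.
  by rewrite XW; ring.
have ST := frame_ST; rewrite !kn_contraction ?trmx1 // !mul1mx tr3.
have := tensor_contraction_le w0 ST Ww'.
have -> : (m ^ 2)%:R = 16 :> R by rewrite natrX m4; ring.
have N0 : 0 <= \tr (S *m S).
  rewrite mxtrace_mulE; apply: sumr_ge0 => p _; apply: sumr_ge0 => q _.
  by rewrite (_ : S q p = S p q) -?expr2 ?sqr_ge0 // -[in LHS]ST mxE.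
set WS := \sum_p _; move: (\tr (S *m S)) N0 (\tr S) => N N0 r.
have := ler_norm WS; move: `|WS| => aw h1 h2.
have h3 : r * N <= `|r| * N by rewrite ler_wpM2r // ler_norm.
have h4 : - (r ^+ 3) <= `|r| ^+ 3 by rewrite -normrX -normrN ler_norm.
(* At m = 4, Rm = W - R/12 g (.) g + 1/2 Rc (.) g. The coefficient of r N is 1/6 + 1/4 = 5/12, that
   of r^3 is -1/6 + 1/8 = -1/24. *)
have -> : WS - r / 12 * (2 * r * r - 2 * N) +
   2^-1 * (2 * N * r - 2 * (3 / 4 * (r * N) - 8^-1 * r ^+ 3)) =
   WS + 5 / 12 * (r * N) - 24^-1 * r ^+ 3 by field.
have -> : (16 * w + 5 / 12 * `|r|) * N = w * 16 * N + 5 / 12 * (`|r| * N) by ring.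
lra.
Qed.

End WeylBound.
End KahlerFrame.

(** * The flow in charts *)

Section TimeDerivative.
Context {R : realType}.
Implicit Types (f : R -> R) (t l c : R).

Definition has_time_derivative f t l := time_quotient f t @ time_nbhs t --> l.

Lemma time_nbhs_filter t : Filter (time_nbhs t).
Proof. exact: within_filter. Qed.
#[local] Existing Instance time_nbhs_filter.

Lemma time_nbhs_proper t : 0 <= t -> ProperFilter (time_nbhs t).
Proof.
move=> t0; apply: Build_ProperFilter.
rewrite /time_nbhs /within /= => /nbhs_ballP[e /= e0 He].
apply: (He (e / 2)).
- by rewrite -ball_normE /= sub0r normrN gtr0_norm ?divr_gt0 // ltr_pdivrMr // ltr_pMr // ltr1n.
- by rewrite gt_eqF // divr_gt0.
by rewrite addr_ge0 // divr_ge0 // ltW.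
Qed.

Lemma time_nbhs_dnbhs t : 0 < t -> time_nbhs t = 0^'.
Proof.
move=> t0; apply/seteqP; split => P.
  rewrite /time_nbhs /within /= => /nbhs_ballP[e /= e0 He]; apply/nbhs_ballP.
  exists (Num.min e t) => /=; first by rewrite lt_min e0.
  move=> h; rewrite -ball_normE /= sub0r normrN lt_min => /andP[he ht] h0.
  apply: He => //; first by rewrite -ball_normE /= sub0r normrN.
  by move: ht; rewrite ltr_norml; lra.
by apply: filterS => h Ph _; exact: Ph.
Qed.

Lemma time_deriveE f t l : 0 <= t -> has_time_derivative f t l -> time_derive f t = l.
Proof.
by move=> /time_nbhs_proper tp fl; apply: cvg_lim.
Qed.

Lemma eq_has_time_derivative f f' t l : 0 <= t -> (forall s, 0 <= s -> f s = f' s) ->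
  has_time_derivative f t l -> has_time_derivative f' t l.
Proof.
move=> t0 ff' fl; apply: cvg_trans fl; apply: near_eq_cvg.
rewrite /time_nbhs near_withinE; apply: nearW => h th.
by rewrite /time_quotient !ff'.
Qed.

Lemma has_time_derivativeD f f' t l l' : has_time_derivative f t l ->
  has_time_derivative f' t l' -> has_time_derivative (fun s => f s + f' s) t (l + l').
Proof.
move=> fl fl'; apply: cvg_trans (cvgD fl fl').
by apply: near_eq_cvg; apply: nearW => h; rewrite ?fctE /time_quotient; ring.
Qed.

Lemma has_time_derivativeZ f c t l : has_time_derivative f t l ->
  has_time_derivative (fun s => c * f s) t (c * l).
Proof.
move=> fl; apply: cvg_trans (@cvgMl_tmp _ _ _ _ _ c _ fl).
by apply: near_eq_cvg; apply: nearW => h; rewrite ?fctE /time_quotient; ring.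
Qed.

Lemma has_time_derivative_sum (I : Type) (r : seq I) (f : I -> R -> R) (l : I -> R) t :
    (forall i, has_time_derivative (f i) t (l i)) ->
  has_time_derivative (fun s => \sum_(i <- r) f i s) t (\sum_(i <- r) l i).
Proof.
move=> fl; elim: r => [|i r IHr].
  have -> : (fun s => \sum_(i <- [::]) f i s) = cst 0.
    by apply/funext => s; rewrite big_nil.
  rewrite big_nil /has_time_derivative (_ : time_quotient _ _ = cst 0); first exact: cvg_cst.
  by apply/funext => h; rewrite /time_quotient subrr mulr0.
have -> : (fun s => \sum_(j <- i :: r) f j s) = (fun s => f i s + \sum_(j <- r) f j s).
  by apply/funext => s; rewrite big_cons.
by rewrite big_cons; exact: has_time_derivativeD.
Qed.

Definition time_derive_mx m (h : R -> 'M[R]_m) t : 'M[R]_m :=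
  \matrix_(a, b) time_derive (fun s => h s a b) t.

(** P and Q are constant in time, like J or the Jacobian of a transition map. The relation is asked
    for s >= 0 only, where the metric is known to be a tensor. *)
Lemma time_derive_mx_mul m (h k : R -> 'M[R]_m) (P Q : 'M[R]_m) t : 0 <= t ->
    (forall a b, time_derivable (fun s => k s a b) t) ->
    (forall s, 0 <= s -> h s = P *m k s *m Q) ->
  time_derive_mx h t = P *m time_derive_mx k t *m Q.
Proof.
move=> t0 dk hk; apply/matrixP=> a b; rewrite mxE; apply: time_deriveE => //.
have e (X : 'M[R]_m) : (P *m X *m Q) a b = \sum_j \sum_i P a i * Q j b * X i j.
  rewrite mxE; apply: eq_bigr => j _; rewrite mxE mulr_suml.
  by apply: eq_bigr => i _; ring.
rewrite e; apply: (@eq_has_time_derivative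
  (fun s => \sum_j \sum_i P a i * Q j b * k s i j)) => //.
  by move=> s s0; rewrite hk // e.
apply: has_time_derivative_sum => j; apply: has_time_derivative_sum => i.
by apply: has_time_derivativeZ; rewrite mxE; exact: dk.
Qed.

End TimeDerivative.

Section HermitianComponents.
Context {R : realType} {n : nat}.
Implicit Types X : 'M[R]_(n + n).

Lemma hermitian_compE X j k : hermitian_comp X j k =
  (((X (lshift n j) (lshift n k) + X (rshift n j) (rshift n k)) / 4)
   +i* ((X (lshift n j) (rshift n k) - X (rshift n j) (lshift n k)) / 4))%C.
Proof.
rewrite /hermitian_comp /d_dz /d_dzbar; set Y := map_mx _ X.
have e (p q : 'I_(n + n)) :
    ((delta_mx 0 p : 'rV[R[i]]_(n + n)) *m Y *m (delta_mx 0 q : 'rV[R[i]]_(n + n))^T) 0 0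
    = ((X p q)%:C)%C.
  by rewrite trmx_delta -rowE -colE !mxE.
have tZ (c : R[i]) (Z : 'rV[R[i]]_(n + n)) : (c *: Z)^T = c *: Z^T.
  by apply/matrixP=> p q; rewrite !mxE.
rewrite -scalemxAl -scalemxAl tZ -scalemxAr scalerA linearD /= tZ.
rewrite !mulmxDr !mulmxBl -!scalemxAr -!scalemxAl.
have comb (k1 k2 a b c d : R[i]) (A B C D : 'M[R[i]]_1) :
    A 0 0 = a -> B 0 0 = b -> C 0 0 = c -> D 0 0 = d ->
    (k1 *: (A - k2 *: B + (k2 *: C - k2 *: (k2 *: D)))) 0 0 =
    k1 * (a - k2 * b + (k2 * c - k2 * (k2 * d))) by rewrite !mxE => -> -> -> ->.
have -> : (2^-1 : R[i]) = ((2^-1 : R)%:C)%C by rewrite fmorphV rmorph_nat.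
apply: etrans (comb _ _ _ _ _ _ _ _ _ _ (e _ _) (e _ _) (e _ _) (e _ _)) _.
move: (X _ _) (X _ _) (X _ _) (X _ _) => a b c d.
by simpc; congr (_ +i* _)%C; field.
Qed.

Lemma commJ_block X : Jmx *m X = X *m Jmx ->
  forall j k, X (rshift n j) (rshift n k) = X (lshift n j) (lshift n k) /\
     X (rshift n j) (lshift n k) = - X (lshift n j) (rshift n k).
Proof.
rewrite -[X]submxK !mulmx_block !mul0mx !mul1mx !mulmx0 !mulmx1 !mulNmx !mul1mx !mulmxN !mulmx1.
rewrite !addr0 !add0r => /eq_block_mx[e1 e2 _ _] j k.
by rewrite block_mxEdr block_mxEul block_mxEdl block_mxEur e1 e2; split=> //; rewrite [LHS]mxE.
Qed.

(** Twice the real and imaginary parts of its Hermitian components are the two independent blocks of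
    a matrix commuting with J; this makes the flow equation a real matrix equation. *)
Lemma hermitian_comp_inj X Y Z : Jmx *m X = X *m Jmx -> Jmx *m Y = Y *m Jmx ->
    Jmx *m Z = Z *m Jmx ->
    (forall j k, hermitian_comp X j k = hermitian_comp Y j k - hermitian_comp Z j k) ->
  X = Y - Z.
Proof.
move=> XJ YJ ZJ e; apply/matrixP=> p q.
have ee j k : X (lshift n j) (lshift n k) = Y (lshift n j) (lshift n k) - Z (lshift n j) (lshift n k)
  /\ X (lshift n j) (rshift n k) = Y (lshift n j) (rshift n k) - Z (lshift n j) (rshift n k).
  have := e j k; rewrite !hermitian_compE.
  have [-> ->] := commJ_block XJ j k; have [-> ->] := commJ_block YJ j k.
  have [-> ->] := commJ_block ZJ j k.
  by move/eqP; rewrite eq_complex /= => /andP[/eqP e1 /eqP e2]; split; lra.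
rewrite [RHS]mxE [X in _ + X]mxE.
case: (split_ordP p) => j ->; case: (split_ordP q) => k ->.
- by have [->] := ee j k.
- by have [_ ->] := ee j k.
- have [_ ->] := commJ_block XJ j k; have [_ ->] := commJ_block YJ j k.
  have [_ ->] := commJ_block ZJ j k; have [_ ->] := ee j k; ring.
- have [-> _] := commJ_block XJ j k; have [-> _] := commJ_block YJ j k.
  by have [-> _] := commJ_block ZJ j k; have [-> _] := ee j k.
Qed.

End HermitianComponents.

Section Spatial.
Context {R : realType} {n : nat} (U : open_set 'rV[R]_(n + n)).
Variable gam : 'rV[R]_(n + n) -> 'M[R]_(n + n).
Local Notation m := (n + n)%N.
Hypothesis gam_smooth : forall a b, smooth_on (oset U) (fun x => gam x a b).
Hypothesis gamT : forall x, oset U x -> (gam x)^T = gam x.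
Hypothesis gamJ : forall x, oset U x -> Jmx *m gam x *m Jmx^T = gam x.
Hypothesis gam_pos : forall x (w : 'rV[R]_m), oset U x -> w != 0 ->
  0 < (w *m gam x *m w^T) 0 0.
Hypothesis gam_closed : forall x a b c, oset U x ->
  partial a (fun y => (Jmx *m gam y) b c) x + partial b (fun y => (Jmx *m gam y) c a) x
  + partial c (fun y => (Jmx *m gam y) a b) x = 0.

Lemma metric_frame x : oset U x -> exists C : 'M[R]_m, C *m gam x *m C^T = 1%:M.
Proof. by move=> Ux; apply: orthonormal_frame; [exact: gamT|move=> w; exact: gam_pos]. Qed.

Lemma metric_det x : oset U x -> \det (gam x) != 0.
Proof. by move=> /metric_frame[C /frame_det]. Qed.

Let v (a : 'I_m) : 'rV[R]_m := delta_mx 0 a.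
Let sm a b : smooth_along v U (fun x => gam x a b) := @gam_smooth a b.

(** The ring of functions on a chart, without time direction: it also covers t = 0, which the open
    space-time set does not reach. *)
Lemma spatial_curvature x : oset U x ->
  [/\ forall a b, Jmx *m curvature_op gam x a b = curvature_op gam x a b *m Jmx,
      (Rc gam x)^T = Rc gam x & Jmx *m Rc gam x = Rc gam x *m Jmx].
Proof.
move=> Ux; pose u : set_type (oset U) := exist _ x (mem_set Ux).
have [Gi [GGi GiG]] := smooth_mx_inv (fun u => (eq_ind_r (fun X => \det X != 0)
  (metric_det (set_valP u)) (eval_G sm u)) : \det (map_mx (eval_at u) (smooth_metric sm)) != 0).
split.
- by move=> a b; exact: (@dir_curvJ _ _ _ _ v U id gam sm gamT gamJ gam_closed Gi GGi GiG a b u).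
- exact: (@dir_ricT _ _ _ _ v U id gam sm gamT gamJ gam_closed Gi GGi GiG u).
- exact: (@dir_ricJ _ _ _ _ v U id gam sm gamT gamJ gam_closed Gi GGi GiG u).
Qed.

End Spatial.

(** * Limits of matrix expressions *)

Section CvgMatrix.
Context {R : realType} {T : Type} (F : set_system T) {FF : Filter F}.

Lemma cvgr_sum (I : Type) (r : seq I) (f : I -> T -> R) (l : I -> R) :
    (forall i, f i x @[x --> F] --> l i) ->
  \sum_(i <- r) f i x @[x --> F] --> \sum_(i <- r) l i.
Proof.
move=> fl; elim: r => [|i r IHr].
  by under eq_cvg do rewrite big_nil; rewrite big_nil; exact: cvg_cst.
by under eq_cvg do rewrite big_cons; rewrite big_cons; exact: cvgD.
Qed.

Lemma cvgr_prod (I : Type) (r : seq I) (f : I -> T -> R) (l : I -> R) :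
    (forall i, f i x @[x --> F] --> l i) ->
  \prod_(i <- r) f i x @[x --> F] --> \prod_(i <- r) l i.
Proof.
move=> fl; elim: r => [|i r IHr].
  by under eq_cvg do rewrite big_nil; rewrite big_nil; exact: cvg_cst.
by under eq_cvg do rewrite big_cons; rewrite big_cons; exact: cvgM.
Qed.

Definition cvg_mx p q (X : T -> 'M[R]_(p, q)) (L : 'M[R]_(p, q)) :=
  forall i j, X x i j @[x --> F] --> L i j.

Lemma cvg_mxM p q r (X : T -> 'M[R]_(p, q)) (Y : T -> 'M[R]_(q, r)) L K :
  cvg_mx X L -> cvg_mx Y K -> cvg_mx (fun x => X x *m Y x) (L *m K).
Proof.
move=> XL YK i j; under eq_cvg do rewrite mxE; rewrite mxE.
by apply: cvgr_sum => k; exact: cvgM.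
Qed.

Lemma cvg_mxtrace p (X : T -> 'M[R]_p) L : cvg_mx X L ->
  \tr (X x) @[x --> F] --> \tr L.
Proof. by move=> XL; apply: cvgr_sum => k; exact: XL. Qed.

Lemma cvg_det p (X : T -> 'M[R]_p) L : cvg_mx X L -> \det (X x) @[x --> F] --> \det L.
Proof.
move=> XL; apply: cvgr_sum => s; apply: cvgM; first exact: cvg_cst.
by apply: cvgr_prod => i; exact: XL.
Qed.

(** [invmx] returns a singular matrix unchanged; with all determinants nonzero the cofactor formula
    holds everywhere. *)
Lemma cvg_invmx p (X : T -> 'M[R]_p) L : \det L != 0 -> (forall x, \det (X x) != 0) ->
  cvg_mx X L -> cvg_mx (fun x => invmx (X x)) (invmx L).
Proof.
move=> L0 X0 XL i j.
have e (Y : 'M[R]_p) : \det Y != 0 -> invmx Y i j = (\det Y)^-1 * cofactor Y j i.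
  by move=> Y0; rewrite /invmx unitmxE unitfE Y0 !mxE.
under eq_cvg do rewrite e //; rewrite e //.
apply: cvgM; first by apply: cvgV => //; exact: cvg_det.
apply: cvgM; first exact: cvg_cst.
apply: cvg_det => k l.
under eq_cvg do rewrite !mxE; rewrite !mxE; exact: XL.
Qed.

End CvgMatrix.

Lemma cvg_within_near (R : realType) (T : topologicalType) (f : T -> R) (A : set T) (z : T) (l : R) :
  (\near z, A z) -> f @ within A (nbhs z) --> l -> f @ nbhs z --> l.
Proof.
move=> nA; apply: cvg_trans; apply: cvg_app => P H.
have {}H : \forall y \near z, A y -> P y by exact: H.
have : \forall y \near z, P y by apply: filterS2 H nA => y; apply.
exact.
Qed.

Section SpaceTime.
Context {R : realType} {m : nat} (U : open_set 'rV[R]_m).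
Local Notation V := ('rV[R]_m).
Local Notation ST := (R * V)%type.

(** Time 0 is left out to have an open set, on which the time derivative is two-sided, that is, a
    directional derivative. *)
Definition spacetime_set : set ST := [set z | 0 < z.1 /\ oset U z.2].

Lemma open_spacetime_set : open spacetime_set.
Proof.
have -> : spacetime_set = [set t | 0 < t] `*` oset U by [].
rewrite openE => -[t x] [/= t0 Ux]; exists ([set t | 0 < t], oset U) => //=.
split; apply: open_nbhs_nbhs; split => //; exact: open_oset.
Qed.

Definition spacetime := OpenSet open_spacetime_set.

Definition spacetime_dir (o : option 'I_m) : ST :=
  if o is Some a then (0, delta_mx 0 a) else (1, 0).
Local Notation v := spacetime_dir.

Lemma spatial_quotient (F : ST -> R) t x (w : V) :
  (fun h : R => h^-1 *: ((F \o shift (t, x)) (h *: (0, w)) - F (t, x))) =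
  (fun h => h^-1 *: (((fun y => F (t, y)) \o shift x) (h *: w) - F (t, x))).
Proof.
apply/funext => h /=; congr (_ *: (F _ - _)).
by change ((h * 0 + t, h *: w + x) = (t, h *: w + x)); rewrite mulr0 add0r.
Qed.

Lemma derive_spatial (F : ST -> R) t x (w : V) :
  'D_((0, w) : ST) F (t, x) = 'D_w (fun y => F (t, y)) x.
Proof. by rewrite /derive spatial_quotient. Qed.

Lemma derivable_spatial (F : ST -> R) t x (w : V) :
  derivable (fun y => F (t, y)) x w -> derivable F (t, x) ((0, w) : ST).
Proof. by rewrite /derivable spatial_quotient. Qed.

Lemma time_quotientE (F : ST -> R) t x :
  (fun h : R => h^-1 *: ((F \o shift (t, x)) (h *: (1, 0)) - F (t, x))) =
  time_quotient (fun s => F (s, x)) t.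
Proof.
apply/funext => h; rewrite /time_quotient /=; congr (_ * (F _ - _)).
by change ((h * 1 + t, h *: 0 + x) = (t + h, x)); rewrite mulr1 scaler0 add0r addrC.
Qed.

Lemma derive_time (F : ST -> R) t x : 0 < t ->
  'D_((1, 0) : ST) F (t, x) = time_derive (fun s => F (s, x)) t.
Proof. by move=> t0; rewrite /derive time_quotientE /time_derive time_nbhs_dnbhs. Qed.

Lemma derivable_time (F : ST -> R) t x : 0 < t ->
  time_derivable (fun s => F (s, x)) t -> derivable F (t, x) ((1, 0) : ST).
Proof.
by move=> t0; rewrite /derivable /time_derivable time_quotientE time_nbhs_dnbhs.
Qed.

Lemma spacetime_smooth_along (f : R -> V -> R) : spacetime_smooth_on (oset U) f ->
  smooth_along v spacetime (fun z => f z.1 z.2).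
Proof.
move=> sf.
have e s z : spacetime_set z ->
    iter_der v s (fun z => f z.1 z.2) z = spacetime_partials s f z.1 z.2.
  elim: s z => [//|o s IHs] z Dz.
  have ne : \near z, iter_der v s (fun z => f z.1 z.2) z = spacetime_partials s f z.1 z.2.
    by apply: filterS (open_nbhs_nbhs (conj open_spacetime_set Dz)) => y; exact: IHs.
  rewrite /= -/(iter_der v s _) (near_eq_derive _ ne).
  by case: z Dz {ne} => t x [/= t0 Ux]; case: o => [a|]; [rewrite derive_spatial|rewrite derive_time].
move=> s z Dz.
have ne : \near z, spacetime_partials s f z.1 z.2 = iter_der v s (fun z => f z.1 z.2) z.
  by apply: filterS (open_nbhs_nbhs (conj open_spacetime_set Dz)) => y Dy; rewrite e.
have [cf df] := sf s; split=> [|o].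
  have := (subspace_continuousP _ _).1 cf z (conj (ltW Dz.1) Dz.2) => cz.
  rewrite /prop_for /continuous_at e //.
  have cz' : (fun y => spacetime_partials s f y.1 y.2) @ z --> spacetime_partials s f z.1 z.2.
    apply: cvg_within_near cz.
    apply: filterS (open_nbhs_nbhs (conj open_spacetime_set Dz)) => y Dy.
    by split; [exact: ltW Dy.1|exact: Dy.2].
  by apply: cvg_trans cz'; exact: near_eq_cvg.
apply: near_eq_derivable ne _.
case: z Dz => t x [/= t0 Ux]; have [dt dx] := df t x (ltW t0) Ux.
by case: o => [a|]; [exact: derivable_spatial (dx a)|exact: derivable_time dt].
Qed.

End SpaceTime.

Lemma sup_norm_ltP (R : realType) (n : nat) (M : complex_manifold R n)
    (T : ('rV[R]_(n + n) -> 'M[R]_(n + n)) -> 'rV[R]_(n + n) -> tensor4)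
    (g : R -> tensor2 M) :
  (sup_norm T g < +oo)%E <-> exists2 c, 0 <= c & forall t i x, 0 <= t -> chart_img i x ->
    tensor4_norm (g t i x) (T (g t i) x) <= c.
Proof.
split=> [|[c c0 Tc]]; last first.
  apply: (@le_lt_trans _ _ c%:E); last exact: ltry.
  apply: ge_ereal_sup => _ [t [i [x [t0 Ux ->]]]].
  by rewrite lee_fin Tc.
rewrite /sup_norm; set S := (X in ereal_sup X) => Soo.
have ub y : S y -> (y <= ereal_sup S)%E by exact: ereal_sup_ubound.
move: (ereal_sup S) Soo ub => [r| |] // _ ub.
  exists (Num.max 0 r); first by rewrite le_max lexx.
  move=> t i x t0 Ux; rewrite le_max -[X in _ || X]lee_fin; apply/orP; right.
  by apply: ub; exists t, i, x.
(* Here the supremum is -oo, so the set is empty and no point (t, i, x) exists. *)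
exists 0 => // t i x t0 Ux.
by have /ub : S (tensor4_norm (g t i x) (T (g t i) x))%:E by exists t, i, x.
Qed.

Section Flow.
Context {R : realType} {n : nat} {M : complex_manifold R n}.
Local Notation m := (n + n)%N.
Local Notation V := ('rV[R]_(n + n)).
Variable g : R -> tensor2 M.
Hypothesis g_flow : kahler_ricci_flow g.
Implicit Types (t : R) (i j : chart_index M) (x : V) (p : M).

Definition chart_open i : open_set V := OpenSet (@chart_img_open _ _ M i).

Definition dot_g t i x : 'M[R]_m := time_derive_mx (fun s => g s i x) t.

Lemma flow_metric t : 0 <= t -> kahler_metric (g t).
Proof. by move=> t0; have [/(_ t t0)] := g_flow. Qed.

Lemma flow_smooth i a b : spacetime_smooth_on (chart_img i) (fun t x => g t i x a b).
Proof. by have [_ ? _] := g_flow. Qed.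

Lemma flow_time_derivable t i x a b : 0 <= t -> chart_img i x ->
  time_derivable (fun s => g s i x a b) t.
Proof. by move=> t0 Ux; have [_ /(_ t x t0 Ux)[]] := flow_smooth i a b [::]. Qed.

Lemma flow_metricT t i x : 0 <= t -> chart_img i x -> (g t i x)^T = g t i x.
Proof. by move=> /flow_metric[_ /(_ i x)]. Qed.

Lemma flow_metricJ t i x : 0 <= t -> chart_img i x -> Jmx *m g t i x *m Jmx^T = g t i x.
Proof. by move=> /flow_metric[_ _ _ /(_ i x)]. Qed.

Lemma flow_frame t i x : 0 <= t -> chart_img i x ->
  exists C : 'M[R]_m, C *m g t i x *m C^T = 1%:M.
Proof.
move=> t0 Ux; apply: orthonormal_frame; first exact: flow_metricT.
by have [_ _ gpos _ _] := flow_metric t0 => w; exact: gpos.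
Qed.

Lemma flow_det t i x : 0 <= t -> chart_img i x -> \det (g t i x) != 0.
Proof. by move=> t0 Ux; have [C /frame_det] := flow_frame t0 Ux. Qed.

Lemma flow_curvature t i x : 0 <= t -> chart_img i x ->
  [/\ forall a b, Jmx *m curvature_op (g t i) x a b = curvature_op (g t i) x a b *m Jmx,
      (Rc (g t i) x)^T = Rc (g t i) x & Jmx *m Rc (g t i) x = Rc (g t i) x *m Jmx].
Proof.
move=> t0 Ux; have [[sg _] gT gpos gJ gc] := flow_metric t0.
apply: (@spatial_curvature _ _ (chart_open i)) => //.
- by move=> a b; exact: sg.
- by move=> y; exact: gT.
- by move=> y; exact: gJ.
- by move=> y w; exact: gpos.
- by move=> y a b c; exact: gc.
Qed.

(** The flow equation only speaks of the Hermitian components; g, its time derivative and Rc all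
    commute with J, so nothing is lost. *)
Lemma flow_dot t i x : 0 <= t -> chart_img i x ->
  dot_g t i x = g t i x - Rc (g t i) x.
Proof.
move=> t0 Ux; have [_ _ RcJ] := flow_curvature t0 Ux.
apply: hermitian_comp_inj => //.
- apply: commJ_of; apply: esym; apply: time_derive_mx_mul => // [a b|s s0].
    exact: flow_time_derivable.
  by rewrite flow_metricJ.
- by apply: commJ_of; exact: flow_metricJ.
by move=> j k; have [_ _ /(_ t i x j k t0 Ux)] := g_flow.
Qed.

Lemma flow_Rc t i x : 0 <= t -> chart_img i x -> Rc (g t i) x = g t i x - dot_g t i x.
Proof. by move=> t0 Ux; rewrite flow_dot // opprB addrC subrK. Qed.

Definition scal_at t i x : R := \tr (Rc (g t i) x *m invmx (g t i x)).
Definition ric2_at t i x : R :=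
  \tr (Rc (g t i) x *m invmx (g t i x) *m (Rc (g t i) x *m invmx (g t i x))).

Lemma scal_frame t i x C : C *m g t i x *m C^T = 1%:M ->
  scal_at t i x = \tr (frame_mx C (Rc (g t i) x)).
Proof. by move=> e; rewrite (mxtrace_frame e). Qed.

Lemma ric2_frame t i x C : C *m g t i x *m C^T = 1%:M ->
  ric2_at t i x = \tr (frame_mx C (Rc (g t i) x) *m frame_mx C (Rc (g t i) x)).
Proof. by move=> e; rewrite (frame_mxM e) (mxtrace_frame e) /ric2_at mulmxA. Qed.

(* Twice differentiability of the transition maps would need Cauchy's theory, so Rc
   is seen to be a tensor through the flow: it is g minus the time derivative of g. *)
Lemma flow_transition t i j p : 0 <= t -> chart_dom i p -> chart_dom j p ->
  let K := transition_jacobian i j p in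
  g t i (chart i p) = K *m g t j (chart j p) *m K^T /\
  Rc (g t i) (chart i p) = K *m Rc (g t j) (chart j p) *m K^T.
Proof.
move=> t0 ip jp K.
have Ui : chart_img i (chart i p) by exists p.
have Uj : chart_img j (chart j p) by exists p.
have tg s : 0 <= s -> g s i (chart i p) = K *m g s j (chart j p) *m K^T.
  by move=> /flow_metric[[_ /(_ i j p ip jp)]].
split; first exact: tg.
rewrite !flow_Rc // mulmxBr mulmxBl -tg //; congr (_ - _).
by apply: time_derive_mx_mul => // a b; exact: flow_time_derivable.
Qed.

(** If C is a frame in chart i, then C K is one in chart j, and Rc has the same matrix in both. *)
Lemma scal_ric2_transition t i j p : 0 <= t -> chart_dom i p -> chart_dom j p ->
  scal_at t i (chart i p) = scal_at t j (chart j p) /\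
  ric2_at t i (chart i p) = ric2_at t j (chart j p).
Proof.
move=> t0 ip jp; have [eg er] := flow_transition t0 ip jp.
move: (transition_jacobian i j p) eg er => K eg er.
have [|C Ci] := @flow_frame t i (chart i p) t0; first by exists p.
have Cj : (C *m K) *m g t j (chart j p) *m (C *m K)^T = 1%:M.
  by rewrite -Ci eg trmx_mul !mulmxA.
rewrite (scal_frame Ci) (scal_frame Cj) (ric2_frame Ci) (ric2_frame Cj) er.
by rewrite -[K *m _ *m _]/(frame_mx K _) frame_mx_comp.
Qed.

Variable B : R.

Definition barrier_at t i x : R := ric2_at t i x - B * scal_at t i x.

Let chart_cover_sig p := cid (chart_cover p).
Definition chart_of p : chart_index M := projT1 (chart_cover_sig p).
Lemma chart_ofP p : chart_dom (chart_of p) p. Proof. exact: projT2 (chart_cover_sig p). Qed.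

(** A function on R x M read in an arbitrarily chosen chart; [barrierE] shows that the choice does
    not matter for t >= 0. *)
Definition barrier (z : R * M) : R := barrier_at z.1 (chart_of z.2) (chart (chart_of z.2) z.2).

Lemma barrierE t i p : 0 <= t -> chart_dom i p -> barrier (t, p) = barrier_at t i (chart i p).
Proof.
move=> t0 ip; rewrite /barrier /barrier_at /=.
by have [-> ->] := scal_ric2_transition t0 (chart_ofP p) ip.
Qed.

(** Rc is replaced by g minus its time derivative, two entries of the space-time smoothness that are
    jointly continuous up to t = 0; Christoffel symbols never enter. *)
Lemma barrier_continuous :
  {within [set z : R * M | 0 <= z.1], continuous barrier}.
Proof.
apply/subspace_continuousP => -[t p] /= t0; set F := within _ _.
pose i := chart_of p; have ip : chart_dom i p := chart_ofP p.
pose phi (z : R * M) : R * V := (z.1, chart i z.2).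
have near_dom : \forall z \near F, 0 <= z.1 /\ chart_dom i z.2.
  rewrite /F near_withinE.
  have : \forall z \near (t, p), chart_dom i z.2.
    exists (setT, chart_dom i) => /=; last by move=> z [].
    split; first exact: filterT.
    by apply: open_nbhs_nbhs; split => //; exact: chart_dom_open.
  by apply: filterS => z zi z0.
have cchart : chart i @ p --> chart i p.
  have := @chart_continuous _ _ M i; rewrite continuous_open_subspace; last exact: chart_dom_open.
  by move=> /(_ p); rewrite inE => /(_ ip).
have cphi : phi z @[z --> F] --> within [set w : R * V | 0 <= w.1 /\ chart_img i w.2]
    (nbhs (t, chart i p)).
  move=> P HP.
  have c : phi z @[z --> (t, p)] --> (t, chart i p).
    have c1 : fst @ nbhs (t, p) --> t by exact: cvg_fst.
    have c2 : (fun z : R * M => chart i z.2) @ nbhs (t, p) --> chart i p.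
      by apply: cvg_comp cchart; exact: cvg_snd.
    exact: (cvg_pair c1 c2).
  have H1 : \forall z \near F, 0 <= (phi z).1 /\ chart_img i (phi z).2 -> P (phi z).
    have H : \forall z \near (t, p), 0 <= (phi z).1 /\ chart_img i (phi z).2 -> P (phi z).
      exact: (c [set w | 0 <= w.1 /\ chart_img i w.2 -> P w] HP).
    by rewrite /F near_withinE; apply: filterS H => z Hz _; exact: Hz.
  have : \forall z \near F, P (phi z).
    apply: filterS2 H1 near_dom => z H [z0 zi]; apply: H; split => //.
    by exists z.2.
  exact.
have cg a b : g z.1 i (chart i z.2) a b @[z --> F] --> g t i (chart i p) a b.
  have [/subspace_continuousP cc _] := flow_smooth i a b [::].
  apply: (cvg_comp phi (fun w : R * V => g w.1 i w.2 a b) cphi).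
  by apply: (cc (t, chart i p)); split => //; exists p.
have cdg a b : dot_g z.1 i (chart i z.2) a b @[z --> F] --> dot_g t i (chart i p) a b.
  have [/subspace_continuousP cc _] := flow_smooth i a b [:: None].
  rewrite [dot_g t _ _ _ _]mxE; under eq_cvg do rewrite mxE.
  apply: (cvg_comp phi
    (fun w : R * V => time_derive (fun s => g s i w.2 a b) w.1) cphi).
  by apply: (cc (t, chart i p)); split => //; exists p.
(* Off the chart the identity serves as default, since [cvg_invmx] wants an invertible matrix
   everywhere. *)
pose G (z : R * M) : 'M[R]_m := if `[< 0 <= z.1 /\ chart_dom i z.2 >]
  then g z.1 i (chart i z.2) else 1%:M.
pose S (z : R * M) : 'M[R]_m := G z - dot_g z.1 i (chart i z.2).
have nG : \forall z \near F, g z.1 i (chart i z.2) = G z.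
  apply: filterS near_dom => z zi; rewrite /G; case: asboolP => //.
have cG : cvg_mx F G (g t i (chart i p)).
  move=> a b; apply: cvg_trans (cg a b); apply: near_eq_cvg.
  by apply: filterS nG => z ->.
have cS : cvg_mx F S (Rc (g t i) (chart i p)).
  move=> a b; rewrite flow_Rc //; last by exists p.
  under eq_cvg do rewrite 2!mxE.
  by rewrite 2!mxE; apply: cvgB; [exact: cG|exact: cdg].
have detG s q : 0 <= s -> chart_dom i q -> \det (g s i (chart i q)) != 0.
  by move=> s0 iq; apply: flow_det => //; exists q.
have cGi : cvg_mx F (fun z => invmx (G z)) (invmx (g t i (chart i p))).
  apply: cvg_invmx => //; first exact: detG.
  by move=> z; rewrite /G; case: asboolP => [[z0 zi]|_]; [exact: detG|rewrite det1 oner_eq0].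
have FF : Filter F by exact: within_filter.
have cA : cvg_mx F (fun z => S z *m invmx (G z))
    (Rc (g t i) (chart i p) *m invmx (g t i (chart i p))) by exact: cvg_mxM.
have suff_b : barrier z @[z --> F] --> barrier (t, p); last by exact: suff_b.
rewrite (barrierE t0 ip).
pose f (z : R * M) := \tr (S z *m invmx (G z) *m (S z *m invmx (G z)))
  - B * \tr (S z *m invmx (G z)).
have cf : f z @[z --> F] --> barrier_at t i (chart i p).
  have c1 : \tr (S z *m invmx (G z) *m (S z *m invmx (G z))) @[z --> F] -->
      ric2_at t i (chart i p).
    by apply: cvg_mxtrace; exact: cvg_mxM.
  have c2 : \tr (S z *m invmx (G z)) @[z --> F] --> scal_at t i (chart i p).
    exact: cvg_mxtrace.
  exact: (cvgB c1 (@cvgMl_tmp _ _ _ _ _ B _ c2)).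
apply: cvg_trans cf; apply: near_eq_cvg.
apply: filterS2 nG near_dom => -[s q] eG [/= s0 iq].
rewrite (barrierE s0 iq) /f /barrier_at /scal_at /ric2_at /S -eG /= -flow_Rc //.
by exists q.
Qed.

End Flow.

(** * Space-time directions and the curvature of time slices *)

Section SpacetimeCurvature.
Context {R : realType} {n : nat}.
Local Notation m := (n + n)%N.
Local Notation V := ('rV[R]_(n + n)).
Variable h : R -> V -> 'M[R]_(n + n).
Implicit Types (t : R) (x : V) (a b c d : 'I_m).
Let gam (z : R * V) := h z.1 z.2.
Local Notation v := (@spacetime_dir R m).

Lemma dirpart_spacetime a (F : R * V -> R) t x :
  dirpart v Some a F (t, x) = partial a (fun y => F (t, y)) x.
Proof. exact: derive_spatial. Qed.

Lemma dir_christoffel_spacetime a b c t x :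
  dir_christoffel v Some gam a b c (t, x) = christoffel (h t) x a b c.
Proof.
congr (_ * _); apply: eq_bigr => d _.
by rewrite (dirpart_spacetime a) (dirpart_spacetime b) (dirpart_spacetime d).
Qed.

Lemma dir_curv_spacetime a b t x :
  dir_curv v Some gam a b (t, x) = curvature_op (h t) x a b.
Proof.
have e p q c d : dirpart v Some p (dir_christoffel v Some gam q c d) (t, x) =
    partial p (fun y => christoffel (h t) y q c d) x.
  rewrite dirpart_spacetime; congr (partial p _ x); apply/funext => y.
  exact: dir_christoffel_spacetime.
apply/matrixP=> c d; rewrite [LHS]mxE [RHS]mxE (e a) (e b); congr (_ + _).
by apply: eq_bigr => k _; rewrite !dir_christoffel_spacetime.
Qed.

Lemma dir_ric_spacetime t x : dir_ric v Some gam (t, x) = Rc (h t) x.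
Proof.
apply/matrixP=> b d; rewrite [LHS]mxE [RHS]mxE; apply: eq_bigr => a _.
by rewrite dir_curv_spacetime.
Qed.

Lemma dir_Rm_spacetime t x a b c d : dir_Rm v Some gam (t, x) a b c d = Rm (h t) x a b c d.
Proof. by apply: eq_bigr => k _; rewrite dir_curv_spacetime. Qed.

Lemma dir_Rm_ric_ric_spacetime t x C : C *m h t x *m C^T = 1%:M ->
  dir_Rm_ric_ric v Some gam (t, x) =
  \sum_p \sum_q \sum_r \sum_s frame_tensor C (Rm (h t) x) p q r s *
    (frame_mx C (Rc (h t) x) p r * frame_mx C (Rc (h t) x) q s).
Proof.
move=> Ch; rewrite -(frame_Rm_ric_ric Ch).
apply: eq_bigr => a _; apply: eq_bigr => b _; apply: eq_bigr => c _; apply: eq_bigr => d _.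
by rewrite dir_Rm_spacetime dir_ric_spacetime.
Qed.

Lemma dirvec_spacetime (c : 'I_m -> R) : exists w, dirvec v Some c = (0, w).
Proof.
rewrite /dirvec; elim/big_ind: _ => [|_ _ [w ->] [w' ->]|a _].
- by exists 0.
- by exists (w + w'); rewrite -[LHS]/(0 + 0, w + w') addr0.
- by exists (c a *: delta_mx 0 a); rewrite -[LHS]/(c a * 0, c a *: delta_mx 0 a) mulr0.
Qed.

End SpacetimeCurvature.

Section MaximumPrinciple.
Context {R : realType} {n : nat} {M : complex_manifold R n}.
Local Notation m := (n + n)%N.
Local Notation V := ('rV[R]_(n + n)).
Variable g : R -> tensor2 M.
Hypothesis g_flow : kahler_ricci_flow g.
Implicit Types (t : R) (i : chart_index M) (x : V) (p : M).
Local Notation v := (@spacetime_dir R m).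

(** [flow_at_max] on the space-time chart, where t > 0 places (t, x) in the open set. Spatial
    directions keep t fixed, so the two maximum hypotheses can be separate. *)
Lemma barrier_at_max t i x C B : 0 < t -> chart_img i x -> C *m g t i x *m C^T = 1%:M ->
    (\forall y \near x, barrier_at g B t i y <= barrier_at g B t i x) ->
    (\forall s \near t, s <= t -> barrier_at g B s i x <= barrier_at g B t i x) ->
  0 <= (\sum_p \sum_q \sum_r \sum_s frame_tensor C (Rm (g t i) x) p q r s *
         (frame_mx C (Rc (g t i) x) p r * frame_mx C (Rc (g t i) x) q s)) *+ 2
       - ric2_at g t i x *+ 2 - B * (ric2_at g t i x - scal_at g t i x).
Proof.
move=> t0 Ux Ci xmax tmax.
pose D := spacetime (chart_open i); pose gam (z : R * V) := g z.1 i z.2.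
pose u : set_type (oset D) := exist _ (t, x) (mem_set (conj t0 Ux)).
have sm a b : smooth_along v D (fun z => gam z a b).
  exact: (@spacetime_smooth_along _ _ (chart_open i) _ (flow_smooth g_flow i a b)).
have gamT z : oset D z -> (gam z)^T = gam z.
  by move=> [z0 Uz]; exact: (flow_metricT g_flow (ltW z0) Uz).
have gamJ z : oset D z -> Jmx *m gam z *m Jmx^T = gam z.
  by move=> [z0 Uz]; exact: (flow_metricJ g_flow (ltW z0) Uz).
have gam_closed z a b c : oset D z ->
    dirpart v Some a (fun y => (Jmx *m gam y) b c) z
    + dirpart v Some b (fun y => (Jmx *m gam y) c a) z
    + dirpart v Some c (fun y => (Jmx *m gam y) a b) z = 0.
  case: z => s y [s0 Uy]; rewrite !dirpart_spacetime.
  by have [_ _ _ _ gc] := flow_metric g_flow (ltW s0); exact: gc.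
have gam_det (w : set_type (oset D)) : \det (map_mx (eval_at w) (smooth_metric sm)) != 0.
  rewrite eval_G; have [w0 Uw] := set_valP w; exact: (flow_det g_flow (ltW w0) Uw).
have [Gi [GGi GiG]] := smooth_mx_inv gam_det.
have dric z : oset D z -> dir_ric v Some gam z = Rc (g z.1 i) z.2.
  by case: z => s y _; exact: (dir_ric_spacetime (fun s => g s i)).
have dscal z : oset D z -> dir_scal v Some gam z = scal_at g z.1 i z.2.
  by move=> Dz; rewrite /dir_scal dric.
have dric2 z : oset D z -> dir_ric2 v Some gam z = ric2_at g z.1 i z.2.
  by move=> Dz; rewrite /dir_ric2 dric.
have := @flow_at_max _ _ _ _ v D Some gam sm gamT gamJ gam_closed Gi GGi GiG None C B u.
rewrite (dscal (val u) (set_valP u)) (dric2 (val u) (set_valP u)).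
rewrite (dir_Rm_ric_ric_spacetime (h := fun s => g s i) Ci).
apply.
- move=> [s y] a b [/= s0 Uy]; have -> : dir_ric v Some gam (s, y) = g s i y - dot_g g s i y.
    by rewrite dric // -(flow_Rc g_flow (ltW s0) Uy).
  rewrite 2!mxE [dot_g _ _ _ _ _ _]mxE opprB addrC subrK.
  exact: (@derive_time _ _ (fun z : R * V => g z.1 i z.2 a b) s y s0).
- exact: invmx_frame Ci.
- move=> c; have [w cw] := @dirvec_spacetime R n c.
  have xw : \forall r \near (0 : R), barrier_at g B t i (x + r *: w) <= barrier_at g B t i x.
    have cxw : {for 0, continuous (fun r : R => x + r *: w)}.
      apply: continuousD; first exact: cst_continuous.
      exact: scalel_continuous.
    apply: (cxw [set y | barrier_at g B t i y <= barrier_at g B t i x]).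
    by rewrite /= scale0r addr0.
  apply: filterS2 xw (near_line u (dirvec v Some c)) => r xr Dr.
  rewrite (dscal _ Dr) (dric2 _ Dr) cw.
  rewrite -[(t, x) + r *: (0, w)]/(t + r * 0, x + r *: w) mulr0 addr0.
  exact: xr.
have tr : \forall r \near (0 : R), t + r <= t ->
    barrier_at g B (t + r) i x <= barrier_at g B t i x.
  have ctr : {for 0, continuous (fun r : R => t + r)}.
    by apply: cvgD; [exact: cvg_cst|exact: cvg_id].
  apply: (ctr [set s | s <= t -> barrier_at g B s i x <= barrier_at g B t i x]).
  by rewrite /= addr0.
apply: filterS2 tr (near_line u (v None)) => r xr Dr r0.
rewrite (dscal _ Dr) (dric2 _ Dr).
rewrite -[(t, x) + r *: (1, 0)]/(t + r * 1, x + r *: 0) mulr1 scaler0 addr0.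
by apply: xr; rewrite gerDl.
Qed.

End MaximumPrinciple.

(** Here r, N and X are R, |Rc|^2 and Rm(Rc, Rc). Since 2 X is at most 2 a N plus a constant, the
    coefficient 2 a of the barrier cancels 2 a N exactly, and -2 N remains to bound N by a r plus a
    constant. *)
Lemma barrier_arith (R : realFieldType) (w c r N X : R) :
    let a := 16 * w + 5 / 12 * c in
    0 <= a -> 0 <= N -> `|r| <= c ->
    X <= (16 * w + 5 / 12 * `|r|) * N + 24^-1 * `|r| ^+ 3 ->
    0 <= X *+ 2 - N *+ 2 - 2 * a * (N - r) ->
  N - 2 * a * r <= 24^-1 * c ^+ 3 + 3 * (a * c).
Proof.
move=> a a0 N0 rc Xle.
have r3 : 24^-1 * `|r| ^+ 3 <= 24^-1 * c ^+ 3.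
  by rewrite ler_pM2l ?invr_gt0 ?ltr0n // lerXn2r ?nnegrE // (le_trans _ rc).
have aN : (16 * w + 5 / 12 * `|r|) * N <= a * N by apply: ler_wpM2r => //; rewrite /a; lra.
have ar : a * r <= a * c by apply: ler_wpM2l => //; exact: le_trans (ler_norm r) rc.
have ar' : - (a * r) <= a * c.
  by rewrite -mulrN; apply: ler_wpM2l => //; rewrite (le_trans _ rc) // -normrN ler_norm.
clearbody a; move: (c ^+ 3) (`|r| ^+ 3) r3 Xle => c3 r3 r3c Xle.
rewrite -!mulrA mulrBr !mulr2n; lra.
Qed.

(** * The maximum principle *)

Section Bound.
Context {R : realType} {n : nat} {M : complex_manifold R n}.
Local Notation m := (n + n)%N.
Local Notation V := ('rV[R]_(n + n)).
Hypothesis M_closed : compact [set: M].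
Variable g : R -> tensor2 M.
Hypothesis g_flow : kahler_ricci_flow g.
Implicit Types (t : R) (i : chart_index M) (x : V) (p : M).

Lemma barrier_max B T p : 0 <= T -> exists t q, 0 <= t <= T /\
  forall s q', 0 <= s <= T -> barrier g B (s, q') <= barrier g B (t, q).
Proof.
move=> T0; pose A : set (R * M) := `[0, T] `*` [set: M].
have [|||[t q]] := @compact_EVT_max (R * M)%type R (barrier g B) A.
- by exists (0, p); split => //=; rewrite in_itv /= lexx.
- by apply: compact_setX => //; exact: segment_compact.
- apply: continuous_subspaceW (barrier_continuous g_flow (B := B)).
  by move=> [s q] [/=]; rewrite in_itv /= => /andP[].
rewrite inE => -[/= tT _] mx; exists t, q; split; first by move: tT; rewrite in_itv.
by move=> s q' sT; apply: mx; rewrite inE; split => //=; rewrite in_itv.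
Qed.

(** Over [0, T] the maximum is attained either at time 0, where it is at most the maximum over M of
    the initial barrier, or at a positive time, where k bounds it. Neither bound depends on T. *)
Lemma barrier_bounded B k :
    (forall t i x, 0 < t -> chart_img i x ->
      (\forall y \near x, barrier_at g B t i y <= barrier_at g B t i x) ->
      (\forall s \near t, s <= t -> barrier_at g B s i x <= barrier_at g B t i x) ->
      barrier_at g B t i x <= k) ->
  exists K, forall t i x, 0 <= t -> chart_img i x -> barrier_at g B t i x <= K.
Proof.
move=> Bk.
have [[p0 _]|M0] := pselect (exists p : M, True); last first.
  by exists 0 => t i x _ [p]; case: M0; exists p.
(* The case T = 0 gives the maximum of the initial barrier over M. *)
have [t0 [q0 [t00 mx0]]] := barrier_max B p0 (lexx 0).
exists (Num.max (barrier g B (t0, q0)) k) => T i x T0 [p ip <-].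
have [t [q [/andP[t_ge0 tT] mx]]] := barrier_max B p T0.
rewrite -(barrierE g_flow B T0 ip); apply: (@le_trans _ _ (barrier g B (t, q))).
  by apply: mx; rewrite T0 lexx.
rewrite le_max; move: t_ge0; rewrite le_eqVlt => /predU1P[<-|t_gt0].
  by rewrite mx0 ?lexx.
apply/orP; right; have jq := chart_ofP q; rewrite (barrierE g_flow B (ltW t_gt0) jq).
have Ux : chart_img (chart_of q) (chart (chart_of q) q) by exists q.
apply: Bk => //.
  apply: filterS (open_nbhs_nbhs (conj (@chart_img_open _ _ M _) Ux)) => _ [q' jq' <-].
  rewrite -(barrierE g_flow B (ltW t_gt0) jq) -(barrierE g_flow B (ltW t_gt0) jq').
  by apply: mx; rewrite tT ltW.
have : \forall s \near t, 0 < s by exact: lt_nbhsr.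
apply: filterS => s s0 st.
rewrite -(barrierE g_flow B (ltW t_gt0) jq) -(barrierE g_flow B (ltW s0) jq).
by apply: mx; rewrite ltW //= (le_trans st).
Qed.

Section WeylBound.
Variable w : R.
Hypothesis w0 : 0 <= w.
Hypothesis Ww : forall t i x, 0 <= t -> chart_img i x ->
  tensor4_norm (g t i x) (weyl (g t i) x) <= w.
Hypothesis m3 : (2 < m)%N.

(** The bound for |R| from [scal_le]; a is then the coefficient of |Rc|^2 in [frame_Rm_ric_ric_le]
    with |R| replaced by c. *)
Let c := (m%:R - 1) / (m%:R - 2) * (m%:R ^+ 4 * w) : R.
Let a := 16 * w + 5 / 12 * c.

Let Wf t i x C : 0 <= t -> chart_img i x -> C *m g t i x *m C^T = 1%:M ->
  forall p q r s : 'I_m, `|frame_tensor C (weyl (g t i) x) p q r s| <= w.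
Proof.
by move=> t0 Ux Ci p q r s; exact: le_trans (frame_tensor_le _ _ _ _ _ (invmx_frame Ci)) (Ww t0 Ux).
Qed.

Let flowJ t i x : 0 <= t -> chart_img i x -> Jmx *m g t i x = g t i x *m Jmx.
Proof. by move=> t0 Ux; apply: commJ_of; exact: flow_metricJ. Qed.

Lemma flow_scal_le t i x : 0 <= t -> chart_img i x -> `|scal_at g t i x| <= c.
Proof.
move=> t0 Ux; have [C Ci] := flow_frame g_flow t0 Ux.
have [OmJ RcT RcJ] := flow_curvature g_flow t0 Ux.
rewrite (scal_frame Ci).
exact: (frame_scal_le Ci m3 (flowJ t0 Ux) RcT RcJ OmJ (Wf t0 Ux Ci)).
Qed.

Lemma flow_ric_bounded : exists rc : R, forall t i x C, 0 <= t -> chart_img i x ->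
  C *m g t i x *m C^T = 1%:M -> forall p q : 'I_m, `|frame_mx C (Rc (g t i) x) p q| <= rc.
Proof.
have [m4|m4] := ltnP 4 m.
  exists (((m%:R - 2) * (m%:R ^+ 3 * w) + (m%:R ^+ 4 * w) / (m%:R - 2)) / (m%:R - 4)).
  move=> t i x C t0 Ux Ci p q; have [OmJ RcT RcJ] := flow_curvature g_flow t0 Ux.
  exact: (frame_ric_le Ci m3 (flowJ t0 Ux) RcT RcJ OmJ (Wf t0 Ux Ci)).
have n2 : n = 2%N by lia.
have c0 : 0 <= c.
  apply: mulr_ge0; last by rewrite mulr_ge0 ?exprn_ge0.
  by apply: divr_ge0; rewrite subr_ge0 ?ler1n ?ler_nat; lia.
have a0 : 0 <= a by move: c0 w0; rewrite /a; move: (c) => k; lra.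
have [|K FK] := @barrier_bounded (2 * a) (24^-1 * c ^+ 3 + 3 * (a * c)).
  move=> t i x t_gt0 Ux xmax tmax; have t0 := ltW t_gt0.
  have [C Ci] := flow_frame g_flow t0 Ux.
  have [OmJ RcT RcJ] := flow_curvature g_flow t0 Ux.
  have := barrier_at_max g_flow t_gt0 Ux Ci xmax tmax.
  have := frame_Rm_ric_ric_le Ci (flowJ t0 Ux) RcT RcJ (Wf t0 Ux Ci) w0 n2.
  have := flow_scal_le t0 Ux.
  have N0 : 0 <= ric2_at g t i x.
    rewrite (ric2_frame Ci); pose p0 := Ordinal (ltnW (ltnW m3)).
    exact: le_trans (sqr_ge0 _) (norm_frame_le C p0 p0 RcT).
  rewrite /barrier_at -(scal_frame Ci) -(ric2_frame Ci).
  exact: barrier_arith.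
(* |Rc|^2 is the barrier plus 2 a R, hence at most K + 2 a c. *)
exists (Num.sqrt (K + 2 * a * c)) => t i x C t0 Ux Ci p q.
have [_ RcT _] := flow_curvature g_flow t0 Ux.
rewrite -sqrtr_sqr; apply: ler_wsqrtr; apply: le_trans (norm_frame_le C p q RcT) _.
rewrite -(ric2_frame Ci); have := FK t i x t0 Ux; rewrite /barrier_at.
have : 2 * a * scal_at g t i x <= 2 * a * c.
  apply: ler_wpM2l; first by rewrite mulr_ge0.
  exact: le_trans (ler_norm _) (flow_scal_le t0 Ux).
lra.
Qed.

End WeylBound.
End Bound.

Theorem corollary1p3 (R : realType) (n : nat) (hn : (3 <= n + n)%N)
    (M : complex_manifold R n) (M_closed : compact [set: M])
    (M_c1 : c1_positive M)
    (g : R -> tensor2 M) (g_flow : kahler_ricci_flow g) :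
  (sup_norm (@Rm R (n + n)) g < +oo)%E <->
  (sup_norm (@weyl R (n + n)) g < +oo)%E.
Proof.
rewrite !sup_norm_ltP; split=> [] [w w0 Ww].
  (* This direction is pointwise: in a frame Rc is a trace of Rm, so its entries are at most (n + n)
     w, and [weyl_kn_le] bounds the distance from Rm to W. *)
  exists (Num.sqrt (((n + n) ^ 4)%:R * (w + 8 * (n + n)%:R * ((n + n)%:R * w)) ^+ 2)).
    exact: sqrtr_ge0.
  move=> t i x t0 Ux; have [C Ci] := flow_frame g_flow t0 Ux.
  by apply: (weyl_norm_le Ci hn); exact: Ww.
have [rc ric_le] := flow_ric_bounded M_closed g_flow w0 Ww hn.
exists (Num.sqrt (((n + n) ^ 4)%:R * (w + 8 * (n + n)%:R * rc) ^+ 2)); first exact: sqrtr_ge0.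
move=> t i x t0 Ux; have [C Ci] := flow_frame g_flow t0 Ux.
apply: (Rm_norm_le Ci hn w0); last exact: ric_le.
by move=> p q r s; exact: le_trans (frame_tensor_le _ _ _ _ _ (invmx_frame Ci)) (Ww _ _ _ t0 Ux).
Qed.
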